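(* Let $Q$ be an $n\times n$ GOE matrix, i.e. a random real symmetric matrix whose diagonal entries are i.i.d. $N(0,1)$ and whose off-diagonal entries $(Q_{ij})_{i<j}$ are i.i.d. $N(0,1/2)$, all mutually independent. There exists $K<\infty$ such that $$\mathbb{P}\bigl(\text{the optimizer of the DNN problem }\vartheta(Q)\text{ is unique and rank one}\bigr)\ge 1-K\frac{(\ln n)^2}{n^3}.$$ On the same event, the exact optimizer can be recovered in $O(n^2)$ time: given the matrix entries, one computes $m_n$, builds the defect graph $G_n^-$ by scanning the off-diagonal entries, extracts its connected components, and solves the constant-size local KKT systems on components of sizes at most four. Since the input has $N=n^2$ entries, the running time is, equivalently, linear in the input size.
   Context: $m_n:=\min_{1\le i\le n}Q_{ii}$, and the defect graph $G_n^-$ is the graph on $\{1,\dots,n\}$ with edges the pairs $\{i,j\}$, $i<j$, such that $Q_{ij}<m_n$. The DNN (doubly nonnegative) problem is $$\vartheta(Q):=\min\{\langle Q,X\rangle:\ \langle E,X\rangle=1,\ X\succeq0,\ X\ge0\},$$ over symmetric $X\in\mathbb{R}^{n\times n}$, where $E$ is the all-ones matrix, $\langle A,B\rangle=\operatorname{tr}(A^\top B)$, $X\succeq0$ means positive semidefinite and $X\ge0$ means entrywise nonnegative. It is the DNN relaxation of the standard quadratic program $\min\{x^\top Qx: x\in\mathbb{R}^n,\ x\ge0,\ \mathbf 1^\top x=1\}$, with $\mathbf 1$ the all-ones vector. The local KKT systems on a component $C$ are, for the nonempty subsets $T\subseteq C$, the linear systems $Q[T]x=\lambda\mathbf 1$,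 $\mathbf 1^\top x=1$ in the unknowns $x\in\mathbb{R}^{|T|}$ and $\lambda\in\mathbb{R}$, where $Q[T]$ is the principal submatrix of $Q$ indexed by $T$.
   Formalization: The O(n²) recovery is proved on the event that the optimizer is unique and rank one and all components of the defect graph have size at most four; this event satisfies the same probability bound. On the uniqueness event alone it fails (n=5, Q=2I−E). *)

(* Defs.v *)
From HB Require Import structures.
From mathcomp Require Import all_boot all_order all_algebra.
From mathcomp Require Import all_classical all_reals all_analysis.

Set Implicit Arguments.
Unset Strict Implicit.
Unset Printing Implicit Defensive.

Import Order.TTheory GRing.Theory Num.Theory.
Import numFieldNormedType.Exports.

Local Open Scope classical_set_scope.
Local Open Scope ring_scope.

(* A dimension n >= 1 is written n.+1 wherever a minimum over the index set is
   taken. *)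

Section GOE.
Context d (T : measurableType d) (R : realType) (P : probability T R).

Definition mutually_independent (I : finType) (X : I -> {RV P >-> R}) : Prop :=
  forall (J : {set I}) (B : I -> set R), (forall i, measurable (B i)) ->
    P [set w | forall i, i \in J -> B i (X i w)] =
    (\prod_(i in J) P (X i @^-1` B i))%E.

Definition upper_index n := {p : 'I_n * 'I_n | (p.1 <= p.2)%N}.

Definition random_matrix n (Q : 'I_n -> 'I_n -> {RV P >-> R}) (w : T) :
  'M[R]_n := \matrix_(i, j) Q i j w.

(* The second parameter of normal_prob is the standard deviation. *)
Definition GOE n (Q : 'I_n -> 'I_n -> {RV P >-> R}) : Prop :=
  [/\ forall i j w, Q i j w = Q j i w,
      forall i (A : set R), measurable A ->
        distribution P (Q i i) A = normal_prob 0 1 A,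
      forall i j : 'I_n, (i < j)%N -> forall A : set R, measurable A ->
        distribution P (Q i j) A = normal_prob 0 (Num.sqrt 2^-1) A &
      mutually_independent
        (fun p : upper_index n => Q (val p).1 (val p).2)].

End GOE.

Section DNN.
Context (R : realType).

Definition mxinner n (A B : 'M[R]_n) : R := \tr (A^T *m B).

Definition psd n (X : 'M[R]_n) : Prop :=
  X^T = X /\ forall v : 'cV[R]_n, 0 <= (v^T *m X *m v) 0 0.

Definition dnn_feasible n (X : 'M[R]_n) : Prop :=
  [/\ mxinner (const_mx 1) X = 1, psd X & forall i j, 0 <= X i j].

Definition dnn_optimal n (Q X : 'M[R]_n) : Prop :=
  dnn_feasible X /\ forall Y, dnn_feasible Y -> mxinner Q X <= mxinner Q Y.

Definition dnn_unique_rank_one n (Q : 'M[R]_n) : Prop :=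
  exists X, [/\ dnn_optimal Q X, forall Y, dnn_optimal Q Y -> Y = X
              & \rank X = 1%N].

(* The default value Q 0 0 of the iterated minimum is one of its terms. *)
Definition min_diag n (Q : 'M[R]_n.+1) : R :=
  \big[Num.min/Q ord0 ord0]_i Q i i.

Definition defect n (Q : 'M[R]_n.+1) : rel 'I_n.+1 := fun i j =>
  (i < j)%N && (Q i j < min_diag Q) || (j < i)%N && (Q j i < min_diag Q).

Definition defect_component n (Q : 'M[R]_n.+1) (i : 'I_n.+1) : {set 'I_n.+1} :=
  [set j | connect (defect Q) i j]%SET.

Definition defect_components_le n (Q : 'M[R]_n.+1) (k : nat) : Prop :=
  forall i, (#|defect_component Q i| <= k)%N.

Definition principal n (Q : 'M[R]_n) (T : {set 'I_n}) : 'M[R]_#|T| :=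
  mxsub (fun i : 'I_#|T| => enum_val i) (fun i : 'I_#|T| => enum_val i) Q.

Definition kkt_system n (Q : 'M[R]_n) (T : {set 'I_n})
    (x : 'cV[R]_#|T|) (lam : R) : Prop :=
  principal Q T *m x = lam *: const_mx 1 /\
  (const_mx 1 : 'cV[R]_#|T|)^T *m x = 1%:M.

Definition kkt_unique_solution n (Q : 'M[R]_n) (T : {set 'I_n})
    (x : 'cV[R]_#|T|) (lam : R) : Prop :=
  kkt_system Q x lam /\
  forall (x' : 'cV[R]_#|T|) lam', kkt_system Q x' lam' ->
    x' = x /\ lam' = lam.

Definition is_local_support n (Q : 'M[R]_n.+1) (T : {set 'I_n.+1}) : Prop :=
  (0 < #|T|)%N /\ exists i, T \subset defect_component Q i.

Definition zero_extend n (T : {set 'I_n}) (x : 'cV[R]_#|T|) : 'cV[R]_n :=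
  \col_i \sum_(k : 'I_#|T| | enum_val k == i) x k 0.

End DNN.

(* Real RAM, as a deeply embedded while language.  The memory consists of
   two-dimensional arrays of naturals and of two-dimensional arrays of reals;
   arrays are named by naturals and a scalar variable is a cell of an array.
   Indices are naturals computed by the program, naturals admit only addition
   and truncated subtraction, and a real cannot be converted to a natural. *)

Inductive nexp : Type :=
| NLit of nat
| NGet of nat & nexp & nexp
| NAdd of nexp & nexp
| NSub of nexp & nexp.

Inductive rexp : Type :=
| RLit of nat
| RGet of nat & nexp & nexp
| RAdd of rexp & rexp
| RSub of rexp & rexp
| RMul of rexp & rexp
| RDiv of rexp & rexp.

Inductive bexp : Type :=
| BLeN of nexp & nexp
| BLtR of rexp & rexp
| BNot of bexp
| BAnd of bexp & bexp.

Inductive cmd : Type :=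
| Skip
| SetN of nat & nexp & nexp & nexp
| SetR of nat & nexp & nexp & rexp
| Seq of cmd & cmd
| If of bexp & cmd & cmd
| While of bexp & cmd.

Fixpoint ncost (e : nexp) : nat :=
  match e with
  | NLit _ => 1
  | NGet _ e1 e2 | NAdd e1 e2 | NSub e1 e2 => (ncost e1 + ncost e2).+1
  end.

Fixpoint rcost (e : rexp) : nat :=
  match e with
  | RLit _ => 1
  | RGet _ e1 e2 => (ncost e1 + ncost e2).+1
  | RAdd e1 e2 | RSub e1 e2 | RMul e1 e2 | RDiv e1 e2 =>
      (rcost e1 + rcost e2).+1
  end.

Fixpoint bcost (b : bexp) : nat :=
  match b with
  | BLeN e1 e2 => (ncost e1 + ncost e2).+1
  | BLtR e1 e2 => (rcost e1 + rcost e2).+1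
  | BNot b1 => (bcost b1).+1
  | BAnd b1 b2 => (bcost b1 + bcost b2).+1
  end.

Definition array_set (V : Type) (f : nat -> nat -> nat -> V) (a i j : nat)
    (v : V) : nat -> nat -> nat -> V :=
  fun a' i' j' => if [&& a' == a, i' == i & j' == j] then v else f a' i' j'.

Section RealRAM.
Context (R : realType).

Record memory : Type := Memory {
  nmem : nat -> nat -> nat -> nat;
  rmem : nat -> nat -> nat -> R }.

Definition set_nmem (s : memory) (a i j v : nat) : memory :=
  Memory (array_set (nmem s) a i j v) (rmem s).

Definition set_rmem (s : memory) (a i j : nat) (v : R) : memory :=
  Memory (nmem s) (array_set (rmem s) a i j v).

Fixpoint neval (s : memory) (e : nexp) : nat :=
  match e with
  | NLit k => k
  | NGet a e1 e2 => nmem s a (neval s e1) (neval s e2)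
  | NAdd e1 e2 => (neval s e1 + neval s e2)%N
  | NSub e1 e2 => (neval s e1 - neval s e2)%N
  end.

(* Division is total, with x / 0 = 0; a program can test its divisors. *)
Fixpoint reval (s : memory) (e : rexp) : R :=
  match e with
  | RLit k => k%:R
  | RGet a e1 e2 => rmem s a (neval s e1) (neval s e2)
  | RAdd e1 e2 => reval s e1 + reval s e2
  | RSub e1 e2 => reval s e1 - reval s e2
  | RMul e1 e2 => reval s e1 * reval s e2
  | RDiv e1 e2 => reval s e1 / reval s e2
  end.

Fixpoint beval (s : memory) (b : bexp) : bool :=
  match b with
  | BLeN e1 e2 => (neval s e1 <= neval s e2)%N
  | BLtR e1 e2 => reval s e1 < reval s e2
  | BNot b1 => ~~ beval s b1
  | BAnd b1 b2 => beval s b1 && beval s b2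
  end.

(* exec c s t s': started in memory s, c halts in memory s' after t steps,
   where every operation, test, memory access and assignment is a step. *)
Inductive exec : cmd -> memory -> nat -> memory -> Prop :=
| exec_Skip s : exec Skip s 1 s
| exec_SetN s a e1 e2 e :
    exec (SetN a e1 e2 e) s (ncost e1 + ncost e2 + ncost e).+1
      (set_nmem s a (neval s e1) (neval s e2) (neval s e))
| exec_SetR s a e1 e2 e :
    exec (SetR a e1 e2 e) s (ncost e1 + ncost e2 + rcost e).+1
      (set_rmem s a (neval s e1) (neval s e2) (reval s e))
| exec_Seq c1 c2 s s1 s2 t1 t2 :
    exec c1 s t1 s1 -> exec c2 s1 t2 s2 -> exec (Seq c1 c2) s (t1 + t2) s2
| exec_If_true b c1 c2 s s1 t :
    beval s b -> exec c1 s t s1 -> exec (If b c1 c2) s (bcost b + t).+1 s1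
| exec_If_false b c1 c2 s s1 t :
    ~~ beval s b -> exec c2 s t s1 -> exec (If b c1 c2) s (bcost b + t).+1 s1
| exec_While_true b c s s1 s2 t1 t2 :
    beval s b -> exec c s t1 s1 -> exec (While b c) s1 t2 s2 ->
    exec (While b c) s (bcost b + t1 + t2).+1 s2
| exec_While_false b c s :
    ~~ beval s b -> exec (While b c) s (bcost b).+1 s.

(* Input convention: the natural cell (0, 0) of array 0 holds the dimension,
   the real array 0 holds Q, and everything else is 0. *)
Definition input n (Q : 'M[R]_n.+1) : memory :=
  Memory
    (fun a i j => if [&& a == 0, i == 0 & j == 0]%N then n.+1 else 0%N)
    (fun a i j => if [&& a == 0, i < n.+1 & j < n.+1]%N
                  then Q (inord i) (inord j) else 0).

(* Output convention.  Natural arrays: 1 is the adjacency matrix of the defect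
   graph, 2 labels each vertex by its component, row k of 3 is the indicator
   of the k-th recorded support.  Real arrays: 1 holds m_n, row k of 2 is the
   zero extension of the k-th recorded local solution x, 3 holds its
   multiplier lambda, 4 is the optimizer. *)
Definition recorded_solution n (s : memory) (T : {set 'I_n})
    (x : 'cV[R]_#|T|) (lam : R) : Prop :=
  exists k : nat,
    [/\ forall i : 'I_n, nmem s 3 k i = (i \in T) :> nat,
        forall i : 'I_n, rmem s 2 k i = zero_extend x i 0
      & rmem s 3 k 0 = lam].

Definition recovers n (Q : 'M[R]_n.+1) (s : memory) : Prop :=
  [/\ rmem s 1 0 0 = min_diag Q,
      forall i j : 'I_n.+1, nmem s 1 i j = defect Q i j :> nat,
      forall i j : 'I_n.+1,
        (nmem s 2 i 0 == nmem s 2 j 0) = connect (defect Q) i j,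
      forall (T : {set 'I_n.+1}) (x : 'cV[R]_#|T|) lam,
        is_local_support Q T -> kkt_unique_solution Q x lam ->
        recorded_solution s x lam
    & exists (T : {set 'I_n.+1}) (x : 'cV[R]_#|T|) lam,
        [/\ is_local_support Q T, kkt_unique_solution Q x lam,
            dnn_optimal Q (zero_extend x *m (zero_extend x)^T)
          & forall i j : 'I_n.+1,
              rmem s 4 i j = (zero_extend x *m (zero_extend x)^T) i j]].

Definition recovers_within n (prog : cmd) (Q : 'M[R]_n.+1) (b : nat) : Prop :=
  exists t s, [/\ exec prog (input Q) t s, (t <= b)%N & recovers Q s].

End RealRAM.

Definition input_size n : nat := #|{: 'I_n * 'I_n}|.

(* Main.v *)
(* A doubly nonnegative matrix of order at most four is completely positive, and
   the entries of Q between different components of the defect graph are at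
   least m_n.  So when every component has at most four vertices, the diagonal
   blocks of a feasible X decompose into nonnegative rank-one matrices, and some
   feasible xx^T has an objective value at most that of X.  The optimizer is
   almost surely unique: two optimizers that differ in the entry p confine Q_p,
   given the other entries of Q, to a null set.

   A component with at least five vertices contains a tree whose four edges lie
   below m_n, and there are O(n^5) such trees.  With a_k the k/n-quantile of the
   diagonal law, P(m_n > a_k) <= exp(-k); since the off-diagonal variance is half
   the diagonal one, P(Q_ij < a_k) is O(sqrt(ln n) (k/n)^2).  Summation over k
   bounds the probability of one tree by O((ln n)^2 / n^8).

   If xx^T is the unique optimizer, then the support of x lies in one component
   and x is the unique solution of its KKT system, which uniqueness makes
   detectable by a nonzero bordered determinant of order at most five.  Cramer's
   rule on all local supports and the comparison of the multipliers of the
   nonnegative solutions therefore recover x. *)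

Require Import Defs.
From mathcomp Require Import all_boot all_order all_algebra.
From mathcomp Require Import all_classical all_reals all_analysis.
From mathcomp Require Import measurable_realfun.
From mathcomp Require Import ring lra zify.

Set Implicit Arguments.
Unset Strict Implicit.
Unset Printing Implicit Defensive.

Import Order.TTheory GRing.Theory Num.Theory.
Import numFieldNormedType.Exports.

Local Open Scope ring_scope.

(** * Complete positivity of small doubly nonnegative matrices *)

(** Full elimination of an index can create negative entries. It is therefore stopped at the first
    entry that reaches zero, and two stopped eliminations at order four leave a 4-cycle, the one
    pattern that needs a decomposition of its own. The passage from X to some xx^T is a duality
    argument: were every simplex point worse than v = <Q, X>, then Q - vE would be strictly
    copositive, against its inner product 0 with X. Independence is available only as a product
    formula for finitely many events. Conditioning on the other entries is therefore replaced by a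
    covering by boxes, and the monotone dependence of an optimizer on the entries of Q makes the bad
    set thin in each box. The event of a unique rank-one optimizer quantifies over matrices; its
    measurability rests on the compactness of the feasible set. The program relies on components of
    at most four vertices, so the probability is bounded for the intersection of both conditions. Up
    to a null set, small components already imply uniqueness. The rate is n^5 trees times n^-8, and
    each of the four edges contributes a factor sqrt(ln n). *)

Section CompletelyPositive.
Context (R : realFieldType) (I : finType).
Implicit Types (X Y : I -> I -> R) (v x : I -> R) (C : {set I}).

Definition qform X v : R := \sum_i \sum_j v i * X i j * v j.

Definition deflate X (c : R) x : I -> I -> R := fun i j => X i j - c * (x i * x j).

(** Complete positivity in peeling form: nonnegative rank-one terms are subtracted one at a time
    until nothing is left. An elimination step is then one use of [comp_pos_add], and the factors
    need not be collected. *)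
Inductive comp_pos : (I -> I -> R) -> Prop :=
| comp_pos_zero X : (forall i j, X i j = 0) -> comp_pos X
| comp_pos_add X c x : 0 <= c -> (forall i, 0 <= x i) ->
    comp_pos (deflate X c x) -> comp_pos X.

Definition symf X := forall i j, X i j = X j i.
Definition psdf X := forall v, 0 <= qform X v.
Definition nonnegf X := forall i j, 0 <= X i j.
Definition dnnf X := [/\ symf X, psdf X & nonnegf X].
(** Removing an index shrinks the support and keeps the index type, so the induction on the order
    never reindexes. Only rows are constrained; for columns see [supportedr]. *)
Definition supported X C := forall i j, i \notin C -> X i j = 0.

Lemma qform_deflate X c x v :
  qform (deflate X c x) v = qform X v - c * (\sum_i x i * v i) ^+ 2.
Proof.
rewrite /qform expr2 mulr_suml mulr_sumr -sumrB; apply: eq_bigr => i _.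
rewrite !mulr_sumr -sumrB; apply: eq_bigr => j _; rewrite /deflate; ring.
Qed.

Lemma sum_delta (i : I) (f : I -> R) : \sum_j f j * (j == i)%:R = f i.
Proof.
rewrite (bigD1 i) //= eqxx mulr1 big1 ?addr0 // => j /negPf ->.
by rewrite mulr0.
Qed.

Lemma qform_shift X v i t : symf X ->
  qform X (fun j => v j + t * (j == i)%:R) =
  qform X v + 2 * t * (\sum_j X i j * v j) + t ^+ 2 * X i i.
Proof.
move=> sX; rewrite /qform.
transitivity (\sum_k \sum_j (v k * X k j * v j + (t * X k j * v j) * (k == i)%:R
   + (t * v k * X k j) * (j == i)%:R + (t ^+ 2 * X k j * (j == i)%:R) * (k == i)%:R)).
  by apply: eq_bigr => k _; apply: eq_bigr => j _; ring.
under eq_bigr => k _ do rewrite !big_split /= -!mulr_suml !sum_delta.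
rewrite !big_split /= !sum_delta -!addrA; congr (_ + _).
rewrite !addrA; congr (_ + _); rewrite mulr_sumr -big_split /=.
by apply: eq_bigr => j _; rewrite (sX j i); ring.
Qed.

(** The polynomial in t given by [qform X] at v + t e_i is nonnegative. Its value at the minimizer
    is the inequality; if [X i i] is zero, the polynomial is affine and its slope must vanish. *)
Lemma psdf_cauchy X v i : symf X -> psdf X ->
  (\sum_j X i j * v j) ^+ 2 <= X i i * qform X v.
Proof.
move=> sX pX; set b := \sum_j _; set q := qform X v.
have H t : 0 <= q + 2 * t * b + t ^+ 2 * X i i.
  by rewrite -qform_shift.
have d0 : 0 <= X i i.
  have := pX (fun j => 0 + 1 * (j == i)%:R); rewrite qform_shift //.
  rewrite /qform !big1 => [|k _|k _]; rewrite ?mulr0 //; first by lra.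
  by rewrite big1 // => j _; rewrite !mul0r.
have [d_eq|d_neq] := eqVneq (X i i) 0.
  have : b = 0; last by move=> ->; rewrite d_eq mul0r expr0n.
  apply/eqP/negPn/negP => b0.
  (* This t brings the affine polynomial to the value -1. *)
  have := H (- (q + 1) / (2 * b)); rewrite d_eq.
  have -> : 2 * (- (q + 1) / (2 * b)) * b = - (q + 1) by field.
  by lra.
have dp : 0 < X i i by rewrite lt_def d_neq.
have := H (- b / X i i).
have -> : q + 2 * (- b / X i i) * b + (- b / X i i) ^+ 2 * X i i
   = (X i i * q - b ^+ 2) / X i i by field.
by rewrite pmulr_lge0 ?invr_gt0 // subr_ge0.
Qed.

Lemma qform_delta X i : qform X (fun j => (j == i)%:R) = X i i.
Proof.
rewrite /qform (eq_bigr (fun k => X k i * (k == i)%:R)) ?sum_delta // => k _.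
by rewrite sum_delta mulrC.
Qed.

Lemma psdf_diag_ge0 X i : psdf X -> 0 <= X i i.
Proof. by move=> pX; rewrite -qform_delta. Qed.

Lemma psdf_minor X i j : symf X -> psdf X -> X i j ^+ 2 <= X i i * X j j.
Proof.
move=> sX pX; have := psdf_cauchy (fun k => (k == j)%:R) i sX pX.
by rewrite sum_delta qform_delta.
Qed.

(** Cauchy-Schwarz bounds the subtracted square for all t up to the Schur complement value 1 /
    [X i i]; the partial elimination uses smaller t. *)
Lemma psdf_deflate X i t : symf X -> psdf X -> 0 <= t -> t * X i i <= 1 ->
  psdf (deflate X t (X i)).
Proof.
move=> sX pX t0 t1 v; rewrite qform_deflate subr_ge0.
have C := psdf_cauchy v i sX pX; have q0 := pX v.
apply: le_trans (_ : t * (X i i * qform X v) <= _); first exact: ler_wpM2l.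
by rewrite mulrA ler_piMl.
Qed.

Lemma psdf_schur X i : symf X -> psdf X -> 0 < X i i ->
  psdf (deflate X (X i i)^-1 (X i)).
Proof.
by move=> sX pX d0; apply: psdf_deflate; rewrite // ?invr_ge0 ?mulVf ?gt_eqF ?(ltW d0).
Qed.

Lemma symf_deflate X t x : symf X -> symf (deflate X t x).
Proof. by move=> sX i j; rewrite /deflate sX (mulrC (x i)). Qed.

Lemma supported_deflate X C t x : supported X C ->
  (forall i, i \notin C -> x i = 0) -> supported (deflate X t x) C.
Proof. by move=> sX x0 i j iC; rewrite /deflate sX // x0 // mul0r mulr0 subrr. Qed.

Lemma supportedr X C i j : symf X -> supported X C -> j \notin C -> X i j = 0.
Proof. by move=> sX sC jC; rewrite sX sC. Qed.

Lemma supported_drop X C i : symf X -> psdf X -> supported X C -> X i i = 0 ->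
  supported X (C :\ i).
Proof.
move=> sX pX sC d0 j k; rewrite !inE negb_and negbK => /orP[/eqP ->|/sC //].
by have := psdf_minor i k sX pX; rewrite d0 mul0r => h; apply/eqP;
  rewrite -sqrf_eq0 eq_le h sqr_ge0.
Qed.

Lemma deflate_out X C t i j k : symf X -> supported X C -> j \notin C ->
  deflate X t (X i) j k = 0.
Proof.
by move=> sX sC jC; rewrite /deflate sC // (supportedr i sX sC jC) mul0r mulr0 subrr.
Qed.

(* Full elimination of [i], possible when the Schur complement stays nonnegative. *)
Lemma comp_pos_pivot X C i : dnnf X -> supported X C ->
  (forall j k, j \in C :\ i -> k \in C :\ i -> j != k ->
    X i j * X i k <= X i i * X j k) ->
  (forall Y, dnnf Y -> supported Y (C :\ i) -> comp_pos Y) -> comp_pos X.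
Proof.
move=> [sX pX nX] sC H IH.
have [d0|d0] := eqVneq (X i i) 0.
  by apply: IH; [split | apply: supported_drop].
have dp : 0 < X i i by rewrite lt_def d0 nX.
apply: (@comp_pos_add X (X i i)^-1 (X i)); rewrite ?invr_ge0 //.
have Yi k : deflate X (X i i)^-1 (X i) i k = 0.
  by rewrite /deflate mulrA mulVf // mul1r subrr.
have sY := @symf_deflate X (X i i)^-1 (X i) sX.
apply: IH; last first.
  move=> j k; rewrite !inE negb_and negbK => /orP[/eqP ->//|jC].
  by rewrite (@deflate_out X C).
split=> //; first by apply: psdf_deflate; rewrite ?invr_ge0 // mulVf.
move=> j k.
have [->|ji] := eqVneq j i; first by rewrite Yi.
have [->|ki] := eqVneq k i; first by rewrite sY Yi.
have [jC|jC] := boolP (j \in C); last first.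
  by rewrite (@deflate_out X C).
have [kC|kC] := boolP (k \in C); last first.
  by rewrite symf_deflate // (@deflate_out X C).
rewrite /deflate subr_ge0 ler_pdivrMl //.
have [->|jk] := eqVneq j k; first by rewrite -expr2; apply: psdf_minor.
by apply: H; rewrite ?inE ?ji ?ki.
Qed.

(* Partial elimination: shrink towards the rank-one matrix of row [i] until the
   first off-diagonal entry vanishes. *)
Lemma comp_pos_partial X C i : dnnf X -> supported X C -> i \in C ->
  (forall Y, dnnf Y -> supported Y (C :\ i) -> comp_pos Y) ->
  (forall t j k, j \in C :\ i -> k \in C :\ i -> j != k ->
     0 < X i j * X i k ->
     dnnf (deflate X t (X i)) -> supported (deflate X t (X i)) C ->
     deflate X t (X i) j k = 0 -> comp_pos (deflate X t (X i))) ->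
  comp_pos X.
Proof.
move=> dX sC iC IH1 IH2; have [sX pX nX] := dX.
have [d0|d0] := eqVneq (X i i) 0.
  by apply: IH1; [split | apply: supported_drop].
have dp : 0 < X i i by rewrite lt_def d0 nX.
pose P (p : I * I) := [&& p.1 \in C :\ i, p.2 \in C :\ i, p.1 != p.2 &
   X i i * X p.1 p.2 < X i p.1 * X i p.2].
have [/existsP[p0 p0P]|/existsPn nP] := boolP [exists p, P p]; last first.
  apply: (comp_pos_pivot dX sC (i := i)) => // j k jC kC jk.
  have := nP (j, k); rewrite /P /= jC kC jk /=; by rewrite -leNgt.
have pos p : P p -> 0 < X i p.1 * X i p.2.
  by case/and4P=> _ _ _; apply: le_lt_trans; rewrite mulr_ge0.
(* The least ratio is the first parameter at which an entry reaches zero. Pairs outside [P] would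
   stay nonnegative even under full elimination. *)
have [p pP pmin] := @arg_minP _ _ _ p0 P
  (fun p => X p.1 p.2 / (X i p.1 * X i p.2)) p0P.
set t := X p.1 p.2 / (X i p.1 * X i p.2) in pmin.
have ppos := pos _ pP.
have t0 : 0 <= t by rewrite divr_ge0 // ltW.
have [p1 p2 p12 plt] := and4P pP.
have t1 : t * X i i < 1 by rewrite /t mulrAC ltr_pdivrMr // mul1r mulrC.
apply: (@comp_pos_add X t (X i)) => //.
have sD : supported (deflate X t (X i)) C.
  by apply: supported_deflate => // j jC; rewrite (supportedr i sX sC).
have zD : deflate X t (X i) p.1 p.2 = 0.
  by rewrite /deflate /t mulfVK ?subrr // gt_eqF.
apply: (IH2 t p.1 p.2) => //.
have tle j : t * X i i * X i j <= X i j by rewrite ler_piMl // ltW.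
split; [exact: symf_deflate | apply: psdf_deflate => //; exact: ltW |].
move=> j k.
have [->|ji] := eqVneq j i; first by rewrite /deflate subr_ge0 mulrA.
have [->|ki] := eqVneq k i.
  by rewrite /deflate subr_ge0 (sX j i) (mulrC (X i j)) mulrA.
have [jC|jC] := boolP (j \in C); last first.
  by rewrite (@deflate_out X C).
have [kC|kC] := boolP (k \in C); last first.
  by rewrite symf_deflate // (@deflate_out X C).
rewrite /deflate subr_ge0.
have [hle|hlt] := leP (X i j * X i k) (X i i * X j k).
  apply: le_trans (ler_wpM2l t0 hle) _; rewrite mulrA ler_piMl // ltW //.
have [->|jk] := eqVneq j k.
  apply: le_trans (_ : t * (X i i * X k k) <= _).
    by apply: ler_wpM2l => //; rewrite -expr2 psdf_minor.
  by rewrite mulrA ler_piMl // ltW.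
have Pjk : P (j, k) by rewrite /P /= !inE ji ki jC kC jk.
by rewrite -ler_pdivlMr ?(pos _ Pjk) // (pmin _ Pjk).
Qed.

Lemma supported_set0 X : supported X finset.set0 -> comp_pos X.
Proof. by move=> s0; apply: comp_pos_zero => i j; rewrite s0 ?inE. Qed.

Lemma comp_pos_le2 X C : (#|C| <= 2)%N -> dnnf X -> supported X C -> comp_pos X.
Proof.
have [m] := ubnP #|C|; elim: m => // m IH in X C *; rewrite ltnS => Cm C2 dX sC.
have [C0|[i iC]] := set_0Vmem C; first by apply: supported_set0; rewrite -C0.
have cC := cardsD1 i C; rewrite iC add1n in cC.
apply: (comp_pos_pivot dX sC (i := i)) => [j k jC kC jk|Y dY sY].
  have : (1 < #|C :\ i|)%N by apply/card_gt1P; exists j, k.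
  by rewrite cC in C2; rewrite ltnNge -ltnS C2.
by rewrite cC in Cm C2; apply: IH sY => //; apply: ltnW.
Qed.

Lemma set_of_cardS C m : #|C| = m.+1 -> exists2 i, i \in C & #|C :\ i| = m.
Proof.
move=> Cm; have /card_gt0P[i iC] : (0 < #|C|)%N by rewrite Cm.
by exists i => //; apply: succn_inj; rewrite -Cm (cardsD1 i C) iC.
Qed.

(** If elimination at i and at j both fail, then a r < p q and b q < p r. Multiplication gives a b q
    r < p^2 q r, against the minor p^2 <= a b. *)
Lemma comp_pos_le3 X C : (#|C| <= 3)%N -> dnnf X -> supported X C -> comp_pos X.
Proof.
rewrite leq_eqVlt => /predU1P[C3 dX sC|]; last exact: comp_pos_le2.
have [sX pX nX] := dX.
have [i iC Ci] := set_of_cardS C3.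
have [j jC Cj] := set_of_cardS Ci.
have [k kC Ck] := set_of_cardS Cj.
have C0 : C :\ i :\ j :\ k = finset.set0 by apply/eqP; rewrite -cards_eq0 Ck.
have CE l : l \in C -> [|| l == i, l == j | l == k].
  move=> lC; have : l \notin C :\ i :\ j :\ k by rewrite C0 inE.
  by rewrite !inE lC; case: (l == i); case: (l == j); case: (l == k).
move: jC kC; rewrite !inE => /andP[ji jC] /and3P[kj ki kC].
have two a : a \in C -> (forall Y, dnnf Y -> supported Y (C :\ a) -> comp_pos Y).
  move=> aC Y dY; apply: comp_pos_le2 => //.
  by have := cardsD1 a C; rewrite aC C3 add1n => -[<-].
have [h1|h1] := leP (X i j * X i k) (X i i * X j k).
  apply: (comp_pos_pivot dX sC (i := i)) => [a b aC bC ab|]; last exact: two.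
  move: aC bC ab; rewrite !inE => /andP[ai /CE] + /andP[bi /CE].
  rewrite (negPf ai) (negPf bi) /= => /orP[]/eqP-> /orP[]/eqP->;
    rewrite ?eqxx // => _.
  by rewrite mulrC (sX k j).
have [h2|h2] := leP (X j i * X j k) (X j j * X i k).
  apply: (comp_pos_pivot dX sC (i := j)) => [a b aC bC ab|]; last exact: two.
  move: aC bC ab; rewrite !inE => /andP[aj /CE] + /andP[bj /CE].
  rewrite (negPf aj) (negPf bj) /= => /orP[]/eqP-> /orP[]/eqP->;
    rewrite ?eqxx // => _.
  by rewrite mulrC (sX k i).
rewrite (sX j i) in h2.
have := psdf_minor i j sX pX.
have := nX i i; have := nX j j; have := nX i j; have := nX i k; have := nX j k.
set a := X i i in h1 h2 *; set b := X j j in h1 h2 *; set p := X i j in h1 h2 *.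
set q := X i k in h1 h2 *; set r := X j k in h1 h2 *.
move=> r0 q0 p0 b0 a0 h.
have qp : 0 < q.
  rewrite lt_def q0 andbT; apply/eqP => qE; rewrite qE mulr0 in h1.
  by have := mulr_ge0 a0 r0; lra.
have rp : 0 < r.
  rewrite lt_def r0 andbT; apply/eqP => rE; rewrite rE mulr0 in h2.
  by have := mulr_ge0 b0 q0; lra.
have H : (a * r) * (b * q) < (p * q) * (p * r).
  by apply: ltr_pM => //; exact: mulr_ge0.
have : (a * r) * (b * q) - (p * q) * (p * r) = (a * b - p ^+ 2) * (q * r) by ring.
have : 0 <= (a * b - p ^+ 2) * (q * r).
  by apply: mulr_ge0; [rewrite subr_ge0 | apply: mulr_ge0].
lra.
Qed.

(** A vertex with at most one neighbour is eliminated without fill-in: of two distinct other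
    indices, one has a zero entry with i, so the product in [comp_pos_pivot] vanishes. *)
Lemma leaf_pivot X C i j : (#|C| <= 4)%N -> dnnf X -> supported X C -> i \in C ->
  (forall k, k \in C :\ i -> k != j -> X i k = 0) -> comp_pos X.
Proof.
move=> C4 dX sC iC H; have [sX pX nX] := dX.
apply: (comp_pos_pivot dX sC (i := i)) => [k l kC lC kl|Y dY sY]; last first.
  apply: comp_pos_le3 sY => //.
  by have := cardsD1 i C; rewrite iC add1n => cC; rewrite cC in C4.
have [kj|kj] := eqVneq k j; last by rewrite (H k) // mul0r mulr_ge0.
by rewrite [X i l](H l) // ?mulr0 ?mulr_ge0 // -kj eq_sym.
Qed.

Lemma qform_supp2 X i j v : i != j ->
  (forall k l, k \notin [set i; j] -> X k l = 0) ->
  (forall k l, l \notin [set i; j] -> X k l = 0) ->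
  qform X v = v i * X i i * v i + v i * X i j * v j +
              (v j * X j i * v i + v j * X j j * v j).
Proof.
move=> ij r0 c0.
have E (f : I -> R) : (forall k, k \notin [set i; j] -> f k = 0) ->
    \sum_k f k = f i + f j.
  move=> f0; rewrite (bigD1 i) //= (bigD1 j) ?(eq_sym j) //= big1 ?addr0 //.
  by move=> k /andP[ki kj]; rewrite f0 // !inE negb_or ki.
rewrite /qform E; last first.
  by move=> k kC; rewrite big1 // => l _; rewrite r0 // mulr0 mul0r.
by congr (_ + _); rewrite E // => l lC; rewrite c0 // mulr0 mul0r.
Qed.

(* The 4-cycle i - k - j - l.  After elimination of [j] and [l], the entry at
   (i, k) is at least [X i k]; the rank-one matrix of [y] carries exactly the
   share of the edge (i, k), and removing it leaves a path. *)
Lemma comp_pos_cycle4 X i j k l : dnnf X -> supported X [set i; j; k; l] ->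
  uniq [:: i; j; k; l] -> X i j = 0 -> X k l = 0 -> comp_pos X.
Proof.
move=> dX; set C := [set i; j; k; l] => sC uC zij zkl; have [sX pX nX] := dX.
have C4 : (#|C| <= 4)%N.
  have -> : C = [set x in [:: i; j; k; l]]%SET by apply/finset.setP=> x; rewrite !inE -!orbA.
  by rewrite cardsE; apply: card_size.
move: (uC); rewrite /= !inE !negb_or => /and4P[/and3P[ij ik il] /andP[jk jl] kl _].
have CE a : a \in C -> [|| a == i, a == j, a == k | a == l].
  by rewrite !inE -!orbA.
have [zik|ik0] := eqVneq (X i k) 0.
  apply: (@leaf_pivot X C i l) => //; first by rewrite !inE eqxx.
  move=> a; rewrite !inE -!orbA => /andP[/negPf -> /=].
  by case/or3P => /eqP -> //; rewrite eqxx.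
have [zil|il0] := eqVneq (X i l) 0.
  apply: (@leaf_pivot X C i k) => //; first by rewrite !inE eqxx.
  move=> a; rewrite !inE -!orbA => /andP[/negPf -> /=].
  by case/or3P => /eqP -> //; rewrite eqxx.
have [zjk|jk0] := eqVneq (X j k) 0.
  apply: (@leaf_pivot X C j l) => //; first by rewrite !inE eqxx !orbT.
  move=> a; rewrite !inE -!orbA => /andP[/negPf aj /=]; rewrite aj /=.
  by case/or3P => /eqP -> //; rewrite ?eqxx // sX.
have [zjl|jl0] := eqVneq (X j l) 0.
  apply: (@leaf_pivot X C j k) => //; first by rewrite !inE eqxx !orbT.
  move=> a; rewrite !inE -!orbA => /andP[/negPf aj /=]; rewrite aj /=.
  by case/or3P => /eqP -> //; rewrite ?eqxx // sX.
have pos a b : X a b != 0 -> 0 < X a b by move=> h; rewrite lt_def h nX.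
have dpos a b : X a b != 0 -> 0 < X a a.
  move=> h; rewrite lt_def nX andbT; apply/eqP => d0.
  by have := psdf_minor a b sX pX; rewrite d0 mul0r leNgt exprn_even_gt0 ?h.
pose b := X j j; pose X1 := deflate X b^-1 (X j).
have b0 : 0 < b := dpos _ _ jk0.
have sX1 : symf X1 by apply: symf_deflate.
have pX1 : psdf X1 by apply: psdf_schur.
pose e := X1 l l; pose X2 := deflate X1 e^-1 (X1 l).
have X1il : X1 l i = X i l by rewrite /X1 /deflate (sX j i) zij mulr0 mulr0 subr0 sX.
have e0 : 0 < e.
  rewrite lt_def psdf_diag_ge0 // andbT; apply/eqP => e0.
  have := psdf_minor l i sX1 pX1; rewrite -/e e0 mul0r X1il leNgt.
  by rewrite exprn_even_gt0 ?il0.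
have sX2 : symf X2 by apply: symf_deflate.
have pX2 : psdf X2 by apply: psdf_schur.
pose p := X i k; pose c := X i l * (X j l * X j k / b) / e.
have p0 : 0 < p := pos _ _ ik0.
have c0 : 0 <= c.
  by rewrite /c !(divr_ge0, mulr_ge0) // ltW.
have X2ik : X2 i k = p + c.
  rewrite /X2 /deflate X1il /X1 /deflate (sX j i) zij (sX l k) zkl /p /c.
  by rewrite -/b; field; rewrite !gt_eqF.
have X2out a d : a \notin [set i; k] -> X2 a d = 0.
  rewrite !inE negb_or => /andP[ai ak].
  have X1j d' : X1 j d' = 0.
    by rewrite /X1 /deflate mulrA mulVf ?gt_eqF // mul1r subrr.
  have [->|aj] := eqVneq a j.
    by rewrite /X2 /deflate X1j (sX1 l j) X1j mul0r mulr0 subrr.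
  have [->|al] := eqVneq a l.
    by rewrite /X2 /deflate mulrA mulVf ?gt_eqF // mul1r subrr.
  have aC : a \notin C.
    by rewrite !inE !negb_or ai aj ak al.
  rewrite /X2 (@deflate_out X1 C) //.
  by move=> x y xC; rewrite /X1 (@deflate_out X C).
have X2out' a d : d \notin [set i; k] -> X2 a d = 0.
  by move=> dC; rewrite sX2 X2out.
have := psdf_minor i k sX2 pX2.
have := psdf_diag_ge0 i pX2; have := psdf_diag_ge0 k pX2; rewrite X2ik.
set A := X2 i i; set B := X2 k k => B0 A0 AB.
have A_gt0 : 0 < A.
  rewrite lt_def A0 andbT; apply/eqP => AE; move: AB; rewrite AE mul0r leNgt.
  by rewrite exprn_gt0 // ltr_wpDr.
have pc : 0 < p + c by rewrite ltr_wpDr.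
(* The diagonal entry A is divided in the ratio p : c of the two parts of the off-diagonal entry.
   What remains of [X2] has off-diagonal entry c and is semidefinite because (p + c)^2 <= A B; since
   [qform X] dominates [qform X2], the remainder of X is semidefinite too. *)
pose a := p * A / (p + c).
have a0 : 0 < a by rewrite /a divr_gt0 // mulr_gt0.
pose y (x : I) : R := if x == i then 1 else if x == k then p / a else 0.
have y0 (x : I) : 0 <= y x.
  rewrite /y; by case: ifP => // _; case: ifP => // _; rewrite divr_ge0 // ltW.
apply: (@comp_pos_add X a y) => //; first exact: ltW.
have yi : y i = 1 by rewrite /y eqxx.
have yk : y k = p / a by rewrite /y eq_sym (negPf ik) eqxx.
have yo (x : I) : x != i -> x != k -> y x = 0 by rewrite /y => /negPf-> /negPf->.
have yj : y j = 0 by rewrite yo // eq_sym.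
have yl : y l = 0 by rewrite yo // eq_sym.
have Xik0 : deflate X a y i k = 0.
  by rewrite /deflate yi yk mul1r mulrCA mulfV ?gt_eqF // mulr1 subrr.
have sY : symf (deflate X a y) by apply: symf_deflate.
have dom v : a * (\sum_x y x * v x) ^+ 2 <= qform X2 v.
  have -> : \sum_x y x * v x = v i + p / a * v k.
    rewrite (bigD1 i) //= (bigD1 k) ?(eq_sym k) //= yi yk mul1r big1 ?addr0 //.
    by move=> x /andP[xi xk]; rewrite yo // mul0r.
  rewrite (@qform_supp2 X2 i k) // X2ik (sX2 k i) X2ik -/A -/B -subr_ge0.
  have -> : v i * A * v i + v i * (p + c) * v k + (v k * (p + c) * v i + v k * B * v k)
    - a * (v i + p / a * v k) ^+ 2 =
    (A * B - (p + c) ^+ 2) / A * v k ^+ 2 +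
      c / (A * (p + c)) * (A * v i + (p + c) * v k) ^+ 2.
    by rewrite /a; field; rewrite !gt_eqF.
  apply: addr_ge0; apply: mulr_ge0; rewrite ?sqr_ge0 //; apply: divr_ge0 => //.
    by rewrite subr_ge0.
  by rewrite mulr_ge0 // ltW.
have pY : psdf (deflate X a y).
  move=> v; rewrite qform_deflate subr_ge0; apply: le_trans (dom v) _.
  rewrite !qform_deflate -addrA gerDl -opprD oppr_le0.
  by apply: addr_ge0; apply: mulr_ge0; rewrite ?sqr_ge0 // invr_ge0 ltW.
have nY : nonnegf (deflate X a y).
  have Ydiag (x : I) : 0 <= deflate X a y x x by apply: psdf_diag_ge0.
  move=> x z.
  have [<-//|xz] := eqVneq x z.
  have [xi|xi] := eqVneq x i; have [xk|xk] := eqVneq x k;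
  have [zi|zi] := eqVneq z i; have [zk|zk] := eqVneq z k; subst;
    rewrite ?eqxx // in ik xz *;
    try (by rewrite /deflate ?[y z]yo ?[y x]yo // ?mulr0 ?mul0r ?mulr0 subr0).
  - by rewrite Xik0.
  - by rewrite sY Xik0.
apply: (@leaf_pivot _ C i l) => //.
- by apply: supported_deflate => // x; rewrite !inE !negb_or -!andbA =>
    /and4P[xi _ xk _]; rewrite yo.
- by rewrite !inE eqxx.
move=> x; rewrite !inE -!orbA => /andP[/negPf -> /=].
case/or3P => /eqP -> //; last by rewrite eqxx.
by move=> _; rewrite /deflate yj mulr0 mulr0 subr0.
Qed.

(** Partial elimination at i produces a zero at some (k, l). Partial elimination at k then involves
    only pairs (a, b) whose entries with k are positive, which excludes l. Hence its new zero sits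
    at the two remaining indices, the old zero persists, and the support is a 4-cycle. *)
Theorem comp_pos_le4 X C : (#|C| <= 4)%N -> dnnf X -> supported X C -> comp_pos X.
Proof.
rewrite leq_eqVlt => /predU1P[C4 dX sC|]; last exact: comp_pos_le3.
have [sX pX nX] := dX.
have small a Y : a \in C -> dnnf Y -> supported Y (C :\ a) -> comp_pos Y.
  move=> aC dY; apply: comp_pos_le3 => //.
  by have := cardsD1 a C; rewrite aC C4 add1n => -[<-].
have [i iC Ci] := set_of_cardS C4.
apply: (comp_pos_partial dX sC iC) => [Y|t k l]; first exact: small.
rewrite !inE => /andP[ki kC] /andP[li lC] kl _.
set Y := deflate _ _ _ => dY sY Ykl.
have [sy _ _] := dY.
apply: (comp_pos_partial dY sY kC) => [Z|s a b]; first exact: small.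
rewrite !inE => /andP[ak aC] /andP[bk bC] ab Yab.
set Z := deflate _ _ _ => dZ sZ Zab.
have al : a != l by apply: contraTneq Yab => ->; rewrite Ykl mul0r ltxx.
have bl : b != l by apply: contraTneq Yab => ->; rewrite Ykl mulr0 ltxx.
have CE : C = [set a; b; k; l].
  apply/eqP; rewrite eq_sym eqEcard C4; apply/andP; split.
    by apply/fintype.subsetP => x; rewrite !inE -!orbA => /or4P[]/eqP->.
  have -> : [set a; b; k; l] = [set x in [:: a; b; k; l]].
    by apply/finset.setP=> x; rewrite !inE -!orbA.
  rewrite cardsE; have /card_uniqP -> // : uniq [:: a; b; k; l].
  by rewrite /= !inE !negb_or ab ak al bk bl kl.
apply: (@comp_pos_cycle4 Z a b k l) => //; first by rewrite -CE.
- by rewrite /= !inE !negb_or ab ak al bk bl kl.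
- by rewrite /Z /deflate Ykl mulr0 mulr0 subr0.
Qed.

End CompletelyPositive.

(** * Rank-one matrices below a feasible matrix *)

Section Deterministic.
Context (R : realType).

Lemma mxinnerE n (A B : 'M[R]_n) : mxinner A B = \sum_i \sum_j A i j * B i j.
Proof.
rewrite /mxinner /mxtrace exchange_big; apply: eq_bigr => i _ /=.
by rewrite mxE; apply: eq_bigr => j _; rewrite mxE.
Qed.

Lemma quad_formE n (X : 'M[R]_n) (v : 'cV[R]_n) :
  (v^T *m X *m v) 0 0 = qform X (fun i => v i 0).
Proof.
rewrite mxE /qform exchange_big; apply: eq_bigr => j _ /=.
by rewrite mxE mulr_suml; apply: eq_bigr => i _; rewrite mxE.
Qed.

Lemma psdP n (X : 'M[R]_n) : psd X <-> symf X /\ psdf X.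
Proof.
split=> [[sX pX]|[sX pX]]; split.
- by move=> i j; rewrite -{1}sX mxE.
- move=> v; have := pX (\col_i v i); rewrite quad_formE.
  congr (_ <= _); rewrite /qform; apply: eq_bigr => i _; apply: eq_bigr => j _.
  by rewrite !mxE.
- by apply/matrixP => i j; rewrite mxE sX.
- by move=> v; rewrite quad_formE.
Qed.

Lemma dnn_feasibleP n (X : 'M[R]_n) :
  dnn_feasible X <-> dnnf X /\ \sum_i \sum_j X i j = 1.
Proof.
rewrite /dnn_feasible mxinnerE.
have -> : \sum_i \sum_j (const_mx 1 : 'M[R]_n) i j * X i j = \sum_i \sum_j X i j.
  by apply: eq_bigr => i _; apply: eq_bigr => j _; rewrite mxE mul1r.
split=> [[h /psdP[sX pX] nX]|[[sX pX nX] h]]; split=> //.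
by apply/psdP.
Qed.

Definition outer n (x : 'I_n -> R) : 'M[R]_n := \matrix_(i, j) (x i * x j).

Definition simplex n (x : 'I_n -> R) := (forall i, 0 <= x i) /\ \sum_i x i = 1.

Lemma sum_outer n (x : 'I_n -> R) :
  \sum_i \sum_j outer x i j = (\sum_i x i) ^+ 2.
Proof.
rewrite expr2 mulr_suml; apply: eq_bigr => i _; rewrite mulr_sumr.
by apply: eq_bigr => j _; rewrite mxE.
Qed.

Lemma qform_outer n (x v : 'I_n -> R) : qform (outer x) v = (\sum_i x i * v i) ^+ 2.
Proof.
rewrite /qform expr2 mulr_suml; apply: eq_bigr => i _; rewrite mulr_sumr.
by apply: eq_bigr => j _; rewrite mxE; ring.
Qed.

Lemma mxinner_outer n (Q : 'M[R]_n) x : mxinner Q (outer x) = qform Q x.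
Proof.
rewrite mxinnerE; apply: eq_bigr => i _; apply: eq_bigr => j _.
by rewrite mxE; ring.
Qed.

Lemma dnn_feasible_outer n (x : 'I_n -> R) : simplex x -> dnn_feasible (outer x).
Proof.
move=> [x0 x1]; apply/dnn_feasibleP; split; last by rewrite sum_outer x1 expr1n.
split; first by move=> i j; rewrite !mxE mulrC.
  by move=> v; rewrite qform_outer sqr_ge0.
by move=> i j; rewrite mxE mulr_ge0.
Qed.

Lemma rank_outer n (x : 'I_n -> R) : simplex x -> \rank (outer x) = 1%N.
Proof.
move=> [x0 x1].
have -> : outer x = (\col_i x i) *m (\row_i x i).
  by apply/matrixP => i j; rewrite !mxE big_ord1 !mxE.
apply/eqP; rewrite eqn_leq; apply/andP; split.
  exact: leq_trans (mxrankM_maxl _ _) (rank_leq_col _).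
rewrite lt0n mxrank_eq0; apply/eqP => /matrixP E.
have xz i : x i = 0.
  have := E i i; rewrite !mxE big_ord1 !mxE => /eqP.
  by rewrite mulf_eq0 orbb => /eqP.
by move: x1; rewrite big1 // => /esym/eqP; rewrite oner_eq0.
Qed.

(** The factor is the vector of row sums: summing the minor identity over k and l leaves X i j on
    one side, since all entries sum to 1, and a product of row sums on the other. *)
Lemma minors_outer n (X : 'M[R]_n) : dnn_feasible X ->
  (forall i j k l, X i j * X k l = X i l * X k j) ->
  exists2 x, simplex x & X = outer x.
Proof.
move=> /dnn_feasibleP[[sX pX nX] X1] cross.
exists (fun i => \sum_j X i j); first by split=> // i; apply: sumr_ge0.
apply/matrixP => i j; rewrite mxE -[LHS]mulr1 -X1.
transitivity (\sum_k \sum_l X i l * X k j).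
  rewrite mulr_sumr; apply: eq_bigr => k _.
  by rewrite mulr_sumr; apply: eq_bigr => l _; exact: cross.
rewrite exchange_big mulr_suml; apply: eq_bigr => l _ /=.
by rewrite mulr_sumr; apply: eq_bigr => k _; rewrite (sX k j).
Qed.

Lemma rank1_minors n (X : 'M[R]_n) : \rank X = 1%N ->
  forall i j k l, X i j * X k l = X i l * X k j.
Proof.
move=> r1 i j k l.
have := mulmx_base X; move: (col_base X) (row_base X); rewrite r1 => c b <-.
by rewrite !mxE !big_ord1; ring.
Qed.

Lemma rank1_outer n (X : 'M[R]_n) : dnn_feasible X -> \rank X = 1%N ->
  exists2 x, simplex x & X = outer x.
Proof. by move=> fX /rank1_minors; exact: minors_outer. Qed.

Lemma min_diag_le n (Q : 'M[R]_n.+1) i : min_diag Q <= Q i i.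
Proof. by rewrite /min_diag; apply: bigmin_le_cond. Qed.

Lemma min_diag_attained n (Q : 'M[R]_n.+1) : exists i, min_diag Q = Q i i.
Proof.
rewrite /min_diag; elim/big_ind: _ => [|x y [i ->] [j ->]|i _].
- by exists ord0.
- by case: (leP (Q i i) (Q j j)) => _; [exists i | exists j].
- by exists i.
Qed.

Section Components.
Context (n : nat) (Q : 'M[R]_n.+1) (sQ : symf Q).

Lemma defect_sym : symmetric (defect Q).
Proof. by move=> i j; rewrite /defect orbC. Qed.

Lemma connect_defect_sym : connect_sym (defect Q).
Proof. exact: sym_connect_sym defect_sym. Qed.

Lemma min_diag_le_cross i j : ~~ connect (defect Q) i j -> min_diag Q <= Q i j.
Proof.
move=> nc; have ij : i != j by apply: contraNneq nc => ->; apply: connect0.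
have : ~~ defect Q i j by apply: contraNN nc; apply: connect1.
rewrite /defect negb_or => /andP[].
case: (ltngtP i j) => [_|_|/val_inj ijE]; rewrite ?ijE ?eqxx //= in ij *.
- by rewrite -leNgt.
- by move=> _; rewrite -leNgt sQ.
Qed.

Lemma comp_pos_inner_ge0 (M X : 'I_n.+1 -> 'I_n.+1 -> R) :
  comp_pos X -> (forall x, (forall i, 0 <= x i) -> 0 <= qform M x) ->
  0 <= \sum_i \sum_j M i j * X i j.
Proof.
move=> cX cop; elim: cX => [Y Y0|Y c x c0 x0 _ IH].
  by rewrite big1 // => i _; rewrite big1 // => j _; rewrite Y0 mulr0.
have -> : \sum_i \sum_j M i j * Y i j =
    (\sum_i \sum_j M i j * deflate Y c x i j) + c * qform M x.
  rewrite /qform mulr_sumr -big_split; apply: eq_bigr => i _ /=.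
  rewrite mulr_sumr -big_split; apply: eq_bigr => j _ /=.
  by rewrite /deflate; ring.
by rewrite addr_ge0 // mulr_ge0 // cop.
Qed.

(** All peeled terms contribute nonnegatively, so each contribution is zero; strict copositivity
    then forces the coefficient or the vector of each term to vanish. *)
Lemma comp_pos_inner_eq0 (M X : 'I_n.+1 -> 'I_n.+1 -> R) :
  comp_pos X -> (forall x, (forall i, 0 <= x i) -> 0 < \sum_i x i -> 0 < qform M x) ->
  \sum_i \sum_j M i j * X i j = 0 -> \sum_i \sum_j X i j = 0.
Proof.
move=> cX cop.
have cop0 x : (forall i, 0 <= x i) -> 0 <= qform M x.
  move=> x0; have : 0 <= \sum_i x i by apply: sumr_ge0.
  rewrite le_eqVlt => /predU1P[/esym s0|]; last by move/(cop x x0)/ltW.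
  have xz i : x i = 0 by apply: (psumr_eq0P _ s0).
  by rewrite /qform big1 // => i _; rewrite big1 // => j _; rewrite xz !mul0r.
elim: cX => [Y Y0 _|Y c x c0 x0 cY IH].
  by rewrite big1 // => i _; rewrite big1.
have -> : \sum_i \sum_j M i j * Y i j =
    (\sum_i \sum_j M i j * deflate Y c x i j) + c * qform M x.
  rewrite /qform mulr_sumr -big_split; apply: eq_bigr => i _ /=.
  rewrite mulr_sumr -big_split; apply: eq_bigr => j _ /=.
  by rewrite /deflate; ring.
have -> : \sum_i \sum_j Y i j =
    (\sum_i \sum_j deflate Y c x i j) + c * (\sum_i x i) ^+ 2.
  rewrite expr2 mulr_suml mulr_sumr -big_split; apply: eq_bigr => i _ /=.
  rewrite !mulr_sumr -big_split; apply: eq_bigr => j _ /=.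
  by rewrite /deflate; ring.
have h1 := comp_pos_inner_ge0 cY cop0; have h2 := mulr_ge0 c0 (cop0 _ x0).
move=> E; have E1 : \sum_i \sum_j M i j * deflate Y c x i j = 0 by lra.
have E2 : c * qform M x = 0 by lra.
rewrite IH // add0r; move/eqP: E2; rewrite mulf_eq0 => /predU1P[->|/eqP q0].
  by rewrite mul0r.
have : 0 <= \sum_i x i by apply: sumr_ge0.
  rewrite le_eqVlt => /predU1P[<-|/(cop x x0)].
  by rewrite expr0n mulr0.
by rewrite q0 ltxx.
Qed.

(* The value of a feasible matrix splits into the values of its diagonal blocks
   over the components, and cross terms with coefficients at least [min_diag Q];
   the blocks are completely positive since they have order at most four. *)
Lemma simplex_below_feasible (X : 'M[R]_n.+1) :
  defect_components_le Q 4 -> dnn_feasible X ->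
  exists2 x, simplex x & qform Q x <= mxinner Q X.
Proof.
move=> C4 /dnn_feasibleP[[sX pX nX] X1]; move vE : (mxinner Q X) => v.
apply: contrapT => nex.
have hS x : simplex x -> v < qform Q x.
  by move=> xS; rewrite ltNge; apply/negP => h; apply: nex; exists x.
have vm : v < min_diag Q.
  have [i ->] := min_diag_attained Q; rewrite -qform_delta; apply: hS; split.
    by move=> j; case: (_ == _).
  rewrite -[RHS](sum_delta i (fun _ => 1)).
  by apply: eq_bigr => j _; rewrite mul1r.
(* By homogeneity, [hS] makes M strictly copositive, and [vm] makes it positive between components.
   Its inner product with X is v - v = 0, so the diagonal blocks and the cross entries of X all
   vanish, although the entries of X sum to 1. *)
pose M i j := Q i j - v.
have qM x : qform M x = qform Q x - v * (\sum_i x i) ^+ 2.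
  rewrite /qform expr2 mulr_suml mulr_sumr -sumrB; apply: eq_bigr => i _ /=.
  rewrite !mulr_sumr -sumrB; apply: eq_bigr => j _ /=; rewrite /M. ring.
have cop x : (forall i, 0 <= x i) -> 0 < \sum_i x i -> 0 < qform M x.
  move=> x0; set s := \sum_i x i => s0.
  have := hS (fun i => x i / s); have -> : qform Q (fun i => x i / s) = qform Q x / s ^+ 2.
    rewrite /qform mulr_suml; apply: eq_bigr => i _; rewrite mulr_suml.
    by apply: eq_bigr => j _; field; rewrite gt_eqF.
  move=> h; rewrite qM subr_gt0 -ltr_pdivlMr ?exprn_gt0 //; apply: h; split.
    by move=> i; rewrite divr_ge0 // ltW.
  by rewrite -mulr_suml mulfV // gt_eqF.
pose rt := fingraph.root (defect Q).
have rtE i j : (rt i == rt j) = connect (defect Q) i j.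
  by rewrite root_connect //; apply: connect_defect_sym.
pose B r i j := (rt i == r)%:R * (rt j == r)%:R * X i j.
have cB r : comp_pos (B r).
  apply: (@comp_pos_le4 _ _ _ (defect_component Q r)); first exact: C4.
    split.
    - by move=> i j; rewrite /B sX (mulrC (rt i == r)%:R).
    - move=> w; have -> : qform (B r) w = qform X (fun i => (rt i == r)%:R * w i).
        apply: eq_bigr => i _; apply: eq_bigr => j _; rewrite /B.
        by move: (rt i == r)%:R (rt j == r)%:R => a b; ring.
      exact: pX.
    - by move=> i j; apply: mulr_ge0 => //; apply: mulr_ge0; apply: ler0n.
  move=> i j; rewrite inE => ri; rewrite /B; case: eqP; rewrite ?mul0r // => rtr.
  by move: ri; rewrite -rtr connect_defect_sym connect_root.
have split2 (F : 'I_n.+1 -> 'I_n.+1 -> R) :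
    \sum_i \sum_j F i j * X i j =
    (\sum_r \sum_i \sum_j F i j * B r i j) +
    \sum_i \sum_j F i j * ((rt i != rt j)%:R * X i j).
  rewrite [X in _ = X + _]exchange_big /= -big_split; apply: eq_bigr => i _ /=.
  rewrite [X in _ = X + _]exchange_big /= -big_split; apply: eq_bigr => j _ /=.
  rewrite -mulr_sumr -mulrDr; congr (_ * _).
  rewrite /B -mulr_suml -mulrDl.
  have -> : \sum_r (rt i == r)%:R * (rt j == r)%:R = (rt i == rt j)%:R :> R.
    rewrite (eq_bigr (fun r => (rt j == r)%:R * (r == rt i)%:R)); last first.
      by move=> r _; rewrite mulrC (eq_sym r).
    by rewrite sum_delta eq_sym.
  by case: (rt i == rt j); rewrite ?addr0 ?add0r mul1r.
have tot : \sum_i \sum_j M i j * X i j = 0.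
  have -> : \sum_i \sum_j M i j * X i j = v - v * \sum_i \sum_j X i j.
    transitivity (mxinner Q X - v * \sum_i \sum_j X i j); last by rewrite vE.
    rewrite mxinnerE mulr_sumr -sumrB; apply: eq_bigr => i _.
    by rewrite mulr_sumr -sumrB; apply: eq_bigr => j _; rewrite /M; ring.
  by rewrite X1 mulr1 subrr.
have crossM i j : rt i != rt j -> 0 < M i j.
  rewrite rtE => /min_diag_le_cross h; rewrite /M subr_gt0; exact: lt_le_trans vm h.
have cr0 : 0 <= \sum_i \sum_j M i j * ((rt i != rt j)%:R * X i j).
  apply: sumr_ge0 => i _; apply: sumr_ge0 => j _.
  case: (boolP (rt i != rt j)) => [h|_]; last by rewrite mul0r mulr0.
  by rewrite mul1r mulr_ge0 // ltW // crossM.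
have cop0 x : (forall i, 0 <= x i) -> 0 <= qform M x.
  move=> x0; have : 0 <= \sum_i x i by apply: sumr_ge0.
  rewrite le_eqVlt => /predU1P[/esym s0|]; last by move/(cop x x0)/ltW.
  have xz i : x i = 0 by apply: (psumr_eq0P _ s0).
  by rewrite /qform big1 // => i _; rewrite big1 // => j _; rewrite xz !mul0r.
have bl0 r : 0 <= \sum_i \sum_j M i j * B r i j by apply: comp_pos_inner_ge0.
have sbl0 : 0 <= \sum_r \sum_i \sum_j M i j * B r i j by apply: sumr_ge0.
have bE : \sum_r \sum_i \sum_j M i j * B r i j = 0 by have := split2 M; lra.
have cE : \sum_i \sum_j M i j * ((rt i != rt j)%:R * X i j) = 0.
  by have := split2 M; lra.
have one : \sum_i \sum_j X i j = 0; last by move: X1; rewrite one => /esym/eqP; rewrite oner_eq0.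
have -> : \sum_i \sum_j X i j = \sum_i \sum_j 1 * X i j.
  by apply: eq_bigr => i _; apply: eq_bigr => j _; rewrite mul1r.
rewrite (split2 (fun _ _ => 1)) big1 ?add0r; last first.
  move=> r _; rewrite -[RHS](@comp_pos_inner_eq0 M (B r)) //.
    by apply: eq_bigr => i _; apply: eq_bigr => j _; rewrite mul1r.
  exact: (psumr_eq0P _ bE).
rewrite big1 // => i _; rewrite big1 // => j _; rewrite mul1r.
have h : \sum_j M i j * ((rt i != rt j)%:R * X i j) = 0.
  apply: (psumr_eq0P _ cE) => // k _; apply: sumr_ge0 => l _.
  case: (boolP (rt k != rt l)) => [h|_]; last by rewrite mul0r mulr0.
  by rewrite mul1r mulr_ge0 // ltW // crossM.
have : M i j * ((rt i != rt j)%:R * X i j) = 0.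
  apply: (psumr_eq0P _ h) => // l _.
  case: (boolP (rt i != rt l)) => [hl|_]; last by rewrite mul0r mulr0.
  by rewrite mul1r mulr_ge0 // ltW // crossM.
case: (boolP (rt i != rt j)) => [hl|_ _]; last by rewrite mul0r.
by rewrite mul1r => /eqP; rewrite mulf_eq0 gt_eqF ?crossM //= => /eqP.
Qed.

End Components.
End Deterministic.

(** * Local KKT systems *)

Section LocalKKT.
Context (R : realType).

(** The local KKT system with vectors on the whole index set, zero off T. Solutions for supports of
    different sizes thus share one type, the same as a row of program memory. *)
Definition kkt_point n (Q : 'M[R]_n) (T : {set 'I_n}) (x : 'I_n -> R) (lam : R) :=
  [/\ forall i, i \notin T -> x i = 0,
      forall i, i \in T -> \sum_j Q i j * x j = lam & \sum_i x i = 1].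

Definition unique_kkt_point n (Q : 'M[R]_n) T x lam :=
  kkt_point Q T x lam /\
  forall x' lam', kkt_point Q T x' lam' -> (forall i, x' i = x i) /\ lam' = lam.

Lemma zero_extend_in n (T : {set 'I_n}) (x : 'cV[R]_#|T|) k :
  zero_extend x (enum_val k) 0 = x k 0.
Proof.
rewrite mxE (bigD1 k) //= big1 ?addr0 // => l /andP[/eqP e].
by rewrite (enum_val_inj e) eqxx.
Qed.

Lemma zero_extend_out n (T : {set 'I_n}) (x : 'cV[R]_#|T|) i :
  i \notin T -> zero_extend x i 0 = 0.
Proof.
move=> iT; rewrite mxE big1 // => k /eqP kE.
by move: iT; rewrite -kE enum_valP.
Qed.

Lemma sum_zero_extend n (T : {set 'I_n}) (x : 'cV[R]_#|T|) (F : 'I_n -> R) :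
  \sum_i F i * zero_extend x i 0 = \sum_k F (enum_val k) * x k 0.
Proof.
transitivity (\sum_(i in T) F i * zero_extend x i 0).
  rewrite [LHS](bigID (mem T)) /= [X in _ + X]big1 ?addr0 // => i iT.
  by rewrite zero_extend_out // mulr0.
rewrite big_enum_val /=; apply: eq_bigr => k _.
by rewrite zero_extend_in.
Qed.

Lemma kkt_systemP n (Q : 'M[R]_n) (T : {set 'I_n}) (x : 'cV[R]_#|T|) lam :
  kkt_system Q x lam <-> kkt_point Q T (fun i => zero_extend x i 0) lam.
Proof.
have S : ((const_mx 1 : 'cV[R]_#|T|)^T *m x = 1%:M) <->
    \sum_i zero_extend x i 0 = 1.
  have -> : \sum_i zero_extend x i 0 = \sum_k x k 0.
    have := sum_zero_extend x (fun _ => 1).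
    by under eq_bigr do rewrite mul1r; under [in RHS]eq_bigr do rewrite mul1r.
  split=> [/matrixP/(_ 0 0)|h].
    by rewrite !mxE /= mulr1n => <-; apply: eq_bigr => k _; rewrite !mxE mul1r.
  apply/matrixP => i j; rewrite !ord1 !mxE /= mulr1n -[RHS]h.
  by apply: eq_bigr => k _; rewrite !mxE mul1r.
split=> [[E /S s1]|[z E /S s1]]; split=> //.
- by move=> i; exact: zero_extend_out.
- move=> i iT; rewrite sum_zero_extend -(enum_rankK_in iT iT).
  have /matrixP/(_ (enum_rank_in iT i) 0) := E; rewrite !mxE mulr1 => <-.
  by apply: eq_bigr => k _; rewrite mxE.
apply/matrixP => k j; rewrite ord1 !mxE mulr1 -(E _ (enum_valP k)) sum_zero_extend.
by apply: eq_bigr => l _; rewrite mxE.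
Qed.

Lemma zero_extend_restrict n (T : {set 'I_n}) (f : 'I_n -> R) :
  (forall i, i \notin T -> f i = 0) ->
  forall i, zero_extend (\col_(k < #|T|) f (enum_val k)) i 0 = f i.
Proof.
move=> f0 i; have [iT|iT] := boolP (i \in T); last by rewrite zero_extend_out // f0.
by rewrite -(enum_rankK_in iT iT) zero_extend_in mxE.
Qed.

Lemma eq_kkt_point n (Q : 'M[R]_n) T (x y : 'I_n -> R) lam :
  x =1 y -> kkt_point Q T x lam -> kkt_point Q T y lam.
Proof.
move=> e [z E s]; split=> [i iT|i iT|].
- by rewrite -e z.
- by rewrite -(E i iT); apply: eq_bigr => j _; rewrite e.
- by rewrite -s; apply: eq_bigr => j _; rewrite e.
Qed.

Lemma kkt_unique_solutionP n (Q : 'M[R]_n) (T : {set 'I_n}) (x : 'cV[R]_#|T|) lam :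
  kkt_unique_solution Q x lam <->
  unique_kkt_point Q T (fun i => zero_extend x i 0) lam.
Proof.
split=> [[/kkt_systemP kx u]|[/kkt_systemP kx u]]; split=> //.
  move=> x' lam' kx'; have [z _ _] := kx'.
  have ze := zero_extend_restrict z.
  have [|e ->] := u (\col_(k < #|T|) x' (enum_val k)) lam'.
    by apply/kkt_systemP; apply: eq_kkt_point kx' => i; rewrite ze.
  by split=> // i; rewrite -e ze.
move=> x' lam' /kkt_systemP/u[e ->]; split=> //.
by apply/matrixP => k j; rewrite ord1 -!zero_extend_in e.
Qed.

(** Stationarity is weighted by x and summed with the normalization. This is why comparing
    multipliers compares objective values. *)
Lemma kkt_point_value n (Q : 'M[R]_n) T x lam :
  kkt_point Q T x lam -> qform Q x = lam.
Proof.
move=> [z E s]; rewrite -[RHS]mul1r -s mulr_suml; apply: eq_bigr => i _.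
have [iT|iT] := boolP (i \in T); last first.
  by rewrite z // mul0r big1 // => j _; rewrite !mul0r.
by rewrite -(E i iT) mulr_sumr; apply: eq_bigr => j _; rewrite mulrA.
Qed.

Lemma outer_inj n (x y : 'I_n -> R) : simplex x -> simplex y ->
  outer x = outer y -> x =1 y.
Proof.
move=> [_ x1] [_ y1] /matrixP E i; rewrite -[LHS]mulr1 -[RHS]mulr1.
rewrite -{1}x1 -y1 !mulr_sumr; apply: eq_bigr => j _.
by have := E i j; rewrite !mxE.
Qed.

Lemma qform_line n (Q : 'M[R]_n) (x d : 'I_n -> R) t : symf Q ->
  qform Q (fun i => x i + t * d i) =
  qform Q x + 2 * t * (\sum_i d i * \sum_j Q i j * x j) + t ^+ 2 * qform Q d.
Proof.
move=> sQ; have H : \sum_i d i * (\sum_j Q i j * x j) = \sum_i \sum_j x i * Q i j * d j.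
  rewrite exchange_big; apply: eq_bigr => i _ /=; rewrite mulr_sumr.
  by apply: eq_bigr => j _; rewrite (sQ j i); ring.
move: H; set G := \sum_i d i * _ => H.
have -> : 2 * t * G = t * G + t * \sum_i \sum_j x i * Q i j * d j.
  by rewrite -H; ring.
rewrite /G {G H}; under [X in t * X]eq_bigr => i _ do rewrite mulr_sumr.
rewrite /qform !mulr_sumr -!big_split /=; apply: eq_bigr => i _.
rewrite !mulr_sumr -!big_split /=; apply: eq_bigr => j _; ring.
Qed.

(** Small steps along d in both directions stay in the simplex, so the linear term cannot help and
    must vanish. If the curvature vanishes as well, a whole segment is optimal, which uniqueness
    forbids unless d = 0. *)
Lemma unique_min_direction n (Q : 'M[R]_n) (x d : 'I_n -> R) : symf Q ->
  simplex x ->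
  (forall y, simplex y -> qform Q x <= qform Q y) ->
  (forall y, simplex y -> qform Q y = qform Q x -> y =1 x) ->
  \sum_i d i = 0 -> (forall i, x i = 0 -> d i = 0) ->
  \sum_i d i * (\sum_j Q i j * x j) = 0 /\
  (qform Q d = 0 -> forall i, d i = 0).
Proof.
move=> sQ [x0 x1] mn un d1 dz.
have [e e0 eP] : exists2 e : R, 0 < e & forall i, e * `|d i| <= x i.
  (* Admissible step length for coordinate i. Where x vanishes so does d, and any positive length
     will do. *)
  pose h i := if x i == 0 then 1 else x i / (1 + `|d i|).
  have hp i : 0 < h i.
    rewrite /h; case: eqP => // /eqP xi; apply: divr_gt0.
      by rewrite lt_def xi x0.
    by rewrite ltr_pwDl.
  exists (\big[Num.min/1]_i h i); first by apply/bigmin_gtP; split.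
  move=> i; have := bigmin_le_cond 1 h (erefl : xpredT i).
  rewrite {2}/h; case: eqP => [xi _|_ le].
    by rewrite dz // normr0 mulr0 xi.
  have dp : 0 < 1 + `|d i| by rewrite ltr_pwDl.
  apply: le_trans (ler_wpM2r _ le) _ => //.
  by rewrite -mulrA ler_piMr // mulrC ler_pdivrMr // mul1r lerDr.
have S t : `|t| <= e -> simplex (fun i => x i + t * d i).
  move=> te; split=> [i|]; last by rewrite big_split /= -mulr_sumr d1 mulr0 addr0.
  have : `|t * d i| <= x i.
    by rewrite normrM; apply: le_trans (eP i); apply: ler_wpM2r.
  by rewrite ler_norml => /andP[h _]; lra.
set g := \sum_i _; set q := qform Q d.
have H t : `|t| <= e -> 0 <= 2 * t * g + t ^+ 2 * q.
  by move=> te; have := mn _ (S t te); rewrite qform_line // -/g -/q; lra.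
have g0 : g = 0.
  apply/eqP/negPn/negP => gn.
  have gp : 0 < `|g| by rewrite normr_gt0.
  (* At this length the quadratic term is at most half of the linear one, so a step against the sign
     of g would decrease the value. *)
  pose t0 := Num.min e (`|g| / (1 + `|q|)).
  have qp : 0 < 1 + `|q| by rewrite ltr_pwDl.
  have t0p : 0 < t0 by rewrite lt_min e0 divr_gt0.
  have t0e : t0 <= e by rewrite ge_min lexx.
  have t0g : t0 * `|q| <= `|g|.
    have : t0 * (1 + `|q|) <= `|g| by rewrite -ler_pdivlMr // ge_min lexx orbT.
    by rewrite mulrDr mulr1; lra.
  have tq : t0 * q <= `|g|.
    by apply: le_trans t0g; apply: ler_wpM2l; [exact: ltW | exact: ler_norm].
  have [gs|gs] := leP 0 g.
    have := H (- t0); rewrite normrN gtr0_norm // => /(_ t0e).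
    rewrite ger0_norm // in tq gp.
    have -> : 2 * - t0 * g + (- t0) ^+ 2 * q = t0 * (t0 * q - 2 * g) by ring.
    by rewrite pmulr_rge0 //; lra.
  have := H t0; rewrite gtr0_norm // => /(_ t0e).
  rewrite ltr0_norm // in tq gp.
  have -> : 2 * t0 * g + t0 ^+ 2 * q = t0 * (t0 * q + 2 * g) by ring.
  by rewrite pmulr_rge0 //; lra.
split=> // q0 i; have ee : `|e| <= e by rewrite gtr0_norm.
have := un _ (S e ee); rewrite qform_line // -/g -/q g0 q0 !mulr0 !addr0.
move=> /(_ erefl i)/eqP; rewrite -subr_eq0 addrAC subrr add0r mulf_eq0.
by rewrite gt_eqF //= => /eqP.
Qed.

Lemma simplex_delta n (i : 'I_n) : simplex (fun j => (j == i)%:R : R).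
Proof.
split=> [j|]; first exact: ler0n.
by rewrite -[RHS](sum_delta i (fun _ => 1)); apply: eq_bigr => j _; rewrite mul1r.
Qed.

Section UniqueOptimum.
Context (n : nat) (Q : 'M[R]_n.+1) (sQ : symf Q).

(** The directions e_i - e_k between support indices make the gradient constant on the support. A
    second KKT point differs from x by some d of sum zero with Qd constant on the support; such a d
    has no curvature and is zero by [unique_min_direction]. *)
Lemma unique_rank_one_kkt : dnn_unique_rank_one Q ->
  exists (T : {set 'I_n.+1}) x lam,
   [/\ is_local_support Q T, unique_kkt_point Q T x lam, simplex x,
       forall y, simplex y -> lam <= qform Q y
     & forall y, simplex y -> qform Q y <= lam -> dnn_optimal Q (outer y)].
Proof.
move=> [X [[fX oX] uX rX]]; have [x sx XE] := rank1_outer fX rX.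
subst X.
have mn y : simplex y -> qform Q x <= qform Q y.
  by move=> sy; rewrite -!mxinner_outer; apply: oX; apply: dnn_feasible_outer.
have op y : simplex y -> qform Q y <= qform Q x -> dnn_optimal Q (outer y).
  move=> sy le; split; first exact: dnn_feasible_outer.
  by move=> Y fY; apply: le_trans (oX Y fY); rewrite !mxinner_outer.
have un y : simplex y -> qform Q y = qform Q x -> y =1 x.
  move=> sy E; apply: outer_inj => //; apply: uX; apply: op => //.
  by rewrite E.
have [x0 x1] := sx.
pose T := [set i | x i != 0]; pose g i := \sum_j Q i j * x j.
have xT i : i \notin T -> x i = 0 by rewrite inE negbK => /eqP.
have [i0 i0T] : exists i, i \in T.
  apply/existsP; apply: contraT => /existsPn h; move: x1.
  by rewrite big1 => [/esym/eqP|i _]; rewrite ?oner_eq0 ?xT ?h.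
have gE i k : i \in T -> k \in T -> g i = g k.
  move=> iT kT; pose d j : R := (j == i)%:R - (j == k)%:R.
  have [||] := @unique_min_direction _ Q x d sQ sx mn un.
  - by rewrite sumrB !(simplex_delta _).2 subrr.
  - move=> j xj; rewrite /d.
    have ji : j != i by apply: contraTneq iT => <-; rewrite inE xj eqxx.
    have jk : j != k by apply: contraTneq kT => <-; rewrite inE xj eqxx.
    by rewrite (negPf ji) (negPf jk) subrr.
  move=> + _; rewrite -/(g _).
  under eq_bigr => j _ do rewrite mulrC mulrBr.
  by rewrite sumrB !sum_delta => /eqP; rewrite subr_eq0 => /eqP.
pose lam := g i0.
have kx : kkt_point Q T x lam by split=> // i iT; apply: (gE i i0).
have lamE : lam = qform Q x by rewrite (kkt_point_value kx).
exists T, x, lam; split=> //; last 2 first.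
- by move=> y /mn; rewrite lamE.
- by move=> y sy; rewrite lamE; apply: op.
- split; first by apply/card_gt0P; exists i0.
  exists i0; apply/fintype.subsetP => k kT; rewrite inE; apply: contraT => nk.
  (* Indicator of the component of [i0], which carries the mass w of x. If a support index k lay
     outside, the normalized restriction of x would differ from x and have value above q, while
     cross entries are at least [min_diag Q] >= q. Adding up gives q > q (w + (1 - w))^2. *)
  pose C i : R := (connect (defect Q) i0 i)%:R.
  pose w := \sum_i C i * x i.
  have C01 i : C i = 0 \/ C i = 1 by rewrite /C; case: connect; [right|left].
  have C0 i : 0 <= C i by exact: ler0n.
  have C1 i : 0 <= 1 - C i by case: (C01 i) => ->; lra.
  have xp i : i \in T -> 0 < x i by rewrite inE lt_def x0 => ->.
  have w0 : 0 < w.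
    rewrite /w (bigD1 i0) //= {1}/C connect0 mul1r ltr_pwDl ?xp //.
    by apply: sumr_ge0 => i _; rewrite mulr_ge0.
  have wE : \sum_i (1 - C i) * x i = 1 - w.
    transitivity (\sum_i x i - w); last by rewrite x1.
    by rewrite /w -sumrB; apply: eq_bigr => i _; rewrite mulrBl mul1r.
  have u0 : 0 < 1 - w.
    rewrite -wE (bigD1 k) //= {1}/C (negPf nk) subr0 mul1r ltr_pwDl ?xp //.
    by apply: sumr_ge0 => i _; rewrite mulr_ge0.
  have scale (z : 'I_n.+1 -> R) s : 0 < s -> (forall i, 0 <= z i) -> \sum_i z i = s ->
      simplex (fun i => z i / s) /\ qform Q (fun i => z i / s) = qform Q z / s ^+ 2.
    move=> s0 z0 zs; split; first split=> [i|].
    - by rewrite divr_ge0 // ltW.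
    - by rewrite -mulr_suml zs mulfV // gt_eqF.
    rewrite /qform mulr_suml; apply: eq_bigr => i _; rewrite mulr_suml.
    by apply: eq_bigr => j _; field; rewrite gt_eqF.
  have [sC qC] := scale (fun i => C i * x i) w w0 (fun i => mulr_ge0 (C0 i) (x0 i)) erefl.
  have [sD qD] := scale (fun i => (1 - C i) * x i) _ u0 (fun i => mulr_ge0 (C1 i) (x0 i)) wE.
  set q := qform Q x in mn un lamE.
  have hC : q * w ^+ 2 < qform Q (fun i => C i * x i).
    rewrite -ltr_pdivlMr ?exprn_gt0 // -qC lt_def mn // andbT.
    apply/eqP => /un/(_ k); rewrite /C (negPf nk) !mul0r => /(_ sC) xk.
    by have := xp _ kT; rewrite -xk ltxx.
  have hD : q * (1 - w) ^+ 2 <= qform Q (fun i => (1 - C i) * x i).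
    by rewrite -ler_pdivlMr ?exprn_gt0 // -qD mn.
  have hm : q <= min_diag Q.
    have [i ->] := min_diag_attained Q; rewrite -qform_delta; apply: mn.
    exact: simplex_delta.
  pose cr := \sum_i \sum_j (C i * x i) * Q i j * ((1 - C j) * x j).
  have hcr : q * (w * (1 - w)) <= cr.
    rewrite -wE /w mulr_suml mulr_sumr; apply: ler_sum => i _.
    rewrite !mulr_sumr; apply: ler_sum => j _.
    have -> : C i * x i * Q i j * ((1 - C j) * x j) =
      Q i j * (C i * x i * ((1 - C j) * x j)) by ring.
    have [ci|ci] := boolP (connect (defect Q) i0 i); last first.
      by rewrite /C (negPf ci) !mul0r !mulr0.
    have [cj|cj] := boolP (connect (defect Q) i0 j).
      by rewrite {2 4}/C cj subrr !mul0r !mulr0.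
    apply: ler_wpM2r; first by rewrite !mulr_ge0.
    apply: le_trans hm _; apply: min_diag_le_cross => //.
    by apply: contraNN cj; apply: connect_trans.
  have : q = qform Q (fun i => C i * x i) + qform Q (fun i => (1 - C i) * x i) + 2 * cr.
    rewrite /q; have -> : qform Q x = qform Q (fun i => C i * x i + 1 * ((1 - C i) * x i)).
      by apply: eq_bigr => i _; apply: eq_bigr => j _; ring.
    rewrite qform_line // mulr1 expr1n mul1r addrAC; congr (_ + _ * _).
    rewrite /cr [RHS]exchange_big; apply: eq_bigr => i _ /=; rewrite mulr_sumr.
    by apply: eq_bigr => j _; rewrite (sQ j); ring.
  have : q = q * w ^+ 2 + q * (1 - w) ^+ 2 + 2 * (q * (w * (1 - w))) by ring.
  by lra.
split=> // x' lam' kx'; have [z' E' s'] := kx'.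
pose d i := x' i - x i.
have d1 : \sum_i d i = 0 by rewrite sumrB s' x1 subrr.
have dT i : x i = 0 -> d i = 0.
  by move=> xi; rewrite /d xi z' ?subr0 // inE xi eqxx.
have [_ dq] := unique_min_direction sQ sx mn un d1 dT.
have Qd i : i \in T -> \sum_j Q i j * d j = lam' - lam.
  move=> iT; have gi : \sum_j Q i j * x j = lam := gE i i0 iT i0T.
  rewrite -(E' i iT) -gi -sumrB.
  by apply: eq_bigr => j _; rewrite /d mulrBr.
have dz : forall i, d i = 0.
  apply: dq; transitivity (\sum_i d i * (lam' - lam)); last by rewrite -mulr_suml d1 mul0r.
  apply: eq_bigr => i _; have [iT|iT] := boolP (i \in T).
    by rewrite -(Qd i iT) mulr_sumr; apply: eq_bigr => j _; rewrite mulrA.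
  by rewrite dT ?xT // mul0r big1 // => j _; rewrite !mul0r.
split=> [i|]; first by apply/eqP; rewrite -subr_eq0; apply/eqP/dz.
apply/eqP; rewrite -subr_eq0 -(Qd _ i0T) big1 // => j _.
by rewrite dz mulr0.
Qed.

End UniqueOptimum.
End LocalKKT.

(** * Running times on the real RAM *)

Fixpoint loop_free (c : cmd) : bool :=
  match c with
  | Seq c1 c2 | If _ c1 c2 => loop_free c1 && loop_free c2
  | While _ _ => false
  | _ => true
  end.

Fixpoint max_cost (c : cmd) : nat :=
  match c with
  | Skip => 1
  | SetN _ e1 e2 e => (ncost e1 + ncost e2 + ncost e).+1
  | SetR _ e1 e2 e => (ncost e1 + ncost e2 + rcost e).+1
  | Seq c1 c2 => max_cost c1 + max_cost c2
  | If b c1 c2 => (bcost b + (max_cost c1 + max_cost c2)).+1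
  | While _ _ => 0
  end.

Fixpoint nat_writes (c : cmd) : seq nat :=
  match c with
  | SetN a _ _ _ => [:: a]
  | Seq c1 c2 | If _ c1 c2 => nat_writes c1 ++ nat_writes c2
  | While _ c => nat_writes c
  | _ => [::]
  end.

Fixpoint real_writes (c : cmd) : seq nat :=
  match c with
  | SetR a _ _ _ => [:: a]
  | Seq c1 c2 | If _ c1 c2 => real_writes c1 ++ real_writes c2
  | While _ c => real_writes c
  | _ => [::]
  end.

Definition dim_exp : nexp := NGet 0 (NLit 0) (NLit 0).
Definition counter (x : nat) : nexp := NGet x (NLit 0) (NLit 0).

(* The counter of each loop lives in an array of its own. *)
Definition For (x : nat) (body : cmd) : cmd :=
  Seq (SetN x (NLit 0) (NLit 0) (NLit 0))
    (While (BLeN (NAdd (counter x) (NLit 1)) dim_exp)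
       (Seq body (SetN x (NLit 0) (NLit 0) (NAdd (counter x) (NLit 1))))).

Section Runs.
Context (R : realType).
Implicit Types (s : memory R).

(** Agrees with [exec] on loop-free commands, by [runs_run], and reduces by computation, so loop
    bodies are verified by rewriting. *)
Fixpoint run (c : cmd) s : memory R :=
  match c with
  | Skip | While _ _ => s
  | SetN a e1 e2 e => set_nmem s a (neval s e1) (neval s e2) (neval s e)
  | SetR a e1 e2 e => set_rmem s a (neval s e1) (neval s e2) (reval s e)
  | Seq c1 c2 => run c2 (run c1 s)
  | If b c1 c2 => if beval s b then run c1 s else run c2 s
  end.

Lemma run_Seq c1 c2 s : run (Seq c1 c2) s = run c2 (run c1 s).
Proof. by []. Qed.

Lemma run_If b c1 c2 s : run (If b c1 c2) s = if beval s b then run c1 s else run c2 s.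
Proof. by []. Qed.

(** The granularity is a whole array: that a later phase preserves an earlier result becomes a
    membership test in a list of array names. *)
Definition frame (c : cmd) s s' :=
  (forall a i j, a \notin nat_writes c -> nmem s' a i j = nmem s a i j) /\
  (forall a i j, a \notin real_writes c -> rmem s' a i j = rmem s a i j).

Lemma exec_frame c s t s' : exec c s t s' -> frame c s s'.
Proof.
elim=> {c s t s'} /=.
- by [].
- move=> s a e1 e2 e; split=> // b i j /=; rewrite inE => /negPf ba.
  by rewrite /array_set ba.
- move=> s a e1 e2 e; split=> // b i j /=; rewrite inE => /negPf ba.
  by rewrite /array_set ba.
- move=> c1 c2 s s1 s2 t1 t2 _ [n1 r1] _ [n2 r2]; split=> a i j /=;
  by rewrite mem_cat negb_or => /andP[h1 h2]; rewrite ?n2 ?n1 ?r2 ?r1.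
- move=> b c1 c2 s s1 t _ _ [n1 r1]; split=> a i j /=;
  by rewrite mem_cat negb_or => /andP[h1 h2]; rewrite ?n1 ?r1.
- move=> b c1 c2 s s1 t _ _ [n1 r1]; split=> a i j /=;
  by rewrite mem_cat negb_or => /andP[h1 h2]; rewrite ?n1 ?r1.
- move=> b c s s1 s2 t1 t2 _ _ [n1 r1] _ [n2 r2]; split=> a i j /= h.
    by rewrite n2 ?n1.
  by rewrite r2 ?r1.
- by move=> b c s _; split.
Qed.

Definition runs c s (b : nat) (post : memory R -> Prop) :=
  exists t s', [/\ exec c s t s', (t <= b)%N & post s'].

Lemma runs_weaken c s b b' (post post' : memory R -> Prop) :
  runs c s b post -> (b <= b')%N -> (forall s', post s' -> post' s') ->
  runs c s b' post'.
Proof.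
move=> [t [s' [e le p]]] bb h; exists t, s'; split=> //; last exact: h.
exact: leq_trans bb.
Qed.

Lemma runs_frame c s b (post : memory R -> Prop) :
  runs c s b post -> runs c s b (fun s' => post s' /\ frame c s s').
Proof.
by move=> [t [s' [e le p]]]; exists t, s'; split=> //; split=> //; exact: exec_frame e.
Qed.

Lemma runs_seq c1 c2 s b1 b2 (post1 post : memory R -> Prop) :
  runs c1 s b1 post1 -> (forall s1, post1 s1 -> frame c1 s s1 -> runs c2 s1 b2 post) ->
  runs (Seq c1 c2) s (b1 + b2) post.
Proof.
move=> [t1 [s1 [e1 le1 p1]]] h; have [t2 [s2 [e2 le2 p2]]] := h s1 p1 (exec_frame e1).
exists (t1 + t2)%N, s2; split=> //; [exact: exec_Seq e2 | exact: leq_add].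
Qed.

Lemma runs_run c s (post : memory R -> Prop) :
  loop_free c -> post (run c s) -> runs c s (max_cost c) post.
Proof.
move=> lf p; suff [t [e le]] : exists t, exec c s t (run c s) /\ (t <= max_cost c)%N.
  by exists t, (run c s).
elim: c lf s {post p} => [|a e1 e2 e|a e1 e2 e|c1 IH1 c2 IH2|b c1 IH1 c2 IH2|//] /=.
- by move=> _ s; exists 1%N; split=> //; exact: exec_Skip.
- by move=> _ s; eexists; split; [exact: exec_SetN|].
- by move=> _ s; eexists; split; [exact: exec_SetR|].
- move=> /andP[/IH1 h1 /IH2 h2] s; have [t1 [e1 l1]] := h1 s.
  have [t2 [e2 l2]] := h2 (run c1 s).
  exists (t1 + t2)%N; split; [exact: exec_Seq e2 | exact: leq_add].
move=> /andP[/IH1 h1 /IH2 h2] s; case: ifP => [bs|/negbT bs].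
  have [t [e l]] := h1 s; exists (bcost b + t).+1; split; first exact: exec_If_true.
  by rewrite ltnS leq_add2l (leq_trans l) // leq_addr.
have [t [e l]] := h2 s; exists (bcost b + t).+1; split; first exact: exec_If_false.
by rewrite ltnS leq_add2l (leq_trans l) // leq_addl.
Qed.

(** One iteration costs at most 20 steps beyond the body and leaving the loop costs 10; since N > 0,
    these and the initialization fit into 40 N. The increment of the counter lies outside [body], so
    the invariant has to survive writes to that cell. *)
Lemma runs_for x body s N b (Inv : nat -> memory R -> Prop) :
  (0 < N)%N -> nmem s 0 0 0 = N -> x != 0%N ->
  x \notin nat_writes body -> 0%N \notin nat_writes body ->
  (forall k s' v, Inv k s' -> Inv k (set_nmem s' x 0 0 v)) ->
  Inv 0%N s ->
  (forall k s', (k < N)%N -> nmem s' 0 0 0 = N -> nmem s' x 0 0 = k -> Inv k s' ->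
     runs body s' b (Inv k.+1)) ->
  runs (For x body) s ((b + 40) * N) (Inv N).
Proof.
move=> N0 dN x0 xb zb stab I0 step.
have W m k s' : (m + k)%N = N -> nmem s' 0 0 0 = N -> nmem s' x 0 0 = k -> Inv k s' ->
    runs (While (BLeN (NAdd (counter x) (NLit 1)) dim_exp)
       (Seq body (SetN x (NLit 0) (NLit 0) (NAdd (counter x) (NLit 1))))) s'
      (m * (b + 20) + 10) (Inv N).
  elim: m k s' => [|m IH] k s' mk d' c' Ik.
    exists (bcost (BLeN (NAdd (counter x) (NLit 1)) dim_exp)).+1, s'; split.
    - by apply: exec_While_false; rewrite /= c' d' addn1 -mk add0n ltnn.
    - by [].
    - by rewrite -mk.
  have kN : (k < N)%N by rewrite -mk addSn ltnS leq_addl.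
  have [t1 [s1 [e1 l1 p1]]] := step k s' kN d' c' Ik.
  have [fn _] := exec_frame e1.
  have d1 : nmem s1 0 0 0 = N by rewrite fn.
  have c1 : nmem s1 x 0 0 = k by rewrite fn.
  have e2 := exec_SetN s1 x (NLit 0) (NLit 0) (NAdd (counter x) (NLit 1)).
  set s2 := set_nmem _ _ _ _ _ in e2.
  have [||||t3 [s3 [e3 l3 p3]]] := IH k.+1 s2.
  - by rewrite addnS -addSn.
  - by rewrite /s2 /= /array_set eq_sym (negPf x0).
  - by rewrite /s2 /= /array_set !eqxx /= c1 addn1.
  - by apply: stab.
  eexists; exists s3; split; last exact: p3.
    apply: exec_While_true e3; last by apply: exec_Seq e1 e2.
    by rewrite /= c' d' addn1.
  by rewrite /=; lia.
have e0 := exec_SetN s x (NLit 0) (NLit 0) (NLit 0).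
set s0 := set_nmem _ _ _ _ _ in e0.
have [||||t [s' [e l p]]] := W N 0%N s0.
- by rewrite addn0.
- by rewrite /s0 /= /array_set eq_sym (negPf x0).
- by rewrite /s0 /= /array_set !eqxx.
- exact: stab.
eexists; exists s'; split; last exact: p.
  exact: exec_Seq e0 e.
by rewrite /=; nia.
Qed.

(** Bounds keep the form constant times size. The constants can then be left as existential
    variables, introduced before any dimension, and unification assembles them from the program
    text. *)
Lemma runs_seq_scaled c1 c2 s M K1 K2 (post1 post : memory R -> Prop) :
  runs c1 s (K1 * M) post1 ->
  (forall s1, post1 s1 -> frame c1 s s1 -> runs c2 s1 (K2 * M) post) ->
  runs (Seq c1 c2) s ((K1 + K2) * M) post.
Proof. by move=> h1 h2; rewrite mulnDl; exact: runs_seq h1 h2. Qed.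

Lemma runs_run_scaled c s M (post : memory R -> Prop) :
  (0 < M)%N -> loop_free c -> post (run c s) -> runs c s (max_cost c * M) post.
Proof.
move=> M0 lf p; apply: (runs_weaken (runs_run lf p)) => //; exact: leq_pmulr.
Qed.

Lemma runs_for_scaled x body s N K M (Inv : nat -> memory R -> Prop) :
  (0 < N)%N -> (0 < M)%N -> nmem s 0 0 0 = N -> x != 0%N ->
  x \notin nat_writes body -> 0%N \notin nat_writes body ->
  (forall k s' v, Inv k s' -> Inv k (set_nmem s' x 0 0 v)) ->
  Inv 0%N s ->
  (forall k s', (k < N)%N -> nmem s' 0 0 0 = N -> nmem s' x 0 0 = k -> Inv k s' ->
     runs body s' (K * M) (Inv k.+1)) ->
  runs (For x body) s ((K + 40) * (M * N)) (Inv N).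
Proof.
move=> N0 M0 dN x0 xb zb stab I0 step.
apply: (runs_weaken (runs_for N0 dN x0 xb zb stab I0 step)) => //.
by rewrite mulnA leq_mul2r mulnDl leq_add2l leq_pmulr ?orbT.
Qed.

End Runs.

(** * Determinants and Cramer's rule on the real RAM *)

Definition sum_exp (l : seq rexp) : rexp := foldr RAdd (RLit 0) l.

Definition sign_exp (b : bool) (e : rexp) : rexp := if b then RSub (RLit 0) e else e.

(** Laplace expansion along the first row, unrolled when the program is generated: k is a fixed
    number and not a memory cell, so the evaluation cost is a constant. *)
Fixpoint det_exp (k : nat) (A : nat -> nat -> rexp) : rexp :=
  match k with
  | 0 => RLit 1
  | k'.+1 => sum_exp [seq sign_exp (odd j)
      (RMul (A 0 j) (det_exp k' (fun a b => A a.+1 (bump j b)))) | j <- iota 0 k'.+1]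
  end.

(** Cofactors of the last row of a matrix of order k + 1; these suffice because the right-hand side
    of the bordered system is the last unit vector. *)
Definition cofactor_exp (k l : nat) (A : nat -> nat -> rexp) : rexp :=
  sign_exp (odd (k + l)) (det_exp k (fun a b => A (bump k a) (bump l b))).

Section Evaluation.
Context (R : realType).
Implicit Types (s : memory R).

Lemma reval_sum_exp s l : reval s (sum_exp l) = \sum_(e <- l) reval s e.
Proof. by elim: l => [|e l IH]; rewrite ?big_nil //= big_cons IH. Qed.

Lemma reval_sign_exp s b e : reval s (sign_exp b e) = (-1) ^+ b * reval s e.
Proof. by case: b; rewrite /= ?sub0r ?expr1 ?mulN1r // expr0 mul1r. Qed.

Lemma reval_det_exp s k A :
  reval s (det_exp k A) = \det (\matrix_(i < k, j < k) reval s (A i j)).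
Proof.
elim: k A => [|k IH] A; first by rewrite det_mx00.
rewrite (expand_det_row _ ord0) [det_exp _ _]/= -/(iota 0 k.+1) -/(sum_exp _).
rewrite -[RAdd _ _]/(sum_exp [seq sign_exp (odd j)
      (RMul (A 0 j) (det_exp k (fun a b => A a.+1 (bump j b)))) | j <- iota 0 k.+1]).
rewrite reval_sum_exp big_map -[iota 0 _]/(index_iota 0 k.+1) big_mkord.
apply: eq_bigr => j _; rewrite reval_sign_exp signr_odd /= IH mxE /cofactor add0n.
rewrite mulrCA; congr (_ * (_ * \det _)).
by apply/matrixP => a b; rewrite !mxE.
Qed.

Lemma reval_cofactor_exp s k A (l : 'I_k.+1) :
  reval s (cofactor_exp k l A) =
  cofactor (\matrix_(i < k.+1, j < k.+1) reval s (A i j)) ord_max l.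
Proof.
rewrite /cofactor_exp reval_sign_exp signr_odd reval_det_exp /cofactor.
by congr (_ * \det _); apply/matrixP => a b; rewrite !mxE.
Qed.

End Evaluation.

Section Bordered.
Context (R : realType) (n : nat) (Q : 'M[R]_n) (s : nat) (e : nat -> 'I_n).
Hypothesis injE : forall k l, (k < s)%N -> (l < s)%N -> e k = e l -> k = l.

(** Q[T] bordered by ones with a zero corner. Taking the negated multiplier as the last unknown
    keeps this matrix symmetric and free of signs. *)
Definition bordered_entry (i j : nat) : R :=
  if (i < s)%N then if (j < s)%N then Q (e i) (e j) else 1
  else if (j < s)%N then 1 else 0.

Definition bordered : 'M[R]_s.+1 := \matrix_(i, j) bordered_entry i j.

Definition listed_set : {set 'I_n} := [set e k | k : 'I_s]%SET.

Definition listed_vec (y : 'I_s.+1 -> R) (v : 'I_n) : R :=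
  \sum_(k < s | e k == v) y (widen_ord (leqnSn s) k).

Definition cramer (l : 'I_s.+1) : R := cofactor bordered ord_max l / \det bordered.

Lemma sum_listed (F x : 'I_n -> R) : (forall i, i \notin listed_set -> x i = 0) ->
  \sum_i F i * x i = \sum_(k < s) F (e k) * x (e k).
Proof.
move=> x0; transitivity (\sum_(i in listed_set) F i * x i).
  rewrite [LHS](bigID (mem listed_set)) /= [X in _ + X]big1 ?addr0 // => i iT.
  by rewrite x0 // mulr0.
rewrite big_imset //= => k l _ _ /injE h; apply: val_inj; exact: h.
Qed.

Lemma listed_vec_in y (k : 'I_s) : listed_vec y (e k) = y (widen_ord (leqnSn s) k).
Proof.
rewrite /listed_vec (bigD1 k) //= big1 ?addr0 // => l /andP[/eqP el].
by rewrite (val_inj (injE (ltn_ord l) (ltn_ord k) el)) eqxx.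
Qed.

Lemma listed_vec_out y i : i \notin listed_set -> listed_vec y i = 0.
Proof.
move=> iT; rewrite /listed_vec big1 // => k /eqP ek.
by move: iT; rewrite -ek imset_f.
Qed.

(* Row [s] of the bordered system is the normalization, the other rows are the
   stationarity equations with the multiplier [- y s]. *)
Lemma bordered_kkt (y : 'I_s.+1 -> R) (x : 'I_n -> R) :
  (forall k : 'I_s, y (widen_ord (leqnSn s) k) = x (e k)) ->
  (forall i, i \notin listed_set -> x i = 0) ->
  kkt_point Q listed_set x (- y ord_max) <->
  forall i, \sum_l bordered i l * y l = (i == ord_max)%:R.
Proof.
move=> yx x0.
have row (k : 'I_s) : \sum_l bordered (widen_ord (leqnSn s) k) l * y l =
    \sum_j Q (e k) j * x j + y ord_max.
  rewrite big_ord_recr /= (sum_listed _ x0); congr (_ + _).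
    apply: eq_bigr => l _; rewrite yx mxE /bordered_entry /=.
    by rewrite !ltn_ord.
  by rewrite mxE /bordered_entry /= ltn_ord ltnn mul1r.
have last : \sum_l bordered ord_max l * y l = \sum_i x i.
  have := sum_listed (fun=> 1) x0.
  under eq_bigr do rewrite mul1r.
  move=> ->; rewrite big_ord_recr /= [bordered ord_max ord_max]mxE /bordered_entry /= ltnn.
  rewrite mul0r addr0.
  by apply: eq_bigr => l _; rewrite yx mxE /bordered_entry /= ltnn ltn_ord.
split=> [[_ E S] i|H].
  have [->|ne] := eqVneq i ord_max; first by rewrite last.
  have il : (i < s)%N by rewrite ltn_neqAle -ltnS ltn_ord andbT.
  have -> : i = widen_ord (leqnSn s) (Ordinal il) by apply: val_inj.
  rewrite row E ?subrr ?addNr //.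
  by apply/imsetP; exists (Ordinal il).
split=> //.
  move=> _ /imsetP[k _ ->]; apply/eqP; rewrite -subr_eq0 opprK -row H.
  by rewrite -val_eqE /= ltn_eqF.
by rewrite -last H eqxx.
Qed.

Lemma cramer_solves : \det bordered != 0 ->
  forall i, \sum_l bordered i l * cramer l = (i == ord_max)%:R.
Proof.
move=> d0 i; have /matrixP/(_ i ord_max) := mul_mx_adj bordered.
rewrite !mxE => h.
have E : \sum_l bordered i l * cofactor bordered ord_max l = \det bordered *+ (i == ord_max).
  by rewrite -h; apply: eq_bigr => l _; rewrite [(\adj _) _ _]mxE.
under eq_bigr do rewrite /cramer mulrA.
by rewrite -mulr_suml E; case: eqP => _; rewrite ?mul0r // mulr1n mulfV.
Qed.

Lemma bordered_unique : \det bordered != 0 -> forall y : 'I_s.+1 -> R,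
  (forall i, \sum_l bordered i l * y l = (i == ord_max)%:R) -> y =1 cramer.
Proof.
move=> d0 y H l.
have /matrixP/(_ l 0) : \adj bordered *m (bordered *m \col_j y j) =
    (\det bordered) *: \col_j y j.
  by rewrite mulmxA mul_adj_mx mul_scalar_mx.
rewrite [RHS]mxE [X in _ = _ * X]mxE => h.
apply: (mulfI d0); rewrite -h /cramer mulrCA mulfV // mulr1.
rewrite mxE (bigD1 ord_max) //= big1 ?addr0; last first.
  move=> i ne; rewrite [X in _ * X]mxE.
  under eq_bigr => j _ do rewrite [X in _ * X]mxE.
  by rewrite H (negPf ne) mulr0.
rewrite [X in _ * X]mxE; under eq_bigr => j _ do rewrite [X in _ * X]mxE.
by rewrite H eqxx mulr1 mxE.
Qed.

Lemma cramer_kkt_unique : \det bordered != 0 ->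
  unique_kkt_point Q listed_set (listed_vec cramer) (- cramer ord_max).
Proof.
move=> d0; split.
  apply/bordered_kkt; [by move=> k; rewrite listed_vec_in|exact: listed_vec_out|].
  exact: cramer_solves.
move=> x' lam' kx; have [z _ _] := kx.
pose y (l : 'I_s.+1) : R := if unlift ord_max l is Some k then x' (e k) else - lam'.
have yw (k : 'I_s) : y (widen_ord (leqnSn s) k) = x' (e k).
  rewrite /y (_ : widen_ord _ _ = lift ord_max k) ?liftK //.
  by apply: val_inj; rewrite /= /bump leqNgt ltn_ord.
have yl : y ord_max = - lam' by rewrite /y unlift_none.
have yc : y =1 cramer.
  by apply: bordered_unique => //; apply/(bordered_kkt yw z); rewrite yl opprK.
split; last by rewrite -yc yl opprK.
move=> i; have [/imsetP[k _ ->]|iT] := boolP (i \in listed_set).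
  by rewrite listed_vec_in -yc yw.
by rewrite z // listed_vec_out.
Qed.

(** A kernel vector of the bordered matrix could be added to the solution to give a second one. With
    [cramer_kkt_unique], the test of the determinant against zero decides unique solvability. *)
Lemma unique_kkt_det x lam : unique_kkt_point Q listed_set x lam ->
  \det bordered != 0.
Proof.
(* Transposition turns the left kernel vector supplied by [det0P] into a right one. *)
move=> [kx u]; have [z _ _] := kx; apply/negP; rewrite -det_tr => /det0P[v v0 vM].
pose y0 (l : 'I_s.+1) : R := if unlift ord_max l is Some k then x (e k) else - lam.
have yw (k : 'I_s) : y0 (widen_ord (leqnSn s) k) = x (e k).
  rewrite /y0 (_ : widen_ord _ _ = lift ord_max k) ?liftK //.
  by apply: val_inj; rewrite /= /bump leqNgt ltn_ord.
have yl : y0 ord_max = - lam by rewrite /y0 unlift_none.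
have H0 : forall i, \sum_l bordered i l * y0 l = (i == ord_max)%:R.
  by apply/(bordered_kkt yw z); rewrite yl opprK.
have Mv i : \sum_l bordered i l * v 0 l = 0.
  move/matrixP/(_ 0 i): vM; rewrite !mxE => E; rewrite -[RHS]E.
  by apply: eq_bigr => l _; rewrite [_^T _ _]mxE mulrC.
pose y1 l := y0 l + v 0 l.
have H1 i : \sum_l bordered i l * y1 l = (i == ord_max)%:R.
  transitivity (\sum_l bordered i l * y0 l + \sum_l bordered i l * v 0 l).
    by rewrite -big_split; apply: eq_bigr => l _; rewrite mulrDr.
  by rewrite H0 Mv addr0.
have k1 : kkt_point Q listed_set (listed_vec y1) (- y1 ord_max).
  by apply/bordered_kkt; [move=> k; rewrite listed_vec_in|exact: listed_vec_out|].
have [ex el] := u _ _ k1.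
case/negP: v0; apply/eqP/rowP => l; rewrite mxE.
have [->|ne] := eqVneq l ord_max.
  by move: el; rewrite /y1 yl => el; lra.
have il : (l < s)%N by rewrite ltn_neqAle -ltnS ltn_ord andbT.
have lE : l = widen_ord (leqnSn s) (Ordinal il) by apply: val_inj.
have := ex (e (Ordinal il)); rewrite listed_vec_in /y1 yw -lE => h; lra.
Qed.

End Bordered.

(** * The defect graph on the real RAM *)

(* Working storage.  Natural arrays: row i of 4 lists the component of vertex i,
   5 holds its size, 6 a flag and the best row found so far, 7 the number of
   recorded rows, 10 and 11 are loop counters.  Real array 5 holds a determinant. *)
Notation ci := (counter 10).
Notation cj := (counter 11).
Notation nzero := (NLit 0).
Notation nsucc e := (NAdd e (NLit 1)).

Definition min_cmd : cmd :=
  Seq (SetR 1 nzero nzero (RGet 0 nzero nzero))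
    (For 10 (If (BLtR (RGet 0 ci ci) (RGet 1 nzero nzero))
               (SetR 1 nzero nzero (RGet 0 ci ci)) Skip)).

Definition adjacency_cmd : cmd :=
  For 10 (For 11
    (If (BAnd (BLeN (nsucc ci) cj) (BLtR (RGet 0 ci cj) (RGet 1 nzero nzero)))
       (SetN 1 ci cj (NLit 1))
    (If (BAnd (BLeN (nsucc cj) ci) (BLtR (RGet 0 cj ci) (RGet 1 nzero nzero)))
       (SetN 1 ci cj (NLit 1)) Skip))).

Definition init_labels_cmd : cmd := For 10 (SetN 2 ci nzero ci).

Definition round_cmd : cmd :=
  For 10 (For 11
    (If (BAnd (BLeN (NLit 1) (NGet 1 ci cj))
              (BLeN (nsucc (NGet 2 cj nzero)) (NGet 2 ci nzero)))
       (SetN 2 ci nzero (NGet 2 cj nzero)) Skip)).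

Definition members_cmd : cmd :=
  For 10 (For 11
    (If (BAnd (BLeN (NGet 2 cj nzero) (NGet 2 ci nzero))
              (BLeN (NGet 2 ci nzero) (NGet 2 cj nzero)))
       (Seq (SetN 4 ci (NGet 5 ci nzero) cj)
            (SetN 5 ci nzero (nsucc (NGet 5 ci nzero)))) Skip)).

Section Phases.
Context (R : realType) (n : nat) (Q : 'M[R]_n.+1).
Implicit Types (s : memory R).

Definition holds_matrix s := forall i j : 'I_n.+1, rmem s 0 i j = Q i j.

Lemma holds_matrix_input : holds_matrix (input Q).
Proof. by move=> i j; rewrite /= !ltn_ord !inord_val. Qed.

End Phases.

Lemma min_diag_unique (R : realType) n (Q : 'M[R]_n.+1) m :
  (exists i, m = Q i i) -> (forall i, m <= Q i i) -> m = min_diag Q.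
Proof.
move=> [i mE] le; apply/eqP; rewrite eq_le {2}mE min_diag_le andbT.
by have [j ->] := min_diag_attained Q.
Qed.

Lemma min_cmd_spec (R : realType) : exists K, forall n (Q : 'M[R]_n.+1) s,
  nmem s 0 0 0 = n.+1 -> holds_matrix Q s ->
  runs min_cmd s (K * (n.+1 * n.+1)) (fun s' => rmem s' 1 0 0 = min_diag Q).
Proof.
eexists => n Q s dN hQ.
apply: (@runs_seq_scaled _ _ _ _ _ _ _
  (fun s' => [/\ nmem s' 0 0 0 = n.+1, holds_matrix Q s' & rmem s' 1 0 0 = Q ord0 ord0])).
  apply: runs_run_scaled => //; split => //=; exact: (hQ ord0 ord0).
move=> s1 [d1 h1 m1] _.
pose Inv k (s' : memory R) := [/\ holds_matrix Q s',
  exists i, rmem s' 1 0 0 = Q i i & forall i : 'I_n.+1, (i < k)%N -> rmem s' 1 0 0 <= Q i i].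
apply: runs_weaken.
- apply: (@runs_for_scaled _ _ _ _ n.+1 _ n.+1 Inv) => //.
    by split=> //; exists ord0.
  move=> k s' kN d' c' [hQ' ex le].
  apply: runs_run_scaled => //.
  pose kk := Ordinal kN; have hk : rmem s' 0 k k = Q kk kk := hQ' kk kk.
  have ik (i : 'I_n.+1) : (i < k.+1)%N -> i = kk \/ (i < k)%N.
    by rewrite ltnS leq_eqVlt => /predU1P[e|]; [left; apply: val_inj | right].
  rewrite /= c' hk; case: ifP => [lt|/negbT]; last rewrite -leNgt => ge.
    split=> //; first by exists kk.
    move=> i /ik[->|ik'] /=; rewrite /array_set /= ?c' ?hk //.
    exact: le_trans (ltW lt) (le i ik').
  by split=> // i /ik[->|/le].
- exact: leqnn.
move=> s' [_ ex le]; apply: min_diag_unique => // i; exact: le.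
Qed.

Lemma ltn_ordS m k (kN : (k < m)%N) (i : 'I_m) : (i < k.+1)%N -> i = Ordinal kN \/ (i < k)%N.
Proof. by rewrite ltnS leq_eqVlt => /predU1P[e|]; [left; apply: val_inj | right]. Qed.

Lemma adjacency_cmd_spec (R : realType) : exists K, forall n (Q : 'M[R]_n.+1) s,
  nmem s 0 0 0 = n.+1 -> holds_matrix Q s -> rmem s 1 0 0 = min_diag Q ->
  (forall i j, nmem s 1 i j = 0%N) ->
  runs adjacency_cmd s (K * (n.+1 * n.+1))
    (fun s' => forall i j : 'I_n.+1, nmem s' 1 i j = defect Q i j :> nat).
Proof.
eexists => n Q s dN hQ hm z.
pose base (s' : memory R) := holds_matrix Q s' /\ rmem s' 1 0 0 = min_diag Q.
pose Inv k (s' : memory R) := base s' /\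
  forall i j : 'I_n.+1, nmem s' 1 i j = if (i < k)%N then defect Q i j : nat else 0%N.
apply: runs_weaken.
- apply: (@runs_for_scaled _ _ _ _ n.+1 _ n.+1 Inv) => //.
  move=> k s1 kN d1 c1 [b1 I1].
  pose Inv2 l (s' : memory R) := [/\ base s', nmem s' 10 0 0 = k &
    forall i j : 'I_n.+1, nmem s' 1 i j =
      if (i < k)%N || (i == k :> nat) && (j < l)%N then defect Q i j : nat else 0%N].
  apply: runs_weaken.
  + apply: (@runs_for_scaled _ _ _ _ n.+1 _ 1 Inv2) => //.
      by split=> // i j; rewrite I1 andbF orbF.
    move=> l s2 lN d2 c2 [[hQ2 hm2] ck I2].
    apply: runs_run_scaled => //.
    pose kk := Ordinal kN; pose ll := Ordinal lN.
    have e1 : rmem s2 0 k l = Q kk ll := hQ2 kk ll.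
    have e2 : rmem s2 0 l k = Q ll kk := hQ2 ll kk.
    have fin (s3 : memory R) : base s3 -> nmem s3 10 0 0 = k ->
        (forall i j : 'I_n.+1, nmem s3 1 i j =
           if (i == k :> nat) && (j == l :> nat) then defect Q kk ll : nat else nmem s2 1 i j) ->
        Inv2 l.+1 s3.
      move=> b3 ck3 h3; split=> // i j; rewrite h3 I2.
      have [ik|ik] := eqVneq (i : nat) k; have [jl|jl] := eqVneq (j : nat) l => /=.
      * have -> : i = kk by apply: val_inj.
        have -> : j = ll by apply: val_inj.
        by rewrite /= ltnSn orbT.
      * have -> // : (j < l.+1)%N = (j < l)%N by rewrite ltnS leq_eqVlt (negPf jl).
      * by rewrite !orbF.
      * by rewrite !orbF.
    rewrite /= ck c2 e1 e2 hm2 !addn1.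
    case: ifP => h1.
      apply: fin => // i j; rewrite /= /array_set /= ?ck ?c2.
      by case: (_ && _) => //; rewrite /defect /= h1.
    case: ifP => h2.
      apply: fin => // i j; rewrite /= /array_set /= ?ck ?c2.
      by case: (_ && _) => //; rewrite /defect /= h1 h2.
    apply: fin => // i j; case: ifP => // /andP[/eqP ik /eqP jl].
    rewrite I2 ik jl !ltnn andbF /=.
    by rewrite /defect /= h1 h2.
  + by rewrite mul1n; exact: leqnn.
  move=> s3 [b3 ck I3]; split=> // i j; rewrite I3 (ltn_ord j) andbT.
  by rewrite [(i < k.+1)%N]ltnS [(i <= k)%N]leq_eqVlt orbC.
- exact: leqnn.
by move=> s' [_ I'] i j; rewrite I' ltn_ord.
Qed.

Lemma init_labels_cmd_spec (R : realType) : exists K, forall n (s : memory R),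
  nmem s 0 0 0 = n.+1 ->
  runs init_labels_cmd s (K * (n.+1 * n.+1))
    (fun s' => forall i : 'I_n.+1, nmem s' 2 i 0 = i).
Proof.
eexists => n s dN.
pose Inv k (s' : memory R) := forall i : 'I_n.+1, (i < k)%N -> nmem s' 2 i 0 = i.
apply: runs_weaken.
- apply: (@runs_for_scaled _ _ _ _ n.+1 _ n.+1 Inv) => //.
  move=> k s1 kN d1 c1 I1; apply: runs_run_scaled => // i /(ltn_ordS kN).
  rewrite /= c1 /array_set eqxx andbT /= => -[->|ik]; first by rewrite /= eqxx.
  by rewrite ltn_eqF // I1.
- exact: leqnn.
by move=> s' I' i; apply: I'.
Qed.

Section Labels.
Context (R : realType) (n : nat) (e : rel 'I_n.+1).

Definition label s (i : nat) : nat := nmem (s : memory R) 2 i 0.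

Definition labels_ok s := forall i : 'I_n.+1, exists2 j : 'I_n.+1,
  label s i = j & connect e i j.

Definition label_bound s r (i : 'I_n.+1) := forall p, path e i p -> (size p <= r)%N ->
  (label s i <= last i p)%N.

Lemma init_labels_ok s : (forall i : 'I_n.+1, nmem s 2 i 0 = i) ->
  labels_ok s /\ forall i, label_bound s 0 i.
Proof.
move=> h; split=> i; first by exists i; [exact: h | exact: connect0].
by case=> //= _ _; rewrite /label h.
Qed.

(** A simple path among at most four vertices has at most three edges, so the bound for r = 3 covers
    the whole component. A label is also a vertex of its component, hence its minimum, and equal
    labels identify components. *)
Lemma labels_connect s : labels_ok s -> (forall i, label_bound s 3 i) ->
  connect_sym e -> (forall i, #|[set j | connect e i j]%SET| <= 4)%N ->
  forall i j : 'I_n.+1, (label s i == label s j) = connect e i j.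
Proof.
move=> ok lb sy c4 i j.
have lb' a b : connect e a b -> (label s a <= b)%N.
  move=> /connectP[p pe ->]; have [q qe uq _] := shortenP pe.
  apply: lb => //; rewrite -ltnS; apply: leq_trans (c4 a).
  rewrite -[_.+1]/(size (a :: q)) -(card_uniqP uq); apply: subset_leq_card.
  apply/fintype.subsetP => x xs; rewrite inE.
  by apply: (@path_connect _ e a q).
have [a la ca] := ok i; have [b lj cb] := ok j.
apply/eqP/idP => [E|cij].
  have ab : a = b by apply: val_inj; rewrite /= -la -lj.
  by apply: connect_trans ca _; rewrite sy ab.
apply/eqP; rewrite eqn_leq; apply/andP; split.
  by rewrite lj; apply: lb'; apply: connect_trans cij cb.
by rewrite la; apply: lb'; apply: connect_trans ca; rewrite sy.
Qed.

End Labels.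

(** Labels only decrease and stay inside the component, so updating in place is harmless. A path
    with r + 1 edges from i starts with an edge to some j, whose label is already bounded along the
    rest of the path. *)
Lemma round_cmd_spec (R : realType) : exists K, forall n (e : rel 'I_n.+1) r (s : memory R),
  nmem s 0 0 0 = n.+1 -> (forall i j : 'I_n.+1, nmem s 1 i j = e i j :> nat) ->
  labels_ok e s -> (forall i, label_bound e s r i) ->
  runs round_cmd s (K * (n.+1 * n.+1))
    (fun s' => labels_ok e s' /\ forall i, label_bound e s' r.+1 i).
Proof.
eexists => n e r s dN adj ok0 lb0.
pose base (s' : memory R) := [/\ forall i j : 'I_n.+1, nmem s' 1 i j = e i j :> nat,
  labels_ok e s' & forall i, label_bound e s' r i].
pose Inv k (s' : memory R) := base s' /\
  forall i : 'I_n.+1, (i < k)%N -> label_bound e s' r.+1 i.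
apply: runs_weaken.
- apply: (@runs_for_scaled _ _ _ _ n.+1 _ n.+1 Inv) => //.
  move=> k s1 kN d1 c1 [b1 I1].
  pose kk := Ordinal kN.
  pose Inv2 l (s' : memory R) := [/\ Inv k s', nmem s' 10 0 0 = k &
    forall j : 'I_n.+1, (j < l)%N -> e kk j -> forall p, path e j p -> (size p <= r)%N ->
      (label s' k <= last j p)%N].
  apply: runs_weaken.
  + apply: (@runs_for_scaled _ _ _ _ n.+1 _ 1 Inv2) => //.
    move=> l s2 lN d2 c2 [[[adj2 ok2 lb2] I2] ck J2].
    apply: runs_run_scaled => //.
    pose ll := Ordinal lN.
    have akl : nmem s2 1 k l = e kk ll := adj2 kk ll.
    rewrite /= ck c2 akl addn1 lt0b.
    case: ifP => [/andP[ekl lt]|no].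
      have lab (i : 'I_n.+1) : label (set_nmem s2 2 k 0 (nmem s2 2 l 0)) i =
          if i == kk then label s2 l else label s2 i.
        by rewrite /label /= /array_set eqxx andbT -val_eqE.
      have mono (i : 'I_n.+1) : (label (set_nmem s2 2 k 0 (nmem s2 2 l 0)) i <= label s2 i)%N.
        by rewrite lab; case: eqP => [->|//]; exact: ltnW.
      split=> //; first split; first split => //.
      * move=> i; rewrite lab; case: eqP => [->|_]; last exact: ok2.
        have [j lj cj] := ok2 ll; exists j => //.
        exact: connect_trans (connect1 ekl) cj.
      * by move=> i p pe sp; apply: leq_trans (mono i) _; exact: lb2.
      * by move=> i ik p pe sp; apply: leq_trans (mono i) _; exact: I2.
      * move=> j jl ej p pe sp; rewrite -[k]/(val kk) lab eqxx.
        case: (ltn_ordS lN jl) => [->|jl'] in pe *; first exact: (lb2 ll).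
        by apply: leq_trans (ltnW lt) _; exact: J2.
    split=> // j jl ej p pe sp.
    case: (ltn_ordS lN jl) => [jE|jl']; last exact: J2.
    have jE' : ll = j by rewrite jE.
    move: no; rewrite jE' ej /= => /negbT; rewrite -ltnNge ltnS => le.
    apply: leq_trans (le : (label s2 k <= label s2 l)%N) _.
    by rewrite jE in pe *; exact: (lb2 ll).
  + by rewrite mul1n; exact: leqnn.
  move=> s3 [[b3 I3] ck J3]; split=> // i /(ltn_ordS kN)[->|]; last exact: I3.
  case=> [|j p] /=; first by move=> _ _; have [_ _ lb3] := b3; exact: (lb3 kk [::]).
  by move=> /andP[ej pe] sp; exact: (J3 j).
- exact: leqnn.
by move=> s' [[_ ok' _] I']; split=> // i; apply: I'.
Qed.

Definition row_members (R : realType) (s : memory R) (i : nat) : seq nat :=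
  [seq nmem s 4 i k | k <- iota 0 (nmem s 5 i 0)].

Lemma members_cmd_spec (R : realType) : exists K, forall n (s : memory R),
  nmem s 0 0 0 = n.+1 -> (forall i, nmem s 5 i 0 = 0%N) ->
  runs members_cmd s (K * (n.+1 * n.+1))
    (fun s' => forall i : 'I_n.+1, row_members s' i =
       [seq j <- iota 0 n.+1 | label s j == label s i]).
Proof.
eexists => n s dN z.
pose base (s' : memory R) := forall i j, nmem s' 2 i j = nmem s 2 i j.
pose Inv k (s' : memory R) := [/\ base s',
  forall i, (i < k)%N -> row_members s' i = [seq j <- iota 0 n.+1 | label s j == label s i]
  & forall i, (k <= i)%N -> nmem s' 5 i 0 = 0%N].
apply: runs_weaken.
- apply: (@runs_for_scaled _ _ _ _ n.+1 _ n.+1 Inv) => //.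
  move=> k s1 kN d1 c1 [b1 I1 z1].
  pose Inv2 l (s' : memory R) := [/\ base s', nmem s' 10 0 0 = k,
    forall i, (i < k)%N -> row_members s' i = [seq j <- iota 0 n.+1 | label s j == label s i],
    forall i, (k < i)%N -> nmem s' 5 i 0 = 0%N
    & row_members s' k = [seq j <- iota 0 l | label s j == label s k]].
  apply: runs_weaken.
  + apply: (@runs_for_scaled _ _ _ _ n.+1 _ 1 Inv2) => //.
      split=> // [i ki|]; first by apply: z1; exact: ltnW.
      by rewrite /row_members z1.
    move=> l s2 lN d2 c2 [b2 ck I2 z2 r2].
    apply: runs_run_scaled => //.
    rewrite /= ck c2 !b2 -eqn_leq -/(label s l) -/(label s k).
    have step : [seq j <- iota 0 l.+1 | label s j == label s k] =
        [seq j <- iota 0 l | label s j == label s k] ++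
        if label s l == label s k then [:: l] else [::].
      by rewrite -addn1 iotaD filter_cat /= add0n.
    case: ifP => h; last by split=> //; rewrite step h cats0.
    have rowE i : (i != k) -> row_members (run (Seq (SetN 4 ci (NGet 5 ci nzero) cj)
            (SetN 5 ci nzero (nsucc (NGet 5 ci nzero)))) s2) i = row_members s2 i.
      move=> ik; rewrite /row_members /= /array_set /= ck (negPf ik) /=.
      by apply: eq_map => j; rewrite ?(negPf ik).
    split.
    * by [].
    * by [].
    * move=> i ik; have ik' : i != k by rewrite ltn_eqF.
      by rewrite -I2 // -(rowE _ ik') /= ck c2.
    * move=> i ki; rewrite /= /array_set /= ?ck (gtn_eqF ki) /=; exact: z2.
    rewrite step h -r2 /row_members /= /array_set /= ?ck ?c2 !eqxx /= addn1.
    rewrite -[X in iota 0 X]addn1 iotaD.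
    rewrite map_cat /= add0n !eqxx; congr (_ ++ _).
    by apply/eq_in_map => j; rewrite mem_iota /= => jl; rewrite ?(ltn_eqF jl) ?andbF.
  + by rewrite mul1n; exact: leqnn.
  move=> s3 [b3 ck I3 z3 r3]; split=> // i; rewrite ltnS leq_eqVlt => /predU1P[->//|].
  exact: I3.
- exact: leqnn.
by move=> s' [_ I' _] i; apply: I'.
Qed.

(** * Local supports on the real RAM *)

Definition mem_exp (l : nat) : nexp := NGet 4 ci (NLit l).
Definition row_exp : nexp := NGet 7 nzero nzero.
Definition lit_true : bexp := BLeN nzero nzero.

Definition entry_exp (pos : seq nat) (a b : nat) : rexp :=
  if (a < size pos)%N then
    if (b < size pos)%N then RGet 0 (mem_exp (nth 0%N pos a)) (mem_exp (nth 0%N pos b))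
    else RLit 1
  else if (b < size pos)%N then RLit 1 else RLit 0.

Definition cramer_exp (pos : seq nat) (l : nat) : rexp :=
  RDiv (cofactor_exp (size pos) l (entry_exp pos)) (RGet 5 nzero nzero).

Definition write_entry_cmd (pos : seq nat) (a : nat) : cmd :=
  Seq (SetN 3 row_exp (mem_exp (nth 0%N pos a)) (NLit 1))
      (SetR 2 row_exp (mem_exp (nth 0%N pos a)) (cramer_exp pos a)).

Definition seq_cmd (l : seq cmd) : cmd := foldr Seq Skip l.

Definition nonneg_test (pos : seq nat) : bexp :=
  foldr (fun p t => BAnd (BNot (BLtR (RGet 2 row_exp (mem_exp p)) (RLit 0))) t) lit_true pos.

Definition best_cmd (pos : seq nat) : cmd :=
  If (nonneg_test pos)
    (If (BAnd (BLeN (NLit 1) (NGet 6 nzero nzero))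
              (BNot (BLtR (RGet 3 row_exp nzero) (RGet 3 (NGet 6 (NLit 1) nzero) nzero))))
       Skip
       (Seq (SetN 6 nzero nzero (NLit 1)) (SetN 6 (NLit 1) nzero row_exp)))
    Skip.

(** The row counter advances last, so [row_exp] denotes the fresh row throughout. A zero
    determinant, recognized by two strict comparisons, consumes no row. *)
Definition record_cmd (pos : seq nat) : cmd :=
  Seq (SetR 5 nzero nzero (det_exp (size pos).+1 (entry_exp pos)))
  (If (BAnd (BNot (BLtR (RGet 5 nzero nzero) (RLit 0)))
            (BNot (BLtR (RLit 0) (RGet 5 nzero nzero))))
     Skip
     (Seq (seq_cmd [seq write_entry_cmd pos a | a <- iota 0 (size pos)])
     (Seq (SetR 3 row_exp nzero (RSub (RLit 0) (cramer_exp pos (size pos))))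
     (Seq (best_cmd pos)
          (SetN 7 nzero nzero (nsucc row_exp)))))).

Definition guard_exp (pos : seq nat) : bexp :=
  foldr (fun p t => BAnd (BLeN (NLit p.+1) (NGet 5 ci nzero)) t) lit_true pos.

Definition support_cmd (pos : seq nat) : cmd :=
  If (guard_exp pos) (record_cmd pos) Skip.

(* A support is named by the positions of its elements in the member list of a
   vertex; four positions suffice for components of size at most four. *)
Fixpoint subsequences (l : seq nat) : seq (seq nat) :=
  if l is x :: l' then subsequences l' ++ [seq x :: p | p <- subsequences l'] else [:: [::]].

Definition positions : seq (seq nat) := [seq p <- subsequences (iota 0 4) | p != [::]].

(** A component is treated once for each of its vertices. The 15 position lists make this a constant
    amount of work per vertex, and duplicate rows do no harm. *)
Definition supports_cmd : cmd :=
  For 10 (seq_cmd [seq support_cmd pos | pos <- positions]).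

Lemma subsequencesP (l p : seq nat) : (p \in subsequences l) = subseq p l.
Proof.
elim: l p => [|x l IH] p /=; first by rewrite inE; case: p.
rewrite mem_cat IH; case: p => [|y p] /=; first by rewrite sub0seq.
case: (eqVneq y x) => [->|yx].
  apply/orP/idP => [[h|/mapP[q + [->]]]|h].
  - by apply: subseq_trans h; exact: subseq_cons.
  - by rewrite IH.
  - by right; apply/mapP; exists p; rewrite // IH.
by rewrite orbC; case: mapP => // -[q _ [e]]; rewrite e eqxx in yx.
Qed.

Section Supports.
Context (R : realType) (n : nat) (Q : 'M[R]_n.+1) (L : 'I_n.+1 -> seq 'I_n.+1).
Hypothesis uniqL : forall i, uniq (L i).
Hypothesis memL : forall i j, (j \in L i) = (j \in defect_component Q i).
Implicit Types (s : memory R).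

Definition support_elt (i : 'I_n.+1) (pos : seq nat) (a : nat) : 'I_n.+1 :=
  nth i (L i) (nth 0%N pos a).

Definition support_of i pos : {set 'I_n.+1} :=
  listed_set (size pos) (support_elt i pos).

Definition holds_members s := holds_matrix Q s /\
  forall i : 'I_n.+1, row_members s i = [seq val j | j <- L i].

Definition row_holds s k (T : {set 'I_n.+1}) (x : 'I_n.+1 -> R) lam :=
  [/\ forall i : 'I_n.+1, nmem s 3 k i = (i \in T) :> nat,
      forall i : 'I_n.+1, rmem s 2 k i = x i & rmem s 3 k 0 = lam].

Definition row_nonneg s k := forall i : 'I_n.+1, 0 <= rmem s 2 k i.

(** Rows from the counter on must be zero: only entries on the support are ever written, and the
    zero extension comes from the initial contents. The last clause concerns the best row among the
    nonnegative ones, if there is one. *)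
Definition rows_ok s :=
  [/\ forall k j, (nmem s 7 0 0 <= k)%N -> nmem s 3 k j = 0%N /\ rmem s 2 k j = 0,
      forall k, (k < nmem s 7 0 0)%N -> exists T x lam,
        [/\ is_local_support Q T, unique_kkt_point Q T x lam & row_holds s k T x lam]
    & if nmem s 6 0 0 == 0%N then forall k, (k < nmem s 7 0 0)%N -> ~ row_nonneg s k
      else [/\ (nmem s 6 1 0 < nmem s 7 0 0)%N, row_nonneg s (nmem s 6 1 0) &
        forall k, (k < nmem s 7 0 0)%N -> row_nonneg s k ->
          rmem s 3 (nmem s 6 1 0) 0 <= rmem s 3 k 0]].

(** Vacuous for a support whose bordered matrix is singular, so skipping such supports is
    correct. *)
Definition recorded s T := forall x lam, unique_kkt_point Q T x lam ->
  exists2 k, (k < nmem s 7 0 0)%N & row_holds s k T x lam.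

Definition valid_position i (pos : seq nat) := all (fun p => p < size (L i))%N pos.

Definition extends s s' := forall T, recorded s T -> recorded s' T.

Section OneSupport.
Context (s : memory R) (i : 'I_n.+1) (pos : seq nat).
Hypotheses (upos : uniq pos) (npos : pos != [::]).
Hypotheses (hs : holds_members s) (ck : nmem s 10 0 0 = i).

Let r := nmem s 7 0 0.
Let m := size pos.
Notation elt := (support_elt i pos).

Lemma members_size : nmem s 5 i 0 = size (L i).
Proof. by have := congr1 size (hs.2 i); rewrite !size_map size_iota. Qed.

Lemma members_nth l : (l < size (L i))%N -> nmem s 4 i l = nth i (L i) l.
Proof.
move=> lt; have := congr1 (nth 0%N ^~ l) (hs.2 i) => /=.
rewrite (nth_map i) // /row_members (nth_map 0%N) ?size_iota ?members_size //.
by rewrite nth_iota ?members_size.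
Qed.

Lemma guard_expE s' : nmem s' 10 0 0 = i -> nmem s' 5 i 0 = size (L i) ->
  beval s' (guard_exp pos) = valid_position i pos.
Proof.
move=> c5 e5; rewrite /guard_exp /valid_position; clear upos npos m.
by elim: pos => [|p l IH] //=; rewrite IH c5 e5.
Qed.

Section Valid.
Hypothesis vpos : valid_position i pos.

Let pos_lt a : (a < m)%N -> (nth 0%N pos a < size (L i))%N.
Proof. by move=> am; move/allP: vpos; apply; rewrite mem_nth. Qed.

Lemma support_elt_inj k l : (k < m)%N -> (l < m)%N -> elt k = elt l -> k = l.
Proof.
move=> km lm /eqP; rewrite /support_elt nth_uniq ?pos_lt // nth_uniq // => /eqP.
by [].
Qed.

Lemma support_of_local : is_local_support Q (support_of i pos).
Proof.
split.
  have m0 : (0 < m)%N by rewrite /m; case: pos npos.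
  by apply/card_gt0P; exists (elt 0); apply/imsetP; exists (Ordinal m0).
exists i; apply/fintype.subsetP => _ /imsetP[k _ ->].
by rewrite -memL /support_elt mem_nth // pos_lt.
Qed.

Definition agrees s' :=
  [/\ forall a b, rmem s' 0 a b = rmem s 0 a b,
      forall a b, nmem s' 4 a b = nmem s 4 a b,
      nmem s' 10 0 0 = i, nmem s' 7 0 0 = r &
      forall a b, nmem s' 5 a b = nmem s 5 a b].

Lemma mem_expE s' a : agrees s' -> (a < m)%N -> neval s' (mem_exp (nth 0%N pos a)) = elt a.
Proof. by move=> [_ e4 e10 _ _] am; rewrite /= e10 e4 members_nth // pos_lt. Qed.

Lemma entry_expE s' a b : agrees s' ->
  reval s' (entry_exp pos a b) = bordered_entry Q m elt a b.
Proof.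
move=> ag; rewrite /entry_exp /bordered_entry -/m.
case: (ltnP a m) => am; case: (ltnP b m) => bm //.
have [e0 _ _ _ _] := ag.
have -> : reval s' (RGet 0 (mem_exp (nth 0%N pos a)) (mem_exp (nth 0%N pos b))) =
  rmem s' 0 (neval s' (mem_exp (nth 0%N pos a))) (neval s' (mem_exp (nth 0%N pos b))) by [].
by rewrite !mem_expE // e0; apply: hs.1.
Qed.

Lemma det_expE s' : agrees s' ->
  reval s' (det_exp m.+1 (entry_exp pos)) = \det (bordered Q m elt).
Proof.
move=> ag; rewrite reval_det_exp; congr (\det _).
by apply/matrixP => a b; rewrite !mxE entry_expE.
Qed.

Lemma cramer_expE s' (l : 'I_m.+1) : agrees s' ->
  rmem s' 5 0 0 = \det (bordered Q m elt) ->
  reval s' (cramer_exp pos l) = cramer Q elt l.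
Proof.
move=> ag e5; rewrite /cramer -e5.
have -> : reval s' (cramer_exp pos l) =
  reval s' (cofactor_exp m l (entry_exp pos)) / rmem s' 5 0 0 by [].
rewrite reval_cofactor_exp; congr (cofactor _ _ _ / _).
by apply/matrixP => a b; rewrite !mxE entry_expE.
Qed.

Let yv : 'I_n.+1 -> R := listed_vec elt (cramer Q (s := m) elt).

Definition written a (j : nat) := has (fun b => val (elt b) == j) (iota 0 a).

Definition partial_row a s' := [/\ agrees s',
  rmem s' 5 0 0 = \det (bordered Q m elt),
  (forall b, nmem s' 6 b 0 = nmem s 6 b 0) /\ (forall k, rmem s' 3 k 0 = rmem s 3 k 0),
  forall k j, nmem s' 3 k j = if (k == r) && written a j then 1%N else nmem s 3 k j
  & forall k j, rmem s' 2 k j = if (k == r) && written a j then yv (inord j) else rmem s 2 k j].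

Lemma write_entry_step a s' : (a < m)%N -> partial_row a s' ->
  partial_row a.+1 (run (write_entry_cmd pos a) s').
Proof.
move=> am [ag e5 [e6 e3] en er].
have [e0 e4 e10 e7 e5'] := ag.
have wS j : written a.+1 j = written a j || (val (elt a) == j).
  by rewrite /written -[a.+1]addn1 iotaD has_cat /= add0n orbF.
set s1 := set_nmem s' 3 r (elt a) 1.
have -> : run (write_entry_cmd pos a) s' =
    set_rmem s1 2 r (elt a) (reval s1 (cramer_exp pos a)).
  rewrite [LHS]/= -/(mem_exp _) e7.
  have := mem_expE ag am; rewrite /= => ->.
  by rewrite /= /array_set /= e10 e4 (members_nth (pos_lt am)) e7.
have ag1 : agrees s1 by split.
have v : reval s1 (cramer_exp pos a) = yv (elt a).
  have -> : yv (elt a) = cramer Q elt (widen_ord (leqnSn m) (Ordinal am)).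
    exact: (listed_vec_in support_elt_inj _ (Ordinal am)).
  by rewrite -(cramer_expE _ ag1 e5).
rewrite v; split=> //.
- move=> k j; rewrite /= /array_set /= en wS.
  have [->|] := eqVneq k r; rewrite ?andbF //= eq_sym.
  by case: (_ == j); rewrite ?orbT ?orbF.
- move=> k j; rewrite /= /array_set /= er wS.
  have [->|] := eqVneq k r; rewrite ?andbF //= eq_sym.
  by have [<-|] := eqVneq (val (elt a)) j; rewrite ?orbT ?orbF // inord_val.
Qed.

Lemma write_entries a b s' : (a + b)%N = m -> partial_row a s' ->
  partial_row m (run (seq_cmd [seq write_entry_cmd pos c | c <- iota a b]) s').
Proof.
elim: b a s' => [|b IH] a s' e; first by rewrite -e addn0.
move=> pr; rewrite [iota _ _]/= [map _ _]/= [seq_cmd _]/= -/(seq_cmd _).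
rewrite run_Seq.
apply: IH; first by rewrite -e addnS.
by apply: write_entry_step pr; rewrite -e addnS ltnS leq_addr.
Qed.

Lemma written_listed (v : 'I_n.+1) : written m v = (v \in support_of i pos).
Proof.
apply/hasP/imsetP => [[b]|[k _ ->]].
  by rewrite mem_iota add0n => /andP[_ bm] /eqP/val_inj <-; exists (Ordinal bm).
by exists (val k) => //; rewrite mem_iota add0n ltn_ord.
Qed.

Lemma yv_out (v : 'I_n.+1) : v \notin support_of i pos -> yv v = 0.
Proof. exact: listed_vec_out. Qed.

Let lam : R := - cramer Q (s := m) elt ord_max.

Lemma unique_kkt_cramer : \det (bordered Q m elt) != 0 ->
  unique_kkt_point Q (support_of i pos) yv lam.
Proof. exact: cramer_kkt_unique support_elt_inj. Qed.

Hypothesis rok : rows_ok s.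

Definition after_record s' := [/\ agrees (set_nmem s' 7 0 0 r), nmem s' 7 0 0 = r.+1,
   (forall k j, nmem s' 3 k j = if (k == r) && written m j then 1%N else nmem s 3 k j),
   (forall k j, rmem s' 2 k j = if (k == r) && written m j then yv (inord j) else rmem s 2 k j)
   & (forall k, rmem s' 3 k 0 = if k == r then lam else rmem s 3 k 0)].

Lemma after_record_row s' : after_record s' -> row_holds s' r (support_of i pos) yv lam.
Proof.
move=> [_ _ en er e3]; have [zr _ _] := rok; split=> [v|v|].
- by rewrite en eqxx /= written_listed; case: ifP => // _; have [] := zr r v (leqnn r).
- rewrite er eqxx /= written_listed inord_val; case: ifPn => // vT.
  by rewrite yv_out //; have [] := zr r v (leqnn r).
by rewrite e3 eqxx.
Qed.

Lemma after_record_old s' k T x l : after_record s' -> (k < r)%N ->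
  row_holds s k T x l -> row_holds s' k T x l.
Proof.
move=> [_ _ en er e3] kr [h1 h2 h3]; have kn : (k == r) = false by rewrite ltn_eqF.
by split=> [v|v|]; rewrite ?en ?er ?e3 kn /= ?h1 ?h2 ?h3.
Qed.

(** Shared by the three outcomes of [best_cmd]: the new row has a negative entry, loses the
    comparison, or becomes the best row. Only the clause on the best row differs among them. *)
Lemma after_record_conclusion s' : after_record s' -> \det (bordered Q m elt) != 0 ->
  (if nmem s' 6 0 0 == 0%N then forall k, (k < r.+1)%N -> ~ row_nonneg s' k
   else [/\ (nmem s' 6 1 0 < r.+1)%N, row_nonneg s' (nmem s' 6 1 0) &
        forall k, (k < r.+1)%N -> row_nonneg s' k ->
          rmem s' 3 (nmem s' 6 1 0) 0 <= rmem s' 3 k 0]) ->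
  [/\ holds_members s', nmem s' 10 0 0 = i, rows_ok s', extends s s' &
      recorded s' (support_of i pos)].
Proof.
move=> ar d0 best; have [[e0 e4 e10 e7 e5] s7 en er e3] := ar.
have [za zb _] := rok.
have row := after_record_row ar.
split.
- split=> [a b|a]; first by rewrite -[RHS](hs.1 a b); exact: e0.
  rewrite -(hs.2 a) /row_members -[nmem s' 5 a 0]/(nmem (set_nmem s' 7 0 0 r) 5 a 0) e5.
  by apply: eq_map => l; exact: e4.
- exact: e10.
- split; rewrite ?s7 //.
    move=> k j rk; have kn : (k == r) = false by rewrite gtn_eqF.
    by rewrite en er kn; apply: za; exact: ltnW.
  move=> k; rewrite ltnS leq_eqVlt => /predU1P[->|kr].
    exists (support_of i pos), yv, lam; split=> //; first exact: support_of_local.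
    exact: unique_kkt_cramer.
  have [T [x [l [h1 h2 h3]]]] := zb k kr; exists T, x, l; split=> //.
  exact: after_record_old.
- move=> T rT x l /rT[k kr h]; exists k; first by rewrite s7 ltnS ltnW.
  exact: after_record_old.
move=> x l u; exists r; first by rewrite s7.
have [_ uu] := u; have [kc _] := unique_kkt_cramer d0.
have [ex <-] := u.2 _ _ kc; have [h1 h2 h3] := row.
by split=> // v; rewrite h2 ex.
Qed.

Lemma nonneg_testE s' : agrees s' -> row_holds s' r (support_of i pos) yv lam ->
  beval s' (nonneg_test pos) <-> row_nonneg s' r.
Proof.
move=> ag [_ h _]; have [_ e4 e10 e7 _] := ag.
have -> : beval s' (nonneg_test pos) =
    all (fun p => 0 <= rmem s' 2 r (neval s' (mem_exp p))) pos.
  rewrite /nonneg_test; clear -e7; elim: pos => [|p l IH] //=.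
  by rewrite -IH -leNgt e7.
split=> [/allP H v|H]; last first.
  apply/allP => p /(nthP 0%N)[a am <-]; rewrite mem_expE //; exact: H.
have [|vT] := boolP (v \in support_of i pos); last by rewrite h yv_out.
move=> /imsetP[k _ ->]; have := H (nth 0%N pos k) (mem_nth _ (ltn_ord k)).
by rewrite mem_expE.
Qed.

Lemma record_cmd_step :
  [/\ holds_members (run (record_cmd pos) s), nmem (run (record_cmd pos) s) 10 0 0 = i,
      rows_ok (run (record_cmd pos) s), extends s (run (record_cmd pos) s) &
      recorded (run (record_cmd pos) s) (support_of i pos)].
Proof.
have ags : agrees s by split.
set D := \det (bordered Q m elt).
pose s1 := set_rmem s 5 0 0 D.
have E1 : run (SetR 5 nzero nzero (det_exp (size pos).+1 (entry_exp pos))) s = s1.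
  by rewrite /s1 /D -(det_expE ags).
pose tail := Seq (seq_cmd [seq write_entry_cmd pos a | a <- iota 0 (size pos)])
     (Seq (SetR 3 row_exp nzero (RSub (RLit 0) (cramer_exp pos (size pos))))
     (Seq (best_cmd pos) (SetN 7 nzero nzero (nsucc row_exp)))).
have E : run (record_cmd pos) s = if ~~ (D < 0) && ~~ (0 < D) then s1 else run tail s1.
  by rewrite /record_cmd run_Seq E1 run_If.
rewrite E; case: ifP => [/andP[]|nz].
  rewrite -!leNgt => D0 D1; have DE : D = 0 by apply/eqP; rewrite eq_le D0 D1.
  split; [exact: hs | exact: ck | exact: rok | by [] | ].
  by move=> x l /(unique_kkt_det support_elt_inj); rewrite -/D DE eqxx.
have D0 : D != 0.
  by apply: contraFneq nz => ->; rewrite ltxx.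
have pr0 : partial_row 0 s1.
  by split; [split | | split | |] => // k j; rewrite /written /= andbF.
pose s2 := run (seq_cmd [seq write_entry_cmd pos a | a <- iota 0 (size pos)]) s1.
have pr : partial_row m s2 by apply: write_entries pr0.
have [ag2 e5 [e6 e3] en er] := pr.
have [_ _ _ e7 _] := ag2.
pose s3 := set_rmem s2 3 r 0 lam.
have E3 : run (SetR 3 row_exp nzero (RSub (RLit 0) (cramer_exp pos (size pos)))) s2 = s3.
  have v : reval s2 (RSub (RLit 0) (cramer_exp pos (size pos))) = lam.
    by rewrite -[LHS]/(0%:R - reval s2 (cramer_exp pos (val (@ord_max m)))) cramer_expE // sub0r.
  rewrite -[LHS]/(set_rmem s2 3 (nmem s2 7 0 0) 0
    (reval s2 (RSub (RLit 0) (cramer_exp pos (size pos))))).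
  by rewrite v e7.
have -> : run tail s1 = set_nmem (run (best_cmd pos) s3) 7 0 0
     (nmem (run (best_cmd pos) s3) 7 0 0 + 1).
  by rewrite -E3.
have ag3 : agrees s3 by split; case: ag2.
have row3 : row_holds s3 r (support_of i pos) yv lam.
  have [zr _ _] := rok; split=> [v|v|].
  - rewrite /= en eqxx /= written_listed; case: ifP => // _; by have [] := zr r v (leqnn r).
  - rewrite /= /array_set /= er eqxx /= written_listed inord_val; case: ifPn => // vT.
    by rewrite yv_out //; have [] := zr r v (leqnn r).
  by rewrite /= /array_set /= eqxx.
have tE := nonneg_testE ag3 row3.
have ar (s4 : memory R) : rmem s4 = rmem s3 ->
    (forall a b c, a != 6%N -> nmem s4 a b c = nmem s3 a b c) ->
    after_record (set_nmem s4 7 0 0 (nmem s4 7 0 0 + 1)).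
  move=> r4 n4; have [e0 e4 e10 _ e5'] := ag2.
  have n7 : nmem s4 7 0 0 = r by rewrite n4.
  split.
  - split=> [a b|a b|||a b] /=.
    + by rewrite r4; exact: e0.
    + by rewrite /array_set /= n4 //; exact: e4.
    + by rewrite /array_set /= n4 //; exact: e10.
    + by [].
    + by rewrite /array_set /= n4 //; exact: e5'.
  - by rewrite /= /array_set /= n7 addn1.
  - by move=> k j; rewrite /= /array_set /= n4 //= en.
  - by move=> k j; rewrite /= r4 /= /array_set /= er.
  - by move=> k; rewrite /= r4 /= /array_set /= e3 andbT.
have old (s4 : memory R) k : rmem s4 = rmem s3 -> (k < r)%N ->
    (row_nonneg s4 k <-> row_nonneg s k) /\ rmem s4 3 k 0 = rmem s 3 k 0.
  move=> r4 kr; have kn : (k == r) = false by rewrite ltn_eqF.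
  split; last by rewrite r4 /= /array_set /= kn e3.
  by split=> h v; have := h v; rewrite r4 /= /array_set /= er kn.
have [za zb zc] := rok.
have lam3 : rmem s3 3 r 0 = lam by case: row3.
have n63 b : nmem s3 6 b 0 = nmem s 6 b 0 by exact: e6.
rewrite /best_cmd run_If.
case: ifP => [/tE nn|/negP nnt]; last first.
  have nn : ~ row_nonneg s3 r by move/tE.
  apply: after_record_conclusion => //; first exact: ar.
  have n7 : nmem s3 7 0 0 = r by case: ag3.
  rewrite -[nmem _ 6 0 0]/(nmem s3 6 0 0) -[nmem _ 6 1 0]/(nmem s3 6 1 0) !n63.
  case: ifP zc => [_ zc k|_ [b1 b2 b3]].
    rewrite ltnS leq_eqVlt => /predU1P[->|kr]; first exact: nn.
    have [q1 _] := old s3 k (erefl _) kr.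
    by move/q1; exact: zc.
  split; first exact: ltnW.
    by have [q1 _] := old s3 _ erefl b1; apply/q1.
  move=> k; rewrite ltnS leq_eqVlt => /predU1P[-> //|kr] h.
  have [q1 q2] := old s3 k erefl kr; have [_ q3] := old s3 _ erefl b1.
  rewrite -[rmem _ 3 _ 0]/(rmem s3 3 (nmem s 6 1 0) 0) -[leRHS]/(rmem s3 3 k 0) q2 q3.
  by apply: b3 => //; apply/q1.
rewrite -[run (If _ _ _) _]/(if (1 <= nmem s3 6 0 0)%N &&
   ~~ (rmem s3 3 (nmem s3 7 0 0) 0 < rmem s3 3 (nmem s3 6 1 0) 0) then s3 else
   set_nmem (set_nmem s3 6 0 0 1) 6 1 0 (nmem s3 7 0 0)).
have n7 : nmem s3 7 0 0 = r by case: ag3.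
rewrite n7 lam3 !n63; case: ifP => [/andP[f1]|].
  rewrite -leNgt => le; apply: after_record_conclusion => //; first exact: ar.
  rewrite -[nmem _ 6 0 0]/(nmem s3 6 0 0) -[nmem _ 6 1 0]/(nmem s3 6 1 0) !n63.
  move: zc; rewrite eqn0Ngt f1 /= => -[b1 b2 b3].
  have [q1 q3] := old s3 _ erefl b1.
  split; [exact: ltnW | exact/q1 |].
  move=> k; rewrite ltnS leq_eqVlt => /predU1P[-> _|kr h].
    suff : rmem s3 3 (nmem s 6 1 0) 0 <= rmem s3 3 r 0 by [].
    by rewrite lam3.
  suff : rmem s3 3 (nmem s 6 1 0) 0 <= rmem s3 3 k 0 by [].
  have [q1' q2] := old s3 k erefl kr; rewrite q2 q3.
  by apply: b3 => //; apply/q1'.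
move=> nb; apply: after_record_conclusion => //.
  by apply: ar => // a b c /negPf a6; rewrite /= /array_set /= a6.
rewrite -[nmem _ 6 0 0]/(1%N) -[nmem _ 6 1 0]/r /=.
split=> // k; rewrite ltnS leq_eqVlt => /predU1P[-> //|kr] h.
have [q1 q2] := old s3 k erefl kr; rewrite -[leRHS]/(rmem s3 3 k 0) q2.
rewrite -[leLHS]/(rmem s3 3 r 0) lam3.
move: zc nb; case: eqVneq => [f0 zc _|f0 [b1 b2 b3]].
  by case: (zc k kr); apply/q1.
rewrite lt0n f0 andTb => /negbT; rewrite negbK => /ltW le.
have [_ q3] := old s3 _ erefl b1; rewrite q3 in le.
by apply: le_trans le _; apply: b3 => //; apply/q1.
Qed.

End Valid.

Lemma support_cmd_step : rows_ok s ->
  [/\ holds_members (run (support_cmd pos) s), nmem (run (support_cmd pos) s) 10 0 0 = i,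
      rows_ok (run (support_cmd pos) s), extends s (run (support_cmd pos) s) &
      valid_position i pos -> recorded (run (support_cmd pos) s) (support_of i pos)].
Proof.
move=> rok.
rewrite /support_cmd run_If.
rewrite guard_expE //; last exact: members_size.
case: ifP => [vp|_]; last by split.
by have [h1 h2 h3 h4 h5] := record_cmd_step vp rok.
Qed.

End OneSupport.
End Supports.

Lemma loop_free_seq_cmd l : all loop_free l -> loop_free (seq_cmd l).
Proof. by elim: l => //= c l IH /andP[-> /IH]. Qed.

Lemma nat_writes_seq_cmd a l : all (fun c => a \notin nat_writes c) l ->
  a \notin nat_writes (seq_cmd l).
Proof. by elim: l => //= c l IH /andP[h /IH]; rewrite mem_cat negb_or h. Qed.

Lemma nat_writes_For a x c : a != x -> a \notin nat_writes c -> a \notin nat_writes (For x c).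
Proof. by move=> ax ac; rewrite /= !(inE, mem_cat) !negb_or ax ac. Qed.

Lemma real_writes_For a x c : a \notin real_writes c -> a \notin real_writes (For x c).
Proof. by rewrite /= cats0. Qed.

Lemma loop_free_support_cmd pos : loop_free (support_cmd pos).
Proof.
have h : loop_free (seq_cmd [seq write_entry_cmd pos a | a <- iota 0 (size pos)]).
  by apply: loop_free_seq_cmd; rewrite all_map; apply/allP.
by rewrite /support_cmd /record_cmd; move: (seq_cmd _) h => c /= ->.
Qed.

Lemma nat_writes_support_cmd a pos : a \notin [:: 3; 6; 7]%N ->
  a \notin nat_writes (support_cmd pos).
Proof.
rewrite !inE !negb_or => /and3P[a3 a6 a7].
have h : a \notin nat_writes (seq_cmd [seq write_entry_cmd pos b | b <- iota 0 (size pos)]).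
  by apply: nat_writes_seq_cmd; rewrite all_map; apply/allP => b _ /=; rewrite inE.
rewrite /support_cmd /record_cmd; move: (seq_cmd _) h => c /= h.
by rewrite cats0 mem_cat negb_or h !inE !negb_or a6 a7.
Qed.

Definition row_cmd : cmd := seq_cmd [seq support_cmd pos | pos <- positions].

Lemma loop_free_row_cmd : loop_free row_cmd.
Proof.
apply: loop_free_seq_cmd; rewrite all_map; apply/allP => p _.
exact: loop_free_support_cmd.
Qed.

Lemma nat_writes_row_cmd a : a \notin [:: 3; 6; 7]%N -> a \notin nat_writes row_cmd.
Proof.
move=> h; apply: nat_writes_seq_cmd; rewrite all_map; apply/allP => p _.
exact: nat_writes_support_cmd.
Qed.

Lemma nat_writes_supports_cmd a : a \notin [:: 3; 6; 7; 10]%N ->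
  a \notin nat_writes supports_cmd.
Proof.
move=> ha; apply: (@nat_writes_For a 10%N row_cmd).
  by apply: contra ha => /eqP->.
apply: nat_writes_row_cmd; apply: contra ha.
by rewrite !inE => /or3P[]->; rewrite ?orbT.
Qed.

Lemma real_writes_seq_cmd a l : all (fun c => a \notin real_writes c) l ->
  a \notin real_writes (seq_cmd l).
Proof. by elim: l => //= c l IH /andP[h /IH]; rewrite mem_cat negb_or h. Qed.

Lemma real_writes_support_cmd a pos : a \notin [:: 2; 3; 5]%N ->
  a \notin real_writes (support_cmd pos).
Proof.
rewrite !inE !negb_or => /and3P[a2 a3 a5].
have h : a \notin real_writes (seq_cmd [seq write_entry_cmd pos b | b <- iota 0 (size pos)]).
  by apply: real_writes_seq_cmd; rewrite all_map; apply/allP => b _ /=; rewrite inE.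
rewrite /support_cmd /record_cmd; move: (seq_cmd _) h => c /= h.
by rewrite !(inE, mem_cat) !negb_or ?h ?a2 ?a3 ?a5.
Qed.

Lemma real_writes_supports_cmd a : a \notin [:: 2; 3; 5]%N ->
  a \notin real_writes supports_cmd.
Proof.
move=> ha; have : a \notin real_writes row_cmd.
  apply: real_writes_seq_cmd; rewrite all_map; apply/allP => p _.
  exact: real_writes_support_cmd.
by move=> h; exact: (@real_writes_For a 10%N row_cmd h).
Qed.

Lemma positions_ok pos : pos \in positions -> uniq pos /\ pos != [::].
Proof.
rewrite mem_filter subsequencesP => /andP[p0 sp]; split=> //.
by apply: subseq_uniq sp _; exact: iota_uniq.
Qed.

Section SupportLoop.
Context (R : realType) (n : nat) (Q : 'M[R]_n.+1) (L : 'I_n.+1 -> seq 'I_n.+1).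
Hypothesis uniqL : forall i, uniq (L i).
Hypothesis memL : forall i j, (j \in L i) = (j \in defect_component Q i).

Lemma seq_support_step (ps : seq (seq nat)) (s : memory R) (i : 'I_n.+1) :
  (forall p, p \in ps -> uniq p /\ p != [::]) ->
  holds_members Q L s -> nmem s 10 0 0 = i -> rows_ok Q s ->
  let s' := run (seq_cmd [seq support_cmd pos | pos <- ps]) s in
  [/\ holds_members Q L s', rows_ok Q s', extends Q s s' &
      forall p, p \in ps -> valid_position L i p -> recorded Q s' (support_of L i p)].
Proof.
elim: ps s => [|p ps IH] s ok hs ck rok /=; first by split.
have [up np] := ok p (mem_head _ _).
have [h1 h2 h3 h4 h5] := support_cmd_step uniqL memL up np hs ck rok.
have ok' q : q \in ps -> uniq q /\ q != [::] by move=> qp; apply: ok; rewrite inE qp orbT.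
have [g1 g2 g3 g4] := IH _ ok' h1 h2 h3.
split=> //.
  by move=> T /h4 /g3.
move=> q; rewrite inE => /predU1P[-> v|]; last exact: g4.
by apply: g3; exact: h5.
Qed.

End SupportLoop.

Lemma supports_cmd_spec (R : realType) : exists K, forall n (Q : 'M[R]_n.+1) L s,
  (forall i, uniq (L i)) ->
  (forall i j, (j \in L i) = (j \in defect_component Q i)) ->
  nmem s 0 0 0 = n.+1 -> holds_members Q L s -> rows_ok Q s ->
  runs supports_cmd s (K * (n.+1 * n.+1)) (fun s' => rows_ok Q s' /\
    forall i p, p \in positions -> valid_position L i p ->
      recorded Q s' (support_of L i p)).
Proof.
eexists => n Q L s uL mL dN hs rok.
pose Inv k (s' : memory R) := [/\ holds_members Q L s', rows_ok Q s' &
  forall (i : 'I_n.+1) p, (i < k)%N -> p \in positions -> valid_position L i p ->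
      recorded Q s' (support_of L i p)].
apply: runs_weaken.
- apply: (@runs_for_scaled _ 10 row_cmd s n.+1 _ n.+1 Inv) => //;
    try exact: nat_writes_row_cmd.
  move=> k s1 kN d1 c1 [h1 r1 g1].
  apply: (@runs_run_scaled _ row_cmd s1 n.+1 (Inv k.+1) (ltn0Sn n) loop_free_row_cmd).
  have [h2 r2 e2 g2] := @seq_support_step _ _ _ _ uL mL positions s1 (Ordinal kN)
     (fun p => @positions_ok p) h1 c1 r1.
  split=> // i p /(ltn_ordS kN)[->|ik] pp vp; first exact: g2.
  by apply: e2; exact: g1.
- exact: leqnn.
by move=> s' [_ r' g']; split=> // i p; apply: g'.
Qed.

(** * Output of the optimizer and the complete recovery program *)

Definition output_cmd : cmd :=
  For 10 (For 11 (SetR 4 ci cj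
    (RMul (RGet 2 (NGet 6 (NLit 1) nzero) ci) (RGet 2 (NGet 6 (NLit 1) nzero) cj)))).

Lemma output_cmd_spec (R : realType) : exists K, forall n (s : memory R),
  nmem s 0 0 0 = n.+1 ->
  runs output_cmd s (K * (n.+1 * n.+1)) (fun s' => forall i j : 'I_n.+1,
    rmem s' 4 i j = rmem s 2 (nmem s 6 1 0) i * rmem s 2 (nmem s 6 1 0) j).
Proof.
eexists => n s dN; set b := nmem s 6 1 0.
pose val2 i j := rmem s 2 b i * rmem s 2 b j.
pose base (s' : memory R) := nmem s' 6 1 0 = b /\ forall i, rmem s' 2 b i = rmem s 2 b i.
pose Inv k (s' : memory R) := base s' /\
  forall i j, (i < k)%N -> (j < n.+1)%N -> rmem s' 4 i j = val2 i j.
apply: runs_weaken.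
- apply: (@runs_for_scaled _ _ _ _ n.+1 _ n.+1 Inv) => //.
  move=> k s1 kN d1 c1 [b1 I1].
  pose Inv2 l (s' : memory R) := [/\ Inv k s', nmem s' 10 0 0 = k &
    forall j, (j < l)%N -> rmem s' 4 k j = val2 k j].
  apply: runs_weaken.
  + apply: (@runs_for_scaled _ _ _ _ n.+1 _ 1 Inv2) => //.
    move=> l s2 lN d2 c2 [[[b2 e2] I2] ck J2].
    apply: runs_run_scaled => //; rewrite /= ck c2 b2 !e2.
    split=> //; first split=> //.
      move=> i j ik jn; rewrite /= /array_set /= (ltn_eqF ik) /=; exact: I2.
    move=> j; rewrite ltnS leq_eqVlt => /predU1P[->|jl].
      by rewrite /= /array_set !eqxx.
    by rewrite /= /array_set (ltn_eqF jl) !andbF; exact: J2.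
  + by rewrite mul1n; exact: leqnn.
  move=> s3 [[b3 I3] ck J3]; split=> // i j; rewrite ltnS leq_eqVlt => /predU1P[->|].
    exact: J3.
  exact: I3.
- exact: leqnn.
by move=> s' [_ I'] i j; apply: I'.
Qed.

(* Two vertices of a component of size at most four are at distance at most
   three, hence three propagation rounds. *)
Definition recovery_cmd : cmd :=
  Seq min_cmd (Seq adjacency_cmd (Seq init_labels_cmd
    (Seq round_cmd (Seq round_cmd (Seq round_cmd
      (Seq members_cmd (Seq supports_cmd output_cmd))))))).

Section Recovery.
Context (R : realType) (n : nat) (Q : 'M[R]_n.+1).
Hypotheses (sQ : symf Q) (uQ : dnn_unique_rank_one Q) (cQ : defect_components_le Q 4).

Definition component_list (i : 'I_n.+1) : seq 'I_n.+1 :=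
  [seq j <- enum 'I_n.+1 | j \in defect_component Q i].

Lemma component_list_uniq i : uniq (component_list i).
Proof. by apply: filter_uniq; exact: enum_uniq. Qed.

Lemma mem_component_list i j : (j \in component_list i) = (j \in defect_component Q i).
Proof. by rewrite mem_filter mem_enum andbT. Qed.

Lemma size_component_list i : (size (component_list i) <= 4)%N.
Proof.
apply: leq_trans (cQ i); rewrite -(card_uniqP (component_list_uniq i)).
by apply: subset_leq_card; apply/fintype.subsetP => j; rewrite mem_component_list.
Qed.

(** The component size enters here: every element of T occupies one of the first four places in the
    member list of i, so T is read off as a list of positions below four. *)
Lemma local_support_position (T : {set 'I_n.+1}) : is_local_support Q T ->
  exists i p, [/\ p \in positions, valid_position component_list i p &
     T = support_of component_list i p].
Proof.
move=> [T0 [i /fintype.subsetP Ti]]; exists i.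
pose a l := (l < size (component_list i))%N && (nth i (component_list i) l \in T).
exists [seq l <- iota 0 4 | a l].
have TE : T = support_of component_list i [seq l <- iota 0 4 | a l].
  set p := [seq l <- _ | a l].
  apply/setP => v; apply/idP/imsetP => [vT|[k _ ->]]; last first.
    have : nth 0%N p k \in p by apply: mem_nth.
    by rewrite {2}/p mem_filter => /andP[/andP[]].
  have vL : v \in component_list i by rewrite mem_component_list Ti.
  have il : (index v (component_list i) < size (component_list i))%N by rewrite index_mem.
  have ip : index v (component_list i) \in p.
    rewrite mem_filter mem_iota /a il nth_index // vT /= ?add0n.
    exact: leq_trans il (size_component_list i).
  have jp : (index (index v (component_list i)) p < size p)%N by rewrite index_mem.
  by exists (Ordinal jp) => //; rewrite /support_elt /= nth_index // nth_index.
split=> //; last first.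
  by apply/allP => l; rewrite mem_filter => /andP[/andP[]].
rewrite mem_filter subsequencesP filter_subseq andbT; apply/eqP => e.
have /card_gt0P[v] := T0; rewrite TE e => /imsetP[[k]] /=.
by [].
Qed.

Lemma row_holds_recorded (s : memory R) k (T : {set 'I_n.+1}) (x : 'cV[R]_#|T|) lam :
  row_holds s k T (fun i => zero_extend x i 0) lam -> recorded_solution s x lam.
Proof. by move=> [h1 h2 h3]; exists k. Qed.

Lemma eq_unique_kkt_point (T : {set 'I_n.+1}) (x y : 'I_n.+1 -> R) lam :
  x =1 y -> unique_kkt_point Q T x lam -> unique_kkt_point Q T y lam.
Proof.
move=> e [k u]; split; first exact: eq_kkt_point k.
by move=> x' l' /u[h ->]; split=> // i; rewrite h e.
Qed.

(** The support of the optimizer has been recorded, so a nonnegative row exists and the best row has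
    a multiplier of at most the optimal value. That multiplier is the value of the best row, which
    is therefore optimal; it may have been recorded for a support other than that of the
    optimizer. *)
Lemma recovers_final (s : memory R) :
  rmem s 1 0 0 = min_diag Q ->
  (forall i j : 'I_n.+1, nmem s 1 i j = defect Q i j :> nat) ->
  (forall i j : 'I_n.+1, (nmem s 2 i 0 == nmem s 2 j 0) = connect (defect Q) i j) ->
  rows_ok Q s ->
  (forall i p, p \in positions -> valid_position component_list i p ->
      recorded Q s (support_of component_list i p)) ->
  (forall i j : 'I_n.+1,
    rmem s 4 i j = rmem s 2 (nmem s 6 1 0) i * rmem s 2 (nmem s 6 1 0) j) ->
  recovers Q s.
Proof.
move=> h1 h2 h3 [_ rb rc] hr h4.
have rec T : is_local_support Q T -> recorded Q s T.
  by move=> /local_support_position[i [p [pp vp ->]]]; exact: hr.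
split=> //.
  move=> T x lam lT /kkt_unique_solutionP/(rec T lT)[k _ h]; exact: row_holds_recorded h.
have [T [x [lam [lT ux sx mn op]]]] := unique_rank_one_kkt sQ uQ.
have [k kr [_ hx hl]] := rec T lT x lam ux.
have nk : row_nonneg n s k by move=> i; rewrite hx; exact: sx.1.
move: rc; case: eqP => [_ rc|_ [br bn bmin]]; first by case: (rc k kr).
have [T' [x' [lam' [lT' ux' [hT hx' hl']]]]] := rb _ br.
have le : lam' <= lam by rewrite -hl' -hl; exact: bmin.
have [z' _ s1] := ux'.1.
have ze := zero_extend_restrict z'.
exists T', (\col_(k < #|T'|) x' (enum_val k)), lam'.
have sx' : simplex x' by split=> // i; rewrite -hx'; exact: bn.
have oE : zero_extend (\col_(k < #|T'|) x' (enum_val k)) *m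
    (zero_extend (\col_(k < #|T'|) x' (enum_val k)))^T
    = outer x'.
  by apply/matrixP => i j; rewrite !mxE big_ord1 [X in _ * X]mxE !ze.
split=> //.
- by apply/kkt_unique_solutionP; apply: eq_unique_kkt_point ux' => i; rewrite ze.
- by rewrite oE; apply: op => //; rewrite (kkt_point_value ux'.1).
- by move=> i j; rewrite oE h4 !hx' mxE.
Qed.

End Recovery.

Theorem recovery_cmd_correct (R : realType) : exists c, forall n (Q : 'M[R]_n.+1),
  symf Q -> dnn_unique_rank_one Q -> defect_components_le Q 4 ->
  recovers_within recovery_cmd Q (c * n.+1 ^ 2).
Proof.
have [K1 S1] := min_cmd_spec R.
have [K2 S2] := adjacency_cmd_spec R.
have [K3 S3] := init_labels_cmd_spec R.
have [K4 S4] := round_cmd_spec R.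
have [K5 S5] := members_cmd_spec R.
have [K6 S6] := supports_cmd_spec R.
have [K7 S7] := output_cmd_spec R.
exists (K1 + (K2 + (K3 + (K4 + (K4 + (K4 + (K5 + (K6 + K7))))))))%N.
move=> n Q sQ uQ cQ; rewrite /recovers_within -mulnn.
set M := (n.+1 * n.+1)%N.
suff : runs recovery_cmd (input Q)
    ((K1 + (K2 + (K3 + (K4 + (K4 + (K4 + (K5 + (K6 + K7)))))))) * M) (recovers Q).
  by move=> [t [s [h1 h2 h3]]]; exists t, s.
apply: runs_seq_scaled; first by apply: S1 => //; exact: holds_matrix_input.
move=> s1 m1 [f1 g1].
apply: runs_seq_scaled.
  apply: (S2 n Q) => //.
  - by rewrite f1.
  - by move=> i j; rewrite g1 //; exact: holds_matrix_input.
  - by move=> i j; rewrite f1.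
move=> s2 a2 [f2 g2].
apply: runs_seq_scaled; first by apply: (S3 n); rewrite f2 // f1.
move=> s3 l3 [f3 g3].
have [ok3 lb3] := @init_labels_ok R n (defect Q) s3 l3.
have d3 : nmem s3 0 0 0 = n.+1 by rewrite f3 // f2 // f1.
have adj3 (i j : 'I_n.+1) : nmem s3 1 i j = defect Q i j :> nat by rewrite f3.
apply: runs_seq_scaled; first exact: (S4 n (defect Q) 0%N).
move=> s4 [ok4 lb4] [f4 g4].
apply: runs_seq_scaled.
  apply: (S4 n (defect Q) 1%N) => //; first by rewrite f4.
  by move=> i j; rewrite f4.
move=> s5 [ok5 lb5] [f5 g5].
apply: runs_seq_scaled.
  apply: (S4 n (defect Q) 2%N) => //; first by rewrite f5 // f4.
  by move=> i j; rewrite f5 // f4.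
move=> s6 [ok6 lb6] [f6 g6].
have lab6 := labels_connect ok6 lb6 (connect_defect_sym Q) cQ.
have d6 : nmem s6 0 0 0 = n.+1 by rewrite f6 // f5 // f4.
(* The remaining phases rely on the zeros of the input in all arrays not written so far. *)
have n6 a : a \notin [:: 0; 1; 2; 10; 11]%N -> forall i j, nmem s6 a i j = 0%N.
  rewrite !inE !negb_or => /and5P[/negPf a0 /negPf a1 /negPf a2' /negPf a10 /negPf a11] i j.
  rewrite f6 ?f5 ?f4 ?f3 ?f2 ?f1 //= ?inE ?a0 ?a1 ?a2' ?a10 ?a11 //.
have r6 a : a \notin [:: 0; 1]%N -> forall i j, rmem s6 a i j = 0.
  rewrite !inE !negb_or => /andP[/negPf a0 /negPf a1] i j.
  by rewrite g6 ?g5 ?g4 ?g3 ?g2 ?g1 //= ?inE ?a0 ?a1.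
apply: runs_seq_scaled; first by apply: (S5 n) => // i; apply: n6.
move=> s7 m7 [f7 g7].
pose L := component_list Q.
have hm : holds_members Q L s7.
  split=> [i j|i].
    by rewrite g7 // g6 // g5 // g4 // g3 // g2 // g1 //; exact: holds_matrix_input.
  rewrite m7 -val_enum_ord filter_map; congr map; apply: eq_filter => j /=.
  by rewrite lab6 inE connect_defect_sym.
have rok : rows_ok Q s7.
  have z7 i j a : a \in [:: 3; 6; 7]%N -> nmem s7 a i j = 0%N.
    by rewrite !inE => /or3P[]/eqP ->; rewrite f7 // n6.
  split; rewrite ?z7 //.
  by move=> k j _; rewrite z7 // g7 // r6.
apply: runs_seq_scaled.
  apply: (S6 n Q L) => //.
  - exact: component_list_uniq.
  - exact: mem_component_list.
  - by rewrite f7.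
move=> s8 [rok8 rec8] [f8 g8].
have n8 a : a \notin [:: 3; 6; 7; 10]%N -> forall i j, nmem s8 a i j = nmem s7 a i j.
  by move=> ha i j; apply: f8; exact: nat_writes_supports_cmd.
have r8 a : a \notin [:: 2; 3; 5]%N -> forall i j, rmem s8 a i j = rmem s7 a i j.
  by move=> ha i j; apply: g8; exact: real_writes_supports_cmd.
have d8 : nmem s8 0 0 0 = n.+1 by rewrite n8 // f7.
apply: (runs_weaken (runs_frame (S7 n s8 d8))) => // s9 [q9 [f9 g9]].
have n9 a : a \notin [:: 10; 11]%N -> forall i j, nmem s9 a i j = nmem s8 a i j.
  rewrite !inE negb_or => /andP[/negPf a10 /negPf a11] i j.
  by rewrite f9 //= !inE a10 a11.
have r9 a : a != 4%N -> forall i j, rmem s9 a i j = rmem s8 a i j.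
  by move=> a4 i j; rewrite g9 //= inE.
apply: recovers_final => //.
- by rewrite r9 // r8 // g7 // g6 // g5 // g4 // g3 // g2 // m1.
- by move=> i j; rewrite n9 // n8 // f7 // f6 // f5 // f4.
- by move=> i j; rewrite !n9 // !n8 // !f7 //; exact: lab6.
- move: rok8; rewrite /rows_ok !n9 // => -[za zb zc]; split.
  + by move=> k j /za; rewrite n9 // r9.
  + move=> k /zb[T [x [l [h1 h2 [q1 q2 q3]]]]]; exists T, x, l; split=> //.
    by split=> [v|v|]; rewrite ?n9 ?r9.
  have nnE k : row_nonneg n s9 k <-> row_nonneg n s8 k.
    by split=> h v; have := h v; rewrite r9.
  move: zc; case: ifP => _ zc; first by move=> k kr /nnE; exact: zc.
  have [z1 z2 z3] := zc; split=> //; first exact/nnE.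
  by move=> k kr /nnE h; rewrite !r9 //; exact: z3.
- move=> i p pp vp x l /(rec8 i p pp vp)[k kr [q1 q2 q3]]; exists k; first by rewrite n9.
  by split=> [v|v|]; rewrite ?n9 ?r9.
by move=> i j; rewrite q9 !n9 // !r9.
Qed.

Local Open Scope classical_set_scope.
Local Open Scope ring_scope.

(** * Measurability *)

Lemma measurable_set_le d (T : measurableType d) (R : realType) (f g : T -> R) :
  measurable_fun setT f -> measurable_fun setT g ->
  measurable [set w | f w <= g w].
Proof.
move=> mf mg; rewrite -[X in measurable X]setTI.
exact: measurable_fun_le.
Qed.

Lemma measurable_set_lt d (T : measurableType d) (R : realType) (f g : T -> R) :
  measurable_fun setT f -> measurable_fun setT g ->
  measurable [set w | f w < g w].
Proof.
move=> mf mg; rewrite (_ : mkset _ = ~` [set w | g w <= f w]).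
  by apply: measurableC; exact: measurable_set_le.
by apply/seteqP; split=> w /=; rewrite ltNge => /negP.
Qed.

Section CompactProjection.
Context d (T : measurableType d) (R : realType) (N : nat).

(** The dense points must lie in K, so grid points cannot serve themselves. For each scale and grid
    point a nearby point of K is chosen if there is one, and [x0] otherwise. *)
Lemma countable_dense_subset (K : set 'rV[R]_N) (x0 : 'rV[R]_N) : K x0 ->
  exists D : nat * 'rV[int]_N -> 'rV[R]_N, (forall p, K (D p)) /\
    forall x (e : R), K x -> 0 < e -> exists p, ball x e (D p).
Proof.
move=> Kx0.
pose near (p : nat * 'rV[int]_N) (x : 'rV[R]_N) :=
  forall i, `|x 0 i * p.1.+1%:R - (p.2 0 i)%:~R| <= 1 :> R.
have ex (p : nat * 'rV[int]_N) : exists y, K y /\ ((exists x, K x /\ near p x) -> near p y).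
  have [[x [Kx nx]]|nx] := pselect (exists x, K x /\ near p x); first by exists x.
  by exists x0.
pose D p := sval (cid (ex p)).
exists D; split=> [p|x e Kx e0].
  by rewrite /D; case: cid => y [].
(* Two points near the same grid point at scale m + 1 differ by at most 2 / (m + 1) < e in each
   coordinate. *)
pose m := Num.truncn (2 / e).
have m0 : 0 < m.+1%:R :> R by rewrite ltr0n.
have me : 2 < e * m.+1%:R.
  by rewrite mulrC -ltr_pdivrMr //; apply: truncnS_gt.
pose z : 'rV[int]_N := \row_i Num.floor (x 0 i * m.+1%:R).
have nz : near (m, z) x.
  move=> i; rewrite mxE ger0_norm ?subr_ge0 ?floor_le //.
  have := floorD1_gt (x 0 i * m.+1%:R); rewrite intrD => h.
  by rewrite lerBlDr addrC ltW.
exists (m, z); split => // a i; rewrite (ord1 a).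
rewrite /D; case: cid => y /= [Ky /(_ (ex_intro _ x (conj Kx nz))) ny].
have := ny i; have := nz i => /= h1 h2.
rewrite /ball /= -(ltr_pM2r m0); apply: le_lt_trans me.
rewrite -[X in `|_| * X]gtr0_norm // -normrM mulrBl.
have -> : x 0 i * m.+1%:R - y 0 i * m.+1%:R =
  (x 0 i * m.+1%:R - (z 0 i)%:~R) - (y 0 i * m.+1%:R - (z 0 i)%:~R) by ring.
by apply: le_trans (ler_normB _ _) _; lra.
Qed.

(** Projections of measurable sets need not be measurable. Continuity lets a countable dense set
    witness h < 1 / (m + 1) for every m, and compactness turns these approximate witnesses into an
    attained minimum that is at most 0. *)
Lemma measurable_exists_compact (K : set 'rV[R]_N) (h : T -> 'rV[R]_N -> R) :
  compact K -> (forall w, continuous (h w)) ->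
  (forall x, measurable_fun setT (h ^~ x)) ->
  measurable [set w | exists2 x, K x & h w x <= 0].
Proof.
move=> cK ch mh.
have [K0|/set0P[x0 Kx0]] := eqVneq K set0.
  rewrite (_ : mkset _ = set0) //; apply/seteqP; split=> w //= [x].
  by rewrite K0.
have [D [KD dD]] := countable_dense_subset Kx0.
rewrite (_ : mkset _ =
  \bigcap_m \bigcup_p [set w | h w (D p) < m.+1%:R^-1]); last first.
  apply/seteqP; split=> [w [x Kx hx] m _|w H] /=.
    have /(@cvgrPdist_lt R) /(_ m.+1%:R^-1) := ch w x.
    rewrite invr_gt0 ltr0n => /(_ isT) /nbhs_ballP[e /= e0 be].
    have [p bp] := dD x e Kx e0; exists p => //=.
    have /= := be _ bp; rewrite distrC => /(le_lt_trans (ler_norm _)).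
    by rewrite ltrBlDr => /lt_le_trans; apply; rewrite gerDl; exact: hx.
  have K0 : K !=set0 by exists x0.
  have cK' : {within K, continuous (h w)} by exact: continuous_subspaceT.
  have [c /set_mem Kc cmin] := compact_EVT_min K0 cK cK'.
  exists c => //; apply/ler_addgt0Pr => e e0; rewrite add0r.
  have [p _ /= hp] := H (Num.truncn e^-1) I.
  apply: le_trans (_ : h w (D p) <= _); first by apply: cmin; apply/mem_set/KD.
  apply: ltW; apply: lt_trans hp _.
  rewrite invf_plt ?posrE ?ltr0n //; exact: truncnS_gt.
apply: bigcapT_measurable => m; apply: countable_bigcupT_measurable.
  exact: countableP.
by move=> p; apply: measurable_set_lt => //; exact: measurable_cst.
Qed.

End CompactProjection.

Section OptimalSet.
Context (R : realType) (n : nat).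
Let N := (n * n + n * n)%N.

(** Two matrices are flattened into one row vector, the type on which the compact projection lemma
    quantifies. *)
Definition fst_mx (v : 'rV[R]_N) : 'M[R]_n :=
  \matrix_(i, j) v 0 (lshift (n * n) (mxvec_index i j)).
Definition snd_mx (v : 'rV[R]_N) : 'M[R]_n :=
  \matrix_(i, j) v 0 (rshift (n * n) (mxvec_index i j)).
Definition pair_mx (X Y : 'M[R]_n) : 'rV[R]_N := row_mx (mxvec X) (mxvec Y).

Lemma fst_pair_mx X Y : fst_mx (pair_mx X Y) = X.
Proof. by apply/matrixP => i j; rewrite mxE row_mxEl mxvecE. Qed.
Lemma snd_pair_mx X Y : snd_mx (pair_mx X Y) = Y.
Proof. by apply/matrixP => i j; rewrite mxE row_mxEr mxvecE. Qed.

Lemma continuous_fst_mx i j : continuous (fun v => fst_mx v i j).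
Proof.
by under eq_fun do rewrite mxE; exact: coord_continuous.
Qed.
Lemma continuous_snd_mx i j : continuous (fun v => snd_mx v i j).
Proof.
by under eq_fun do rewrite mxE; exact: coord_continuous.
Qed.

Lemma continuous_sumr (V : topologicalType) (I : Type) (r : seq I) (F : I -> V -> R) :
  (forall i, continuous (F i)) -> continuous (fun v => \sum_(i <- r) F i v).
Proof.
by move=> cF; apply: continuous_big => //; exact: add_continuous.
Qed.

Lemma continuousDf (V : topologicalType) (f g : V -> R) :
  continuous f -> continuous g -> continuous (fun v => f v + g v).
Proof. by move=> cf cg v; apply: cvgD; [exact: cf|exact: cg]. Qed.

Lemma continuousBf (V : topologicalType) (f g : V -> R) :
  continuous f -> continuous g -> continuous (fun v => f v - g v).
Proof. by move=> cf cg v; apply: cvgB; [exact: cf|exact: cg]. Qed.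

Lemma continuousMf (V : topologicalType) (f g : V -> R) :
  continuous f -> continuous g -> continuous (fun v => f v * g v).
Proof. by move=> cf cg v; apply: cvgM; [exact: cf|exact: cg]. Qed.

Lemma continuous_normf (V : topologicalType) (f : V -> R) :
  continuous f -> continuous (fun v => `|f v|).
Proof. by move=> cf v; apply: cvg_norm; exact: cf. Qed.

Lemma continuous_cstf (V : topologicalType) (a : R) : continuous (fun _ : V => a).
Proof. by move=> v; exact: cvg_cst. Qed.

Lemma continuous_max0f (V : topologicalType) (f : V -> R) :
  continuous f -> continuous (fun v => Num.max 0 (f v)).
Proof.
move=> cf v; have := @continuous_max R V (fun=> 0) f v; apply; last exact: cf.
exact: cvg_cst.
Qed.

Lemma closed_preimage (V : topologicalType) (f : V -> R) (A : set R) :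
  continuous f -> closed A -> closed (f @^-1` A).
Proof. by move=> cf; apply: preimage_closed => x _; exact: cf. Qed.

Let closed_set_ge (V : topologicalType) (f : V -> R) a :
  continuous f -> closed [set v | a <= f v].
Proof. by move=> cf; apply: (closed_preimage (A := [set y | a <= y]) cf); exact: closed_ge. Qed.

Let closed_set_eq (V : topologicalType) (f : V -> R) a :
  continuous f -> closed [set v | f v = a].
Proof. by move=> cf; apply: (closed_preimage (A := [set y | y = a]) cf); exact: closed_eq. Qed.

Lemma closed_feasible (V : topologicalType) (F : V -> 'M[R]_n) :
  (forall i j, continuous (fun v => F v i j)) ->
  closed [set v | dnn_feasible (F v)].
Proof.
move=> cF.
rewrite (_ : mkset _ = (\bigcap_(p in [set: 'I_n * 'I_n])
   [set v | F v p.1 p.2 - F v p.2 p.1 = 0]) `&`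
  (\bigcap_x [set v | 0 <= qform (F v) x]) `&`
  (\bigcap_(p in [set: 'I_n * 'I_n]) [set v | 0 <= F v p.1 p.2]) `&`
  [set v | \sum_i \sum_j F v i j = 1]); last first.
  apply/seteqP; split=> v /=.
    move/dnn_feasibleP => [[sX pX nX] X1]; repeat split => //.
    - by move=> p _ /=; rewrite sX subrr.
    - by move=> x _ /=; exact: pX.
    - by move=> p _ /=; exact: nX.
  move=> [[[H1 H2] H3] H4]; apply/dnn_feasibleP; split=> //; split.
  - by move=> i j; apply/eqP; rewrite -subr_eq0; apply/eqP; exact: (H1 (i, j)).
  - by move=> x; exact: H2.
  - by move=> i j; exact: (H3 (i, j)).
apply: closedI; first apply: closedI; first apply: closedI.
- apply: closed_bigI => p _; apply: closed_set_eq => v.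
  by apply: cvgB; apply: cF.
- apply: closed_bigI => x _; apply: closed_set_ge.
  apply: continuous_sumr => i; apply: continuous_sumr => j v.
  apply: cvgM; last exact: cvg_cst.
  by apply: cvgM; [exact: cvg_cst|exact: cF].
- by apply: closed_bigI => p _; apply: closed_set_ge; exact: cF.
- by apply: closed_set_eq; apply: continuous_sumr => i; apply: continuous_sumr => j.
Qed.

Lemma feasible_le1 (X : 'M[R]_n) : dnn_feasible X -> forall i j, 0 <= X i j <= 1.
Proof.
move=> /dnn_feasibleP[[_ _ nX] X1] i j; rewrite nX /= -X1.
rewrite (bigD1 i) //= (bigD1 j) //= -addrA lerDl addr_ge0 ?sumr_ge0 //.
by move=> k _; apply: sumr_ge0.
Qed.

Definition feasible_pairs : set 'rV[R]_N :=
  [set v | dnn_feasible (fst_mx v) /\ dnn_feasible (snd_mx v)].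

Lemma compact_feasible_pairs : compact feasible_pairs.
Proof.
apply: (@subclosed_compact _ _ [set v : 'rV[R]_N | forall i, `[0, 1]%classic (v ord0 i)]).
- rewrite (_ : feasible_pairs = [set v | dnn_feasible (fst_mx v)] `&`
    [set v | dnn_feasible (snd_mx v)]) //.
  apply: closedI; apply: closed_feasible.
    exact: continuous_fst_mx.
  exact: continuous_snd_mx.
- apply: (@rV_compact R N (fun=> `[0, 1]%classic)) => i; exact: segment_compact.
move=> v [/feasible_le1 f /feasible_le1 g] k; rewrite /= in_itv /=.
rewrite -(splitK k); case: (fintype.split k) => l /=; case/mxvec_indexP: l => i j.
  by have := f i j; rewrite mxE.
by have := g i j; rewrite mxE.
Qed.

Lemma continuous_mxinner (V : topologicalType) (F : V -> 'M[R]_n) (Q : 'M[R]_n) :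
  (forall i j, continuous (fun v => F v i j)) ->
  continuous (fun v => mxinner Q (F v)).
Proof.
move=> cF; under eq_fun do rewrite mxinnerE.
apply: continuous_sumr => i; apply: continuous_sumr => j v.
by apply: cvgM; [exact: cvg_cst|exact: cF].
Qed.

End OptimalSet.

Lemma dnn_optimal_exists (R : realType) n (Q : 'M[R]_n.+1) : exists X, dnn_optimal Q X.
Proof.
have f0 := dnn_feasible_outer (@simplex_delta R n.+1 ord0).
have K0 : @feasible_pairs R n.+1 !=set0.
  by eexists (pair_mx _ _); split; rewrite ?fst_pair_mx ?snd_pair_mx; exact: f0.
have cf : {within @feasible_pairs R n.+1, continuous (fun v => mxinner Q (fst_mx v))}.
  by apply: continuous_subspaceT; apply: continuous_mxinner; exact: continuous_fst_mx.
have [v /set_mem[fv _] vmin] := compact_EVT_min K0 (@compact_feasible_pairs R n.+1) cf.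
exists (fst_mx v); split=> // Y fY.
have := vmin (pair_mx Y Y); rewrite fst_pair_mx; apply; apply/mem_set.
by split; rewrite ?fst_pair_mx ?snd_pair_mx.
Qed.

Section MeasurableUnique.
Context d (T : measurableType d) (R : realType) (n : nat) (M : T -> 'M[R]_n.+1).
Hypothesis mM : forall i j, measurable_fun setT (fun w => M w i j).

Let theta w := mxinner (M w) (sval (cid (dnn_optimal_exists (M w)))).

Let theta_le w X : dnn_feasible X -> theta w <= mxinner (M w) X.
Proof. by rewrite /theta; case: cid => Y [_ h] /= /h. Qed.

Let theta_attained w : exists2 X, dnn_feasible X & theta w = mxinner (M w) X.
Proof. by rewrite /theta; case: cid => X [fX _] /=; exists X. Qed.

Let theta_optimal w X : dnn_feasible X -> mxinner (M w) X <= theta w ->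
  dnn_optimal (M w) X.
Proof. by move=> fX h; split=> // Y /(theta_le w); exact: le_trans. Qed.

Let optimal_theta w X : dnn_optimal (M w) X -> mxinner (M w) X = theta w.
Proof.
move=> [fX h]; apply/eqP; rewrite eq_le theta_le // andbT.
by have [Y fY ->] := theta_attained w; exact: h.
Qed.

Let measurable_inner X : measurable_fun setT (fun w => mxinner (M w) X).
Proof.
under eq_fun do rewrite mxinnerE.
apply: measurable_sum => i; apply: measurable_sum => j.
by apply: measurable_funM => //; exact: measurable_cst.
Qed.

Let measurable_theta : measurable_fun setT theta.
Proof.
move=> mD; apply: (measurability _ (RGenOInfty.measurableE R)) => //.
move=> /= _ [_ [a ->] <-]; rewrite preimage_itvoy setTI.
rewrite (_ : [set w | a < theta w] = ~` [set w | exists2 v, @feasible_pairs R n.+1 v &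
    mxinner (M w) (fst_mx v) - a <= 0]); last first.
  apply/seteqP; split=> w /=.
    by move=> h [v [/(theta_le w) fv _]]; rewrite subr_le0 => /(le_trans fv); rewrite leNgt h.
  move=> h; rewrite ltNge; apply/negP => ta; apply: h.
  have [X fX XE] := theta_attained w; exists (pair_mx X X).
    by split; rewrite ?fst_pair_mx ?snd_pair_mx.
  by rewrite fst_pair_mx -XE subr_le0.
apply: measurableC; apply: measurable_exists_compact.
- exact: compact_feasible_pairs.
- move=> w; apply: continuousBf; last exact: continuous_cstf.
  by apply: continuous_mxinner; exact: continuous_fst_mx.
- by move=> v; apply: measurable_funB => //; exact: measurable_cst.
Qed.

Let minor (X : 'M[R]_n.+1) (p : 'I_n.+1 * 'I_n.+1 * ('I_n.+1 * 'I_n.+1)) : R :=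
  X p.1.1 p.1.2 * X p.2.1 p.2.2 - X p.1.1 p.2.2 * X p.2.1 p.1.2.

(** One continuous quantity for both failures, two distinct optimizers and rank above one. The
    failure event becomes a single existential over pairs of optimal matrices. *)
Let gap (X Y : 'M[R]_n.+1) : R :=
  \sum_p `|X p.1 p.2 - Y p.1 p.2| + \sum_p `|minor X p|.

Let gap_ge0 (X Y : 'M[R]_n.+1) : 0 <= gap X Y.
Proof. by apply: addr_ge0; apply: sumr_ge0. Qed.

Let gap_eq0 X Y : gap X Y = 0 <->
  X = Y /\ forall i j k l, X i j * X k l = X i l * X k j.
Proof.
have sum0 (I : finType) (F : I -> R) :
    (\sum_i `|F i| == 0) = [forall i, F i == 0].
  rewrite psumr_eq0 //; apply/allP/forallP => h i; last by rewrite normr_eq0 h.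
  by have := h i; rewrite mem_index_enum normr_eq0; apply.
split=> [/eqP|[<- h]]; last first.
  rewrite /gap !big1 ?addr0 // => [[[i j] [k l]]|p] _; rewrite ?subrr ?normr0 //.
  by rewrite /minor h subrr normr0.
rewrite paddr_eq0 ?sumr_ge0 // !sum0 => /andP[/forallP h1 /forallP h2].
split=> [|i j k l]; last by apply/eqP; rewrite -subr_eq0 (h2 ((i, j), (k, l))).
by apply/matrixP => i j; apply/eqP; rewrite -subr_eq0 (h1 (i, j)).
Qed.

Let unique_gap w : dnn_unique_rank_one (M w) <->
  forall X Y, dnn_optimal (M w) X -> dnn_optimal (M w) Y -> gap X Y = 0.
Proof.
split=> [[Z [oZ uZ rZ]] X Y /uZ -> /uZ ->|H].
  by apply/gap_eq0; split=> //; exact: rank1_minors.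
have [X oX] := dnn_optimal_exists (M w); exists X; split=> //.
  by move=> Y oY; have /gap_eq0[] := H Y X oY oX.
have /gap_eq0[_ mX] := H X X oX oX.
by have [x sx ->] := minors_outer oX.1 mX; exact: rank_outer.
Qed.

Lemma measurable_dnn_unique_rank_one : measurable [set w | dnn_unique_rank_one (M w)].
Proof.
(* On feasible pairs all three summands are nonnegative, so h <= 0 says that both matrices are
   optimal and their gap is at least 1 / (k + 1). Cutting the open condition gap > 0 into these
   closed ones makes the compact projection applicable. *)
pose h k w v := mxinner (M w) (fst_mx v) - theta w + (mxinner (M w) (snd_mx v) - theta w) +
  Num.max 0 (k.+1%:R^-1 - gap (fst_mx v) (snd_mx v)).
rewrite (_ : mkset _ = ~` \bigcup_k [set w | exists2 v, @feasible_pairs R n.+1 v & h k w v <= 0]).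
  apply: measurableC; apply: bigcupT_measurable => k.
  apply: measurable_exists_compact; first exact: compact_feasible_pairs.
  - have cst (a : R) : continuous (fun _ : 'rV[R]_(n.+1 * n.+1 + n.+1 * n.+1) => a).
      exact: continuous_cstf.
    move=> w; apply: continuousDf; first apply: continuousDf.
    + apply: continuousBf => //.
      by apply: continuous_mxinner; exact: continuous_fst_mx.
    + apply: continuousBf => //.
      by apply: continuous_mxinner; exact: continuous_snd_mx.
    + apply: continuous_max0f; apply: continuousBf => //; apply: continuousDf.
        apply: continuous_sumr => p; apply: continuous_normf.
        by apply: continuousBf; [exact: continuous_fst_mx|exact: continuous_snd_mx].
      apply: continuous_sumr => p; apply: continuous_normf.
      by apply: continuousBf; apply: continuousMf; exact: continuous_fst_mx.
  - move=> v; apply: measurable_funD; last exact: measurable_cst.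
    by apply: measurable_funD; apply: measurable_funB.
apply/seteqP; split=> w /=.
  move=> /unique_gap u [k _ /= [v [fX fY]]].
  have := theta_le w fX; have := theta_le w fY; rewrite /h.
  set X := fst_mx v in fX *; set Y := snd_mx v in fY *.
  set m := Num.max _ _ => h1 h2 h3.
  have m0 : 0 <= m by rewrite le_max lexx.
  have g0 : gap X Y = 0 by apply: u; apply: theta_optimal => //; lra.
  have : 0 < m by rewrite /m g0 subr0 lt_max invr_gt0 ltr0n orbT.
  by lra.
move=> H; apply/unique_gap => X Y oX oY; apply/eqP/negPn/negP => gn.
have gp : 0 < gap X Y by rewrite lt_def gn gap_ge0.
apply: H; exists (Num.truncn (gap X Y)^-1) => //=; exists (pair_mx X Y).
  by split; rewrite ?fst_pair_mx ?snd_pair_mx; [exact: oX.1|exact: oY.1].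
rewrite /h fst_pair_mx snd_pair_mx !optimal_theta // !subrr !add0r ge_max lexx /=.
rewrite subr_le0 ltW // invf_plt ?posrE ?ltr0n //; exact: truncnS_gt.
Qed.

End MeasurableUnique.

(** * Almost sure uniqueness of the optimizer *)

Section NormalIntervals.
Context (R : realType).
Implicit Types (s a b M : R).

Let lebesgue_itv_cc a b : a <= b ->
  lebesgue_measure (`[a, b]%classic : set R) = (b - a)%:E.
Proof.
rewrite le_eqVlt lebesgue_measure_itv /= lte_fin => /predU1P[->|ab].
  by rewrite ltxx subrr.
by rewrite ab EFinB.
Qed.

Let integral_cst_itv a b M : a <= b ->
  (\int[lebesgue_measure]_(x in `[a, b]) (cst M%:E x))%E = (M * (b - a))%:E.
Proof.
move=> ab; have := @integral_cst _ _ R (@lebesgue_measure R) `[a, b]%classic.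
by move=> -> //; rewrite EFinM; congr (_ * _)%E; exact: lebesgue_itv_cc.
Qed.

Lemma normal_prob_itv_le s a b M : a <= b ->
  (forall x, a <= x <= b -> normal_pdf 0 s x <= M) ->
  (normal_prob 0 s `[a, b] <= (M * (b - a))%:E)%E.
Proof.
move=> ab h; rewrite /normal_prob.
have M0 : 0 <= M by apply: le_trans (h a _); rewrite ?normal_pdf_ge0 ?lexx.
apply: (@le_trans _ _ (\int[lebesgue_measure]_(x in `[a, b]) (cst M%:E x))%E).
  apply: ge0_le_integral => //=.
  - by move=> x _; rewrite lee_fin normal_pdf_ge0.
  - by apply/measurable_EFinP; apply: measurable_funTS; exact: measurable_normal_pdf.
by rewrite integral_cst_itv.
Qed.

Lemma normal_prob_itv_ge s a b M : a <= b -> 0 <= M ->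
  (forall x, a <= x <= b -> M <= normal_pdf 0 s x) ->
  ((M * (b - a))%:E <= normal_prob 0 s `[a, b])%E.
Proof.
move=> ab M0 h; rewrite /normal_prob.
apply: (@le_trans _ _ (\int[lebesgue_measure]_(x in `[a, b]) (cst M%:E x))%E).
  by rewrite integral_cst_itv.
apply: ge0_le_integral => //=.
- by apply/measurable_EFinP; apply: measurable_funTS; exact: measurable_normal_pdf.
Qed.

End NormalIntervals.

Section AlmostSureUnique.

(** Raising one entry of Q cannot raise the same entry of an optimizer. The two optimality
    inequalities add up to <Q' - Q, Y - X> <= 0; in it the entry (i0, j0) contributes at least g,
    its mirror image is nonnegative, and the rest is at least -2e because the entries of X and of Y
    sum to 1. *)
Lemma optimal_entry_gap (R : realType) n (Q Q' X Y : 'M[R]_n) i0 j0 (e r1 r2 : R) :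
  (forall i j, (i, j) != (i0, j0) -> (i, j) != (j0, i0) -> `|Q' i j - Q i j| <= e) ->
  symf Q -> symf Q' -> 0 <= e ->
  dnn_optimal Q X -> dnn_optimal Q' Y ->
  X i0 j0 <= r1 -> r2 <= Y i0 j0 -> r1 <= r2 -> Q i0 j0 <= Q' i0 j0 ->
  (Q' i0 j0 - Q i0 j0) * (r2 - r1) <= 2 * e.
Proof.
move=> close sQ sQ' e0 [fX oX] [fY oY] X1 Y2 r12 Q12.
have /dnn_feasibleP[[sX _ nX] sumX] := fX.
have /dnn_feasibleP[[sY _ nY] sumY] := fY.
have h1 := oX _ fY; have h2 := oY _ fX.
set g := _ * _.
have : \sum_i \sum_j (- e * (Y i j + X i j) + (j == j0)%:R * ((i == i0)%:R * g)) <=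
    \sum_i \sum_j (Q' i j - Q i j) * (Y i j - X i j).
  apply: ler_sum => i _; apply: ler_sum => j _.
  have p0 : 0 <= e * (Y i j + X i j) by rewrite mulr_ge0 // addr_ge0.
  have gap0 : 0 <= (Q' i0 j0 - Q i0 j0) * (Y i0 j0 - X i0 j0).
    by apply: mulr_ge0; lra.
  have gg : g <= (Q' i0 j0 - Q i0 j0) * (Y i0 j0 - X i0 j0).
    by apply: ler_wpM2l; lra.
  have [[-> ->]|ne] := eqVneq (i, j) (i0, j0).
    by rewrite !eqxx !mul1r mulNr; apply: le_trans gg; rewrite gerDr oppr_le0
      mulr_ge0 // addr_ge0.
  have -> : (j == j0)%:R * ((i == i0)%:R * g) = 0.
    move: ne; rewrite xpair_eqE negb_and; case: (i == i0) => //= [/negPf ->|_].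
      by rewrite mul0r.
    by rewrite mul0r mulr0.
  rewrite addr0 mulNr.
  have [[-> ->]|ne'] := eqVneq (i, j) (j0, i0).
    by rewrite (sQ' j0) (sQ j0) (sY j0) (sX j0); apply: le_trans gap0; rewrite oppr_le0
       mulr_ge0 // addr_ge0.
  rewrite lerNl; apply: le_trans (ler_norm _) _; rewrite normrN normrM.
  apply: ler_pM => //; first exact: close.
  by apply: le_trans (ler_normB _ _) _; rewrite !ger0_norm.
have -> : \sum_i \sum_j (Q' i j - Q i j) * (Y i j - X i j) =
  mxinner Q' Y - mxinner Q' X - (mxinner Q Y - mxinner Q X).
  rewrite !mxinnerE -!sumrB; apply: eq_bigr => i _; rewrite -!sumrB.
  by apply: eq_bigr => j _; ring.
have -> : \sum_i \sum_j (- e * (Y i j + X i j) + (j == j0)%:R * ((i == i0)%:R * g)) =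
   - e * (1 + 1) + g.
  transitivity (- e * (\sum_i \sum_j (Y i j + X i j)) + g); last first.
    congr (_ * _ + _); rewrite -[X in _ = X + _]sumY -[X in _ = _ + X]sumX.
    by rewrite -big_split; apply: eq_bigr => i _; rewrite -big_split.
  rewrite mulr_sumr -[g in RHS](sum_delta i0 (fun _ => g)).
  rewrite -big_split; apply: eq_bigr => i _ /=.
  rewrite mulr_sumr -[g * _ in RHS](sum_delta j0 (fun _ => g * (i == i0)%:R)).
  rewrite -big_split; apply: eq_bigr => j _ /=.
  by rewrite [(j == j0)%:R * _]mulrC [_ * g]mulrC.
by lra.
Qed.

Context d (T : measurableType d) (R : realType) (P : probability T R).

(** Meant for sets that are covered by small events without being shown measurable. *)
Lemma negligible_outer (A : set T) :
  (forall e : R, 0 < e -> exists N, [/\ measurable N, A `<=` N & (P N <= e%:E)%E]) ->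
  P.-negligible A.
Proof.
move=> H.
have ex k : exists N, [/\ measurable N, A `<=` N & (P N <= (k.+1%:R^-1 : R)%:E)%E].
  by apply: H; rewrite invr_gt0 ltr0n.
pose N k := sval (cid (ex k)).
have NP k : [/\ measurable (N k), A `<=` N k & (P (N k) <= (k.+1%:R^-1 : R)%:E)%E].
  by rewrite /N; case: cid.
exists (\bigcap_k N k); split; last by move=> w Aw k _; have [_ /(_ w Aw)] := NP k.
  by apply: bigcapT_measurable => k; have [] := NP k.
apply/eqP; rewrite eq_le measure_ge0 andbT; apply/lee_addgt0Pr => e e0; rewrite add0e.
pose k := Num.truncn e^-1.
have [mk _ le] := NP k.
apply: (@le_trans _ _ (P (N k))).
  apply: le_measure; rewrite ?inE //; last by move=> w; apply.
  by apply: bigcapT_measurable => j; have [] := NP j.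
apply: le_trans le _; rewrite lee_fin ltW // invf_plt ?posrE ?ltr0n //.
exact: truncnS_gt.
Qed.

Lemma independent_split (I : finType) (X : I -> {RV P >-> R}) (i0 : I) (B : I -> set R) :
  mutually_independent X -> (forall i, measurable (B i)) ->
  P [set w | forall i, B i (X i w)] =
  (P [set w | forall i, i != i0 -> B i (X i w)] * P (X i0 @^-1` B i0))%E.
Proof.
move=> ind mB.
have := ind [set: I]%SET B mB; rewrite (bigD1 i0) ?inE //= muleC => E.
have := ind [set~ i0]%SET B mB.
rewrite (eq_bigl (fun i => (i \in [set: I]%SET) && (i != i0))); last first.
  by move=> i; rewrite !inE.
move=> E'; rewrite -E' in E; rewrite (_ : mkset _ = [set w | forall i : I,
   i \in [set: I]%SET -> B i (X i w)]).
  rewrite E; congr (P _ * _)%E; apply/seteqP; split=> w /= h i.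
    by move=> ii; apply: h; rewrite !inE.
  by rewrite !inE; apply: h.
apply/seteqP; split=> w /= h i; first by move=> _; exact: h.
by apply: h; rewrite inE.
Qed.

Lemma RV_measurable (X : {RV P >-> R}) : measurable_fun setT X.
Proof. exact: measurable_funP. Qed.

Lemma RV_preimage_measurable (X : {RV P >-> R}) (B : set R) : measurable B ->
  measurable (X @^-1` B).
Proof. by move=> mB; rewrite -[X in measurable X]setTI; apply: RV_measurable. Qed.

Lemma measurable_forall_fin (I : finType) (F : I -> set T) (p : pred I) :
  (forall i, measurable (F i)) -> measurable [set w | forall i, p i -> F i w].
Proof.
move=> mF; rewrite (_ : mkset _ = \bigcap_(i in [set` p]) F i) //.
by apply: fin_bigcap_measurable => //; exact: finite_finset.
Qed.

(* Covering by boxes in the other coordinates: in each box the bad set confines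
   [X i0] to an interval of length proportional to the side of the box. *)
Lemma negligible_determined (I : finType) (X : I -> {RV P >-> R}) (i0 : I)
    (A : set T) (C M : R) :
  mutually_independent X -> 0 <= C -> 0 <= M ->
  (forall a e : R, 0 <= e ->
    (P (X i0 @^-1` `[(a - e)%R, (a + e)%R]%classic) <= (M * e)%:E)%E) ->
  (forall (e : R) w w', 0 < e -> A w -> A w' ->
     (forall i, i != i0 -> `|X i w - X i w'| <= e) -> `|X i0 w - X i0 w'| <= C * e) ->
  P.-negligible A.
Proof.
move=> ind C0 M0 small lip; apply: negligible_outer => e e0.
(* The side of the boxes; the bad set then has outer probability at most M C [dl] <= e, and the
   summand 1 covers the case M C = 0. *)
pose dl := e / (1 + M * C).
have MC0 : 0 < 1 + M * C by rewrite ltr_pwDl // mulr_ge0.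
have dl0 : 0 < dl by rewrite divr_gt0.
pose cell (b : {ffun I -> int}) i : set R :=
  `[(b i)%:~R * dl, (b i + 1)%:~R * dl[%classic.
pose box b : set T := [set w | forall i, i != i0 -> cell b i (X i w)].
(* Any bad point of the box serves as the center of the interval; a box without bad points takes an
   arbitrary one. *)
have exJ b : exists a, forall w, A w -> box b w -> `[a - C * dl, a + C * dl]%classic (X i0 w).
  have [[w0 [Aw0 bw0]]|no] := pselect (exists w0, A w0 /\ box b w0).
    exists (X i0 w0) => w Aw bw /=; rewrite in_itv /=.
    have := lip dl w w0 dl0 Aw Aw0; rewrite ler_distl => -> //.
    move=> i ii; have := bw i ii; have := bw0 i ii; rewrite /cell /= !in_itv /=.
    rewrite intrD mulrDl mul1r ler_distl => /andP[h1 h2] /andP[h3 h4].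
    by apply/andP; split; lra.
  by exists 0 => w Aw bw; case: no; exists w.
pose a b := sval (cid (exJ b)).
have aP b w : A w -> box b w -> `[a b - C * dl, a b + C * dl]%classic (X i0 w).
  by rewrite /a; case: (cid (exJ b)) => x /= h; exact: h.
have mbox b : measurable (box b).
  apply: (@measurable_forall_fin _ (fun i => X i @^-1` cell b i)) => i.
  by apply: RV_preimage_measurable; exact: measurable_itv.
pose D b := X i0 @^-1` `[a b - C * dl, a b + C * dl]%classic.
have mD b : measurable (D b) by apply: RV_preimage_measurable; exact: measurable_itv.
have Pbox b : (P (box b `&` D b) <= (M * (C * dl))%:E * P (box b))%E.
  have := @independent_split _ X i0 (fun i => if i == i0 then `[a b - C * dl, a b + C * dl]%classic
     else cell b i) ind.
  move=> h; rewrite [X in P X](_ : _ = [set w | forall i, (if i == i0 then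
     `[a b - C * dl, a b + C * dl]%classic else cell b i) (X i w)]); last first.
    apply/seteqP; split=> w /= => [[bw Dw] i|h'].
      by case: eqP => [->|/eqP]; [exact: Dw | exact: bw].
    split; last by move: (h' i0); rewrite eqxx; exact: id.
    by move=> i /negPf ii; move: (h' i); rewrite ii; exact: id.
  rewrite h; last by move=> i; case: eqP => _; exact: measurable_itv.
  rewrite [X in (P X * _)%E](_ : _ = box b); last first.
    apply/seteqP; split=> w /= h' i ii; move: (h' i ii); rewrite (negPf ii); exact: id.
  rewrite eqxx muleC.
  by apply: lee_wpmul2r => //; apply: small; rewrite mulr_ge0 // ltW.
(* A box ignores the coordinate [i0], so only codes with [b i0 = 0] are kept. Each box then occurs
   once, the boxes are disjoint, and their probabilities sum to at most 1. *)
pose Cn k := if @pickle_inv {ffun I -> int} k is Some b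
  then if b i0 == 0 then box b else set0 else set0.
pose Fn k := if @pickle_inv {ffun I -> int} k is Some b then
  if b i0 == 0 then box b `&` D b else set0 else set0.
have mC k : measurable (Cn k) by rewrite /Cn; case: pickle_inv => // b; case: eqP.
have mF k : measurable (Fn k).
  by rewrite /Fn; case: pickle_inv => // b; case: eqP => // _; exact: measurableI.
have FC k : Fn k `<=` Cn k.
  by rewrite /Fn /Cn; case: pickle_inv => // b; case: eqP => // _ w [].
have PFC k : (P (Fn k) <= (M * (C * dl))%:E * P (Cn k))%E.
  rewrite /Fn /Cn; case: pickle_inv => [b|]; last by rewrite measure0 mule0.
  by case: eqP => _; [exact: Pbox | rewrite measure0 mule0].
have tC : trivIset setT Cn.
  apply/trivIsetP => k l _ _ kl; rewrite /Cn.
  have ik := @pickle_invK {ffun I -> int} k.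
  have il := @pickle_invK {ffun I -> int} l.
  case: (pickle_inv k) ik => [b|] /= ik; last by rewrite set0I.
  case: (pickle_inv l) il => [c|] /= il; last by rewrite setI0.
  case: eqP => [b0|_]; last by rewrite set0I.
  case: eqP => [c0|_]; last by rewrite setI0.
  apply/seteqP; split=> // w [bw cw]; move: kl; rewrite -ik -il.
  suff -> : b = c by rewrite eqxx.
  apply/ffunP => i; have [->|ii] := eqVneq i i0; first by rewrite b0 c0.
  have := bw i ii; have := cw i ii; rewrite /cell /= !in_itv /=.
  move=> /andP[h1 h2] /andP[h3 h4].
  have := le_lt_trans h1 h4; have := le_lt_trans h3 h2.
  rewrite !ltr_pM2r // !ltr_int !ltzD1 => h5 h6.
  by apply/eqP; rewrite eq_le h5 h6.
have tF : trivIset setT Fn.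
  apply/trivIsetP => k l _ _ kl; apply/seteqP; split=> // w [/FC h1 /FC h2].
  by have /trivIsetP/(_ k l Logic.I Logic.I kl)/seteqP[h _] := tC; apply: (h w).
exists (\bigcup_k Fn k); split.
- exact: bigcupT_measurable.
- move=> w Aw.
  pose b : {ffun I -> int} := [ffun i => if i == i0 then 0 else Num.floor (X i w / dl)].
  exists (pickle b) => //; rewrite /Fn pickleK_inv ffunE eqxx eqxx.
  have bw : box b w.
    move=> i ii; rewrite /cell /= in_itv /= ffunE (negPf ii).
    have /andP[h1 h2] := floor_itv (X i w / dl).
    by rewrite -ler_pdivlMr // h1 -ltr_pdivrMr.
  by split => //; exact: aP.
have mcd : 0 <= M * (C * dl) := mulr_ge0 M0 (mulr_ge0 C0 (ltW dl0)).
rewrite measure_bigcup //.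
apply: (@le_trans _ _ (\big[+%E/0%E]_(0 <= k <oo | k \in setT) ((M * (C * dl))%:E * P (Cn k)))%E).
  by apply: lee_nneseries => [k _ _|k _]; [exact: measure_ge0|exact: PFC].
rewrite nneseriesZl // -measure_bigcup //.
apply: (@le_trans _ _ ((M * (C * dl))%:E * 1)%E).
  by apply: lee_wpmul2l => //; apply: probability_le1; exact: bigcupT_measurable.
rewrite mule1 lee_fin /dl !mulrA ler_pdivrMr // mulrDr mulr1 (mulrC e).
by rewrite lerDr ltW.
Qed.

Lemma negligible_bigcup_countable (I : countType) (F : I -> set T) :
  (forall i, P.-negligible (F i)) -> P.-negligible (\bigcup_i F i).
Proof.
move=> nF; apply: (@negligibleS _ _ _ _ (\bigcup_k
    if @pickle_inv I k is Some i then F i else set0)).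
  by move=> w [i _ Fi]; exists (pickle i) => //; rewrite pickleK_inv.
apply: negligible_bigcup => k; case: pickle_inv => [i|]; first exact: nF.
exact: negligible_set0.
Qed.

Section GOEMatrix.
Context (n : nat) (Q : 'I_n -> 'I_n -> {RV P >-> R}) (goeQ : GOE Q).

Lemma GOE_sym w : symf (random_matrix Q w).
Proof. by case: goeQ => sQ _ _ _ i j; rewrite !mxE sQ. Qed.

Lemma GOE_measurable i j : measurable_fun setT (fun w => random_matrix Q w i j).
Proof. by under eq_fun do rewrite mxE; exact: RV_measurable. Qed.

Definition entry_sd (p : upper_index n) : R :=
  if (val p).1 == (val p).2 then 1 else Num.sqrt 2^-1.

Lemma entry_sd_neq0 p : entry_sd p != 0.
Proof.
rewrite /entry_sd; case: ifP => _; first exact: oner_neq0.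
by rewrite gt_eqF // sqrtr_gt0 invr_gt0.
Qed.

Lemma GOE_marginal (p : upper_index n) (B : set R) : measurable B ->
  P (Q (val p).1 (val p).2 @^-1` B) = normal_prob 0 (entry_sd p) B.
Proof.
case: goeQ => _ dg od _ mB; rewrite /entry_sd; case: eqP => [e|/eqP ne].
  by have := dg (val p).1 B mB; rewrite /distribution /= {2}e.
have lt : ((val p).1 < (val p).2)%N by rewrite ltn_neqAle ne (valP p).
exact: (od _ _ lt B mB).
Qed.

Lemma upper_index_of (i j : 'I_n) : exists p : upper_index n,
  val p = (i, j) \/ val p = (j, i).
Proof.
have [ij|ji] := leqP i j; first by exists (Sub (i, j) ij); left.
by exists (Sub (j, i) (ltnW ji)); right.
Qed.

(** Two rational levels q1 < q2 between the differing entries cut the set into countably many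
    pieces. In one piece every outcome has an optimizer with p-entry at most q1 and another with
    p-entry at least q2. For two outcomes the pairing required by [optimal_entry_gap] is thus
    available whichever has the larger Q_p, and Q_p is Lipschitz in the other entries with constant
    2 / (q2 - q1). *)
Lemma negligible_not_unique :
  P.-negligible [set w | exists X Y, [/\ dnn_optimal (random_matrix Q w) X,
    dnn_optimal (random_matrix Q w) Y & X <> Y]].
Proof.
pose F (t : upper_index n * (rat * rat)) := [set w | exists X Y,
  [/\ dnn_optimal (random_matrix Q w) X, dnn_optimal (random_matrix Q w) Y,
   X (val t.1).1 (val t.1).2 <= ratr t.2.1, ratr t.2.2 <= Y (val t.1).1 (val t.1).2
   & ratr t.2.1 < ratr t.2.2 :> R]].
apply: (@negligibleS _ _ _ _ (\bigcup_t F t)).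
  move=> w [X [Y [oX oY XY]]].
  have {XY} [i [j XY]] : exists i j, X i j != Y i j.
    apply: contrapT => h; apply: XY; apply/matrixP => i j; apply/eqP.
    by apply/negPn/negP => ne; apply: h; exists i, j.
  wlog {XY} XY : X Y oX oY / X i j < Y i j.
    move=> H; case: (ltgtP (X i j) (Y i j)) XY => // lt _; last exact: (H Y X).
    exact: (H X Y).
  have [p pij] := upper_index_of i j.
  have {}XY : X (val p).1 (val p).2 < Y (val p).1 (val p).2.
    case: pij => -> //=.
    have /dnn_feasibleP[[sX _ _] _] := oX.1; have /dnn_feasibleP[[sY _ _] _] := oY.1.
    by rewrite sX sY.
  have [q1] := rat_in_itvoo XY; rewrite in_itv /= => /andP[h1 h2].
  have [q2] := rat_in_itvoo h2; rewrite in_itv /= => /andP[h3 h4].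
  by exists (p, (q1, q2)) => //; exists X, Y; split=> //=; exact: ltW.
apply: negligible_bigcup_countable => -[p [q1 q2]].
have [q12|q12] := ltP (ratr q1 : R) (ratr q2); last first.
  apply: negligibleS (negligible_set0 _) => w [X [Y [_ _ _ _ /=]]].
  by rewrite ltNge q12.
have r0 : 0 < ratr q2 - ratr q1 :> R by rewrite subr_gt0.
have ind : mutually_independent (fun p : upper_index n => Q (val p).1 (val p).2).
  by case: goeQ.
apply: (@negligible_determined _ _ p _ (2 / (ratr q2 - ratr q1))
   (2 * normal_peak (entry_sd p)) ind).
- by rewrite divr_ge0 // ltW.
- by rewrite mulr_ge0 // normal_peak_ge0.
- move=> a e e0; rewrite GOE_marginal; last exact: measurable_itv.
  have ae : a - e <= a + e by lra.
  apply: le_trans (normal_prob_itv_le (s := entry_sd p) ae _) _.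
    by move=> x _; apply: normal_pdf_ub; exact: entry_sd_neq0.
  rewrite lee_fin; have -> : a + e - (a - e) = 2 * e by ring.
  by rewrite mulrA [_ * 2]mulrC.
have half e w w' : 0 < e -> F (p, (q1, q2)) w -> F (p, (q1, q2)) w' ->
    (forall i : upper_index n, i != p ->
       `|Q (val i).1 (val i).2 w - Q (val i).1 (val i).2 w'| <= e) ->
    Q (val p).1 (val p).2 w <= Q (val p).1 (val p).2 w' ->
    Q (val p).1 (val p).2 w' - Q (val p).1 (val p).2 w <= 2 / (ratr q2 - ratr q1) * e.
  move=> e0 [X [_ [oX _ X1 _ _]]] [_ [Y [_ oY _ Y2 _]]] close le.
  rewrite mulrAC ler_pdivlMr //.
  have := @optimal_entry_gap R n (random_matrix Q w) (random_matrix Q w') X Y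
    (val p).1 (val p).2 e (ratr q1) (ratr q2).
  rewrite !mxE; apply=> //; [|exact: GOE_sym|exact: GOE_sym|exact: ltW|exact: ltW].
  move=> i j ne1 ne2; rewrite !mxE distrC.
  have [r rij] := upper_index_of i j.
  have rp : r != p.
    apply/eqP => rp; case: rij; rewrite rp => e'.
      by move: ne1; rewrite -e' -surjective_pairing eqxx.
    by move: ne2; rewrite e' /= eqxx.
  have := close r rp; case: rij => -> //=.
  by case: goeQ => sQ _ _ _; rewrite (sQ j i w) (sQ j i w').
move=> e w w' e0 Fw Fw' close.
have [le|lt] := leP (Q (val p).1 (val p).2 w) (Q (val p).1 (val p).2 w').
  by rewrite distrC ger0_norm ?subr_ge0 //; exact: half.
rewrite ger0_norm ?subr_ge0 ?(ltW lt) //; apply: (half e w' w) => //; last exact: ltW.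
by move=> i ip; rewrite distrC; exact: close.
Qed.

End GOEMatrix.
End AlmostSureUnique.

(** * Gaussian tails *)

Section NormalTail.
Context (R : realType).
Implicit Types (s x y t : R).

Definition normal_cdf s x : R := fine (normal_prob 0 s `]-oo, x]).

Lemma normal_cdfE s x : (normal_cdf s x)%:E = normal_prob 0 s `]-oo, x].
Proof. by rewrite /normal_cdf fineK // fin_num_measure. Qed.

Lemma normal_cdf_ge0 s x : 0 <= normal_cdf s x.
Proof. by rewrite -lee_fin normal_cdfE measure_ge0. Qed.

Lemma normal_cdf_le1 s x : normal_cdf s x <= 1.
Proof. by rewrite -lee_fin normal_cdfE probability_le1. Qed.

Lemma normal_cdf_le s x y : x <= y -> normal_cdf s x <= normal_cdf s y.
Proof.
move=> xy; rewrite -lee_fin !normal_cdfE; apply: le_measure; rewrite ?inE //.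
by apply: subset_itvl; rewrite bnd_simp.
Qed.

Lemma normal_cdf_lip s x y : s != 0 -> x <= y ->
  normal_cdf s y <= normal_cdf s x + normal_peak s * (y - x).
Proof.
move=> s0 xy; rewrite -lee_fin EFinD !normal_cdfE.
apply: (@le_trans _ _ (normal_prob 0 s (`]-oo, x] `|` `[x, y])))%E.
  apply: le_measure; rewrite ?inE //; first exact: measurableU.
  move=> z /=; rewrite !in_itv /= => zy; case: (leP z x) => [|/ltW] zx; first by left.
  by right; rewrite zx zy.
apply: le_trans (measureU2 _ _ _) _ => //.
apply: leeD2l; apply: normal_prob_itv_le => // z _; exact: normal_pdf_ub.
Qed.

Lemma continuous_normal_cdf s : s != 0 -> continuous (normal_cdf s).
Proof.
move=> s0 x; apply/(@cvgrPdist_le R) => e e0.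
have p0 := normal_peak_gt0 s0.
near=> y.
have d : `|x - y| <= e / normal_peak s.
  by near: y; apply: cvgr_dist_le => //; rewrite divr_gt0.
have H a b : a <= b -> `|a - b| <= e / normal_peak s ->
    `|normal_cdf s a - normal_cdf s b| <= e.
  move=> ab dab; have h1 := normal_cdf_le s ab; have h2 := normal_cdf_lip s0 ab.
  rewrite distrC ger0_norm ?subr_ge0 //; rewrite distrC ger0_norm ?subr_ge0 // in dab.
  by move: dab; rewrite ler_pdivlMr // mulrC => dab; lra.
have [xy|/ltW yx] := leP x y; first exact: H.
by rewrite distrC; apply: H => //; rewrite distrC.
Unshelve. all: by end_near. Qed.

Lemma normal_pdf_E s x : s != 0 ->
  normal_pdf 0 s x = normal_peak s * expR (- x ^+ 2 / (s ^+ 2 *+ 2)).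
Proof. by move=> s0; rewrite normal_pdfE // /normal_fun subr0. Qed.

Lemma expRN1_le_half : expR (-1) <= 2^-1 :> R.
Proof.
rewrite expRN lef_pV2 ?posrE ?expR_gt0 //.
by apply: le_trans (expR_ge1Dx _); lra.
Qed.

(* Cut the tail into intervals of length [t^-1], on which the density decays
   at least geometrically with ratio 1/2. *)
Lemma normal_tail_le s t : 0 < s -> s <= 1 -> 1 <= t ->
  normal_cdf s (- t) <= 2 * normal_peak s * expR (- t ^+ 2 / (s ^+ 2 *+ 2)) / t.
Proof.
move=> s0 s1 t1; have t0 : 0 < t by lra.
have sn0 : s != 0 by rewrite gt_eqF.
set E := expR _; set c := 2 * _ * _ / _.
have c0 : 0 <= c.
  by rewrite /c divr_ge0 ?(ltW t0) // mulr_ge0 ?expR_ge0 // mulr_ge0 // normal_peak_ge0.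
(* The target c is written as the geometric series of c / 2^(j+1), to be matched interval by
   interval. *)
rewrite -lee_fin normal_cdfE; apply: le_trans (epsilon_trick0 xpredT c0).
pose F (j : nat) : set R := `[- t - j.+1%:R / t, - t - j%:R / t]%classic.
apply: le_trans (measure_sigma_subadditive (normal_prob 0 s) (F := F) _ _ _) _.
- by move=> j; exact: measurable_itv.
- exact: measurable_itv.
- move=> x /=; rewrite in_itv /= => xt.
  have h : 0 <= (- x - t) * t by rewrite mulr_ge0 ?(ltW t0) //; lra.
  exists (Num.truncn ((- x - t) * t)) => //; rewrite /F /= in_itv /=.
  have /andP[h1 h2] := truncn_itv h.
  set j := Num.truncn _ in h1 h2 *.
  have h3 : - x - t <= j.+1%:R / t by rewrite ler_pdivlMr // ltW.
  have h4 : j%:R / t <= - x - t by rewrite ler_pdivrMr.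
  by apply/andP; split; lra.
apply: lee_nneseries => [j _ _|j _]; first exact: measure_ge0.
have le : - t - j.+1%:R / t <= - t - j%:R / t.
  by rewrite lerB // ler_pM2r ?invr_gt0 // ler_nat.
apply: le_trans (@normal_prob_itv_le _ s _ _ (normal_peak s * (E * 2^-1 ^+ j)) le _) _.
  move=> x /andP[_ hx]; rewrite normal_pdf_E //; apply: ler_wpM2l; first exact: normal_peak_ge0.
  apply: (@le_trans _ _ (E * expR (-1) ^+ j)); last first.
    apply: ler_wpM2l; first exact: expR_ge0.
    by apply: lerXn2r; rewrite ?nnegrE ?expR_ge0 ?invr_ge0 //; exact: expRN1_le_half.
  (* On the j-th interval x^2 >= (t + j / t)^2 >= t^2 + 2 j; with s <= 1 the exponent drops by at
     least j. *)
  rewrite -expRM_natl -expRD ler_expR.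
  have s2 : 0 < s ^+ 2 *+ 2 by rewrite mulrn_wgt0 // exprn_gt0.
  rewrite mulrN1 -[leRHS](@mulfK _ (s ^+ 2 *+ 2)) ?gt_eqF //.
  rewrite ler_pM2r ?invr_gt0 // mulrDl mulfVK ?gt_eqF //.
  have hj : 0 <= j%:R / t by rewrite divr_ge0 // ltW.
  have hx2 : (t + j%:R / t) ^+ 2 <= x ^+ 2.
    rewrite -[leRHS]sqrrN; apply: lerXn2r; rewrite ?nnegrE; lra.
  have hx3 : t ^+ 2 + 2 * j%:R <= (t + j%:R / t) ^+ 2.
    have -> : (t + j%:R / t) ^+ 2 = t ^+ 2 + 2 * j%:R + (j%:R / t) ^+ 2.
      by field; rewrite gt_eqF.
    by rewrite lerDl sqr_ge0.
  have hs : j%:R * (s ^+ 2 *+ 2) <= 2 * j%:R.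
    rewrite mulrC; apply: ler_wpM2r; rewrite ?ler0n // -[leRHS]/(1 *+ 2) lerMn2r.
    by rewrite expr_le1 // ltW.
  by rewrite mulNr; lra.
rewrite lee_fin; have -> : - t - j%:R / t - (- t - j.+1%:R / t) = t^-1.
  by rewrite -natr1; field; rewrite gt_eqF.
rewrite natrX exprS /c exprVn le_eqVlt; apply/orP; left; apply/eqP.
by field; rewrite (gt_eqF t0) expf_neq0 // pnatr_eq0.
Qed.

(** A single interval of length 1 / t suffices: on it x^2 <= (t + 1 / t)^2 <= t^2 + 3, which is the
    origin of the factor exp(-3/2). *)
Lemma normal_tail_ge t : 1 <= t ->
  normal_peak 1 * expR (- 3 / 2) * expR (- t ^+ 2 / 2) / t <= normal_cdf 1 (- t).
Proof.
move=> t1; have t0 : 0 < t by lra.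
have n1 : (1 : R) != 0 by exact: oner_neq0.
rewrite -lee_fin normal_cdfE.
have le : - t - t^-1 <= - t by rewrite gerDl oppr_le0 invr_ge0 ltW.
apply: (@le_trans _ _ (normal_prob 0 1 `[- t - t^-1, - t]%classic)); last first.
  by apply: le_measure; rewrite ?inE //; move=> x /=; rewrite !in_itv /= => /andP[].
apply: le_trans (@normal_prob_itv_ge _ 1 _ _
  (normal_peak 1 * expR (- 3 / 2) * expR (- t ^+ 2 / 2)) le _ _).
- by have -> : - t - (- t - t^-1) = t^-1 by ring. 
- by rewrite !mulr_ge0 ?expR_ge0 // normal_peak_ge0.
move=> x /andP[h1 h2]; rewrite normal_pdf_E // -mulrA; apply: ler_wpM2l.
  exact: normal_peak_ge0.
rewrite -expRD ler_expR expr1n -[X in _ <= _ / X]/(2 : R) -mulrDl ler_pM2r ?invr_gt0 //.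
have ti0 : 0 < t^-1 by rewrite invr_gt0.
have ti : t^-1 <= 1 by rewrite invf_le1.
have : x ^+ 2 <= (t + t^-1) ^+ 2.
  by rewrite -[leLHS]sqrrN; apply: lerXn2r; rewrite ?nnegrE; lra.
have -> : (t + t^-1) ^+ 2 = t ^+ 2 + 2 + t^-1 ^+ 2 by field; rewrite gt_eqF.
have : t^-1 ^+ 2 <= 1 by rewrite expr_le1 // ltW.
lra.
Qed.

End NormalTail.

(** * Four defect edges *)

Section Levels.
Context (R : realType).

Definition off_sd : R := Num.sqrt 2^-1.

Lemma off_sd_gt0 : 0 < off_sd.
Proof. by rewrite sqrtr_gt0 invr_gt0. Qed.

Lemma off_sd_sqr : off_sd ^+ 2 = 2^-1.
Proof. by rewrite sqr_sqrtr // invr_ge0. Qed.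

(* Both tails are explicit up to the factor t, and the exponent of the
   off-diagonal tail is twice that of the diagonal one. *)
Lemma off_diag_tail : exists2 C : R, 0 < C & forall t, 1 <= t ->
  normal_cdf off_sd (- t) <= C * t * normal_cdf 1 (- t) ^+ 2.
Proof.
have s0 := off_sd_gt0; have sn0 : off_sd != 0 by rewrite gt_eqF.
pose c : R := normal_peak 1 * expR (- 3 / 2).
have c0 : 0 < c by rewrite mulr_gt0 ?expR_gt0 // normal_peak_gt0 // oner_neq0.
exists (2 * normal_peak off_sd / c ^+ 2).
  by rewrite divr_gt0 ?exprn_gt0 // mulr_gt0 // normal_peak_gt0.
move=> t t1; have t0 : 0 < t by lra.
have s1 : off_sd <= 1.
  rewrite -(@expr_le1 _ 2) // ?off_sd_sqr ?(ltW s0) //; lra.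
apply: le_trans (normal_tail_le s0 s1 t1) _.
have -> : off_sd ^+ 2 *+ 2 = 1 :> R.
  by rewrite off_sd_sqr -[LHS]mulr_natr mulVf // pnatr_eq0.
rewrite divr1.
have := normal_tail_ge t1; rewrite -/c.
set E := expR (- t ^+ 2 / 2) => h.
have -> : expR (- t ^+ 2) = E ^+ 2.
  by rewrite /E -expRM_natl; congr expR; field.
have h2 : (c * E / t) ^+ 2 <= normal_cdf 1 (- t) ^+ 2.
  apply: lerXn2r; rewrite ?nnegrE ?normal_cdf_ge0 //.
  by rewrite divr_ge0 ?(ltW t0) // mulr_ge0 ?expR_ge0 // ltW.
set p := normal_peak off_sd.
have -> : 2 * p * E ^+ 2 / t = 2 * p / c ^+ 2 * t * (c * E / t) ^+ 2.
  by field; rewrite !gt_eqF.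
apply: ler_wpM2l h2; rewrite mulr_ge0 ?(ltW t0) // divr_ge0 ?sqr_ge0 //.
by rewrite mulr_ge0 // normal_peak_ge0.
Qed.

Lemma normal_cdf_le_expR t : 1 <= t -> normal_cdf (1 : R) (- t) <= expR (- t ^+ 2 / 2).
Proof.
move=> t1; have t0 : 0 < t by lra.
apply: le_trans (normal_tail_le ltr01 (lexx 1) t1) _.
have -> : (1 : R) ^+ 2 *+ 2 = 2 by rewrite expr1n.
set E := expR _.
have p1 : 2 * normal_peak (1 : R) <= 1.
  rewrite /normal_peak expr1n mul1r.
  have p2 : 2 <= Num.sqrt (pi *+ 2 : R).
    have -> : 2 = Num.sqrt (2 ^+ 2 : R) by rewrite sqrtr_sqr ger0_norm.
    rewrite ler_sqrt; have := pi_ge2 R; rewrite -mulr_natr ?mulr_ge0; lra.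
  by rewrite ler_pdivrMr ?mul1r //; lra.
rewrite ler_pdivrMr //; apply: (@le_trans _ _ (1 * E)).
  by apply: ler_wpM2r => //; exact: expR_ge0.
by rewrite mul1r ler_peMr // expR_ge0.
Qed.

Lemma normal_quantile (v : R) : 0 < v -> v <= normal_cdf 1 (- 1) ->
  exists2 t, 1 <= t & normal_cdf 1 (- t) = v.
Proof.
move=> v0 v1.
(* From (T - 1)^2 >= 0 follows 1 + T^2 / 2 >= T >= 1 / v, so exp(-T^2 / 2) <= v and the level v is
   bracketed. *)
pose T := 1 + v^-1.
have vi0 : 0 < v^-1 by rewrite invr_gt0.
have T1 : 1 <= T by rewrite /T; lra.
have hT : normal_cdf 1 (- T) <= v.
  apply: le_trans (normal_cdf_le_expR T1) _.
  rewrite mulNr expRN -[leRHS]invrK lef_pV2 ?posrE ?expR_gt0 //.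
  apply: le_trans (expR_ge1Dx _).
  have : 0 <= (T - 1) ^+ 2 by exact: sqr_ge0.
  have -> : (T - 1) ^+ 2 = T ^+ 2 - 2 * T + 1 by ring.
  rewrite /T; set u := v^-1 in vi0 *; set q := (1 + u) ^+ 2 => h; lra.
have le : - T <= - 1 by rewrite lerN2.
have [||c] := @IVT _ (normal_cdf 1) (- T) (- 1) v le.
- by apply: continuous_subspaceT; apply: continuous_normal_cdf; exact: oner_neq0.
- by rewrite ge_min le_max hT v1 orbT.
rewrite in_itv /= => /andP[c1 c2] cE; exists (- c); last by rewrite opprK.
lra.
Qed.

(** The source of the logarithm: all levels in use are at least 1 / N, so the factor t in the
    comparison of the two tails is at most sqrt(2 ln N). *)
Lemma quantile_le (t : R) (N : nat) : (0 < N)%N -> 1 <= t ->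
  N%:R^-1 <= normal_cdf 1 (- t) -> t ^+ 2 <= 2 * ln N%:R.
Proof.
move=> N0 t1 h; have h1 := le_trans h (normal_cdf_le_expR t1).
have Np : 0 < N%:R :> R by rewrite ltr0n.
have : ln (N%:R^-1) <= ln (expR (- t ^+ 2 / 2)).
  by rewrite ler_ln ?posrE ?invr_gt0 ?expR_gt0.
by rewrite expRK lnV ?posrE // mulNr lerN2 ler_pdivrMr // mulrC.
Qed.

Lemma expR_pow (x : R) (m : nat) : 0 <= x -> (0 < m)%N -> (x / m%:R) ^+ m <= expR x.
Proof.
move=> x0 m0; have mp : 0 < m%:R :> R by rewrite ltr0n.
have -> : expR x = expR (x / m%:R) ^+ m.
  by rewrite -expRM_natl mulrCA mulfV ?gt_eqF // mulr1.
apply: lerXn2r; rewrite ?nnegrE ?expR_ge0 ?divr_ge0 // ?(ltW mp) //.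
by apply: le_trans (expR_ge1Dx _); rewrite lerDr.
Qed.

Lemma sum_inv_sqr (m : nat) : \sum_(k < m) (k.+1%:R ^- 2 : R) <= 2.
Proof.
case: m => [|m]; first by rewrite big_ord0.
suff h : \sum_(k < m.+1) (k.+1%:R ^- 2 : R) <= 2 - m.+1%:R^-1.
  by apply: le_trans h _; rewrite gerBl invr_ge0 ler0n.
elim: m => [|m IH]; first by rewrite big_ord1 expr1n invr1; lra.
rewrite big_ord_recr /=; apply: le_trans (lerD IH (lexx _)) _.
rewrite -addrA lerD2l -subr_ge0.
have m0 : 0 < m.+1%:R :> R by rewrite ltr0n.
rewrite -[m.+2%:R]natr1; set x : R := m.+1%:R in m0 *.
have -> : - (x + 1)^-1 - (- x^-1 + (x + 1) ^- 2) = (x * (x + 1) ^+ 2)^-1.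
  by field; rewrite !gt_eqF // ltr_wpDr.
by rewrite invr_ge0 mulr_ge0 ?sqr_ge0 // ltW.
Qed.

End Levels.

Section FourEdges.
Context d (T : measurableType d) (R : realType) (P : probability T R).

Lemma le_probability (A B : set T) : measurable A -> measurable B -> A `<=` B ->
  (P A <= P B)%E.
Proof. by move=> mA mB AB; apply: le_measure; rewrite ?inE. Qed.

Lemma measurable_forall (I : finType) (F : I -> set T) :
  (forall i, measurable (F i)) -> measurable [set w | forall i, F i w].
Proof.
move=> mF; rewrite (_ : mkset _ = \bigcap_i F i).
  by apply: fin_bigcap_measurable => //; exact: finite_finset.
by apply/seteqP; split=> w h i //; exact: h.
Qed.

Lemma probability_bigU_le (I : Type) (r : seq I) (F : I -> set T) :
  (forall i, measurable (F i)) ->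
  (P (\big[setU/set0]_(i <- r) F i) <= \sum_(i <- r) P (F i))%E.
Proof.
move=> mF; elim: r => [|i r IH]; first by rewrite !big_nil measure0.
rewrite !big_cons; apply: le_trans (measureU2 _ _ _) _ => //.
  exact: bigsetU_measurable.
exact: leeD2l.
Qed.

Context (n : nat) (Q : 'I_n -> 'I_n -> {RV P >-> R}) (goeQ : GOE Q).
Notation U := (upper_index n).

Definition diag_index (i : 'I_n) : U := Sub (i, i) (leqnn i).

Definition diag_indices : {set U} := [set p | (val p).1 == (val p).2]%SET.

Lemma card_diag_indices : #|diag_indices| = n.
Proof.
have -> : diag_indices = [set diag_index i | i in 'I_n]%SET.
  apply/setP => p; rewrite inE; apply/eqP/imsetP => [e|[i _ ->] //].
  by exists (val p).1 => //; apply: val_inj => /=; rewrite {2}e -surjective_pairing.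
rewrite card_imset ?card_ord // => i j e.
by have /(congr1 val)[] := e.
Qed.

Let entry (p : U) := Q (val p).1 (val p).2.

Let indQ : mutually_independent entry. Proof. by case: goeQ. Qed.

Let entry_marginal p (B : set R) : measurable B ->
  P (entry p @^-1` B) = normal_prob 0 (entry_sd R p) B.
Proof. exact: (GOE_marginal goeQ). Qed.

Lemma normal_prob_gt (a : R) :
  normal_prob 0 1 `]a, +oo[ = (1 - normal_cdf 1 a)%:E.
Proof.
rewrite EFinB normal_cdfE -probability_setC ?setCitvl //; exact: measurable_itv.
Qed.

Lemma prob_diag_gt a :
  P [set w | forall i, a < Q i i w] = ((1 - normal_cdf 1 a) ^+ n)%:E.
Proof.
have := indQ diag_indices (B := fun=> `]a, +oo[%classic) (fun=> measurable_itv `]a, +oo[).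
rewrite (_ : mkset _ = [set w | forall i, a < Q i i w]); last first.
  apply/seteqP; split=> w /= h i; last by rewrite inE in_itv /= andbT => /eqP e;
    have := h (val i).1; rewrite {2}e.
  by have := h (diag_index i); rewrite inE /= eqxx in_itv /= andbT; apply.
move=> ->; rewrite (eq_bigr (fun=> (1 - normal_cdf 1 a)%:E)); last first.
  move=> p; rewrite inE => pd; rewrite entry_marginal; last exact: measurable_itv.
  by rewrite /entry_sd pd normal_prob_gt.
by rewrite prodEFin prodr_const card_diag_indices.
Qed.

Context (f : 'I_4 -> U) (injf : injective f).
Hypothesis offf : forall k, (val (f k)).1 != (val (f k)).2.

Lemma prob_edges_le b :
  P [set w | forall k, entry (f k) w <= b] = (normal_cdf (off_sd R) b ^+ 4)%:E.
Proof.
have := indQ [set f k | k in 'I_4]%SET (B := fun=> `]-oo, b]%classic)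
  (fun=> measurable_itv `]-oo, b]).
rewrite (_ : mkset _ = [set w | forall k, entry (f k) w <= b]); last first.
  apply/seteqP; split=> w /= h.
    by move=> k; have := h (f k); rewrite imset_f // in_itv /=; apply.
  by move=> p /imsetP[k _ ->]; rewrite in_itv /=.
move=> ->; rewrite (eq_bigr (fun=> (normal_cdf (off_sd R) b)%:E)); last first.
  move=> p /imsetP[k _ ->]; rewrite entry_marginal; last exact: measurable_itv.
  by rewrite /entry_sd (negPf (offf k)) normal_cdfE.
by rewrite prodEFin prodr_const card_imset // card_ord.
Qed.

Lemma prob_diag_gt_edges_le a b :
  P [set w | (forall i, a < Q i i w) /\ (forall k, entry (f k) w <= b)] =
  ((1 - normal_cdf 1 a) ^+ n * normal_cdf (off_sd R) b ^+ 4)%:E.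
Proof.
pose B (p : U) : set R := if p \in diag_indices then `]a, +oo[%classic else `]-oo, b]%classic.
have mB p : measurable (B p) by rewrite /B; case: ifP => _; exact: measurable_itv.
pose E := [set f k | k in 'I_4]%SET.
have nd k : f k \notin diag_indices by rewrite inE offf.
have := indQ (diag_indices :|: E)%SET mB.
rewrite (_ : mkset _ = [set w | (forall i, a < Q i i w) /\ (forall k, entry (f k) w <= b)]);
    last first.
  apply/seteqP; split=> w /= => [h|[h1 h2] p].
    split=> [i|k].
      have := h (diag_index i); rewrite /B !inE /= eqxx => /(_ isT).
      by rewrite /= in_itv /= andbT.
    have := h (f k); rewrite /B finset.in_setU (negPf (nd k)) imset_f // => /(_ isT).
    by rewrite /= in_itv.
  rewrite finset.in_setU /B; case: ifP => [pd _|_ /imsetP[k _ ->]]; rewrite /= in_itv /=.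
    by move: pd; rewrite andbT inE => /eqP e; have := h1 (val p).1; rewrite {2}e.
  exact: h2.
move=> ->; rewrite (bigID (mem diag_indices)) /=.
rewrite (eq_bigl (mem diag_indices)); last first.
  by move=> p; rewrite /= finset.in_setU; case: (p \in diag_indices); rewrite ?andbF ?andbT.
rewrite [X in (_ * X)%E](eq_bigl (mem E)); last first.
  move=> p; rewrite /= finset.in_setU; case: (boolP (p \in E)) => [/imsetP[k _ ->]|_].
    by rewrite nd orbT.
  by rewrite orbF andbN.
rewrite (eq_bigr (fun=> (1 - normal_cdf 1 a)%:E)); last first.
  move=> p /= pd; rewrite entry_marginal // /B pd.
  move: pd; rewrite inE /entry_sd => ->.
  exact: normal_prob_gt.
rewrite [X in (_ * X)%E](eq_bigr (fun=> (normal_cdf (off_sd R) b)%:E)); last first.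
  move=> p /imsetP[k _ ->]; rewrite entry_marginal // /B (negPf (nd k)).
  by rewrite /entry_sd (negPf (offf k)) normal_cdfE.
rewrite !prodEFin !prodr_const card_diag_indices card_imset // card_ord.
by rewrite EFinM.
Qed.

Let Ev := [set w | forall k i, entry (f k) w < Q i i w].

Lemma measurable_edges_lt_diag : measurable Ev.
Proof.
apply: (@measurable_forall _ (fun k => [set w | forall i, entry (f k) w < Q i i w])) => k.
apply: (@measurable_forall _ (fun i => [set w | entry (f k) w < Q i i w])) => i.
by apply: measurable_set_lt; exact: RV_measurable.
Qed.

(** Slice k describes a diagonal minimum between levels k and k + 1; the upper level is kept only
    through its consequence for the four edges. Below level 1 there is no lower condition, hence
    [setT]. *)
Let lower (a : nat -> R) k :=
  if k is k'.+1 then [set w | forall i, a k'.+1 < Q i i w] else setT.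
Let upper (a : nat -> R) k := [set w | forall j, entry (f j) w <= a k.+1].

Lemma edges_lt_diag_slices (m : nat) (a : nat -> R) :
  (P Ev <= \sum_(k < m) P (lower a k `&` upper a k) + P (lower a m))%E.
Proof.
have mdiag x : measurable [set w | forall i, x < Q i i w].
  apply: (@measurable_forall _ (fun i => [set w | x < Q i i w])) => i.
  by apply: measurable_set_lt; [exact: measurable_cst | exact: RV_measurable].
have ml k : measurable (lower a k) by case: k => [|k] //=; exact: mdiag.
have mu k : measurable (upper a k).
  apply: (@measurable_forall _ (fun j => [set w | entry (f j) w <= a k.+1])) => j.
  by apply: measurable_set_le; [exact: RV_measurable | exact: measurable_cst].
have cover : Ev `<=` \big[setU/set0]_(k < m) (lower a k `&` upper a k) `|` lower a m.
  elim: m => [|m IH] w Ew; first by right.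
  rewrite big_ord_recr /=; have [h|h] := IH w Ew; first by left; left.
  have [lw|/existsNP[i /negP]] := pselect (forall i, a m.+1 < Q i i w); first by right.
  rewrite -leNgt => le; left; right; split=> // k.
  by apply: le_trans le; apply: ltW; exact: Ew.
apply: le_trans (le_probability measurable_edges_lt_diag _ cover) _.
  by apply: measurableU => //; apply: bigsetU_measurable => k _; exact: measurableI.
apply: le_trans (measureU2 _ _ _) _ => //.
  by apply: bigsetU_measurable => k _; exact: measurableI.
apply: leeD2r; apply: probability_bigU_le => k; exact: measurableI.
Qed.

Let slice_prob (a : nat -> R) k :
  P (lower a k `&` upper a k) =
  ((if k is 0 then 1 else (1 - normal_cdf 1 (a k)) ^+ n) *
    normal_cdf (off_sd R) (a k.+1) ^+ 4)%:E.
Proof.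
case: k => [|k]; first by rewrite /= setTI mul1r; exact: prob_edges_le.
exact: prob_diag_gt_edges_le.
Qed.

Let lower_prob (a : nat -> R) k :
  P (lower a k) = (if k is 0 then 1 else (1 - normal_cdf 1 (a k)) ^+ n)%:E.
Proof.
by case: k => [|k]; [rewrite /= probability_setT | exact: prob_diag_gt].
Qed.

(** In the first constant, 4 is the square of the 2 in t^2 <= 2 ln n, another 2 bounds the sum of
    inverse squares, and e 10^10 comes from exp(-k) (k+1)^8 <= e 10^10 / (k+1)^2. The second summand
    pays for a minimum above the last level. *)
Lemma four_edges_bound (C : R) : 0 < C -> (1 < n)%N ->
  (forall t, 1 <= t ->
     normal_cdf (off_sd R) (- t) <= C * t * normal_cdf 1 (- t) ^+ 2) ->
  (P Ev <= ((8 * C ^+ 4 * (expR 1 * 10 ^+ 10) +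
     expR 1 * (8 / normal_cdf 1 (- 1)) ^+ 8 / ln 2 ^+ 2) *
     (ln n%:R ^+ 2 / n%:R ^+ 8))%:E)%E.
Proof.
move=> C0 n1 hC; set ka := normal_cdf 1 (- 1).
have np : 0 < n%:R :> R by rewrite ltr0n ltnW.
have nn : n%:R != 0 :> R by rewrite gt_eqF.
have ka0 : 0 < ka.
  apply: lt_le_trans (normal_tail_ge (lexx 1)).
  by rewrite divr1 !mulr_gt0 ?expR_gt0 // normal_peak_gt0 // oner_neq0.
(* The level k / n is attained at some -t with t >= 1 only while k / n <= [ka]. Beyond the last
   level the probability is at most exp(-K), with K close to [ka] n. *)
pose K := Num.truncn (ka * n%:R).
have /andP[K1 K2] : K%:R <= ka * n%:R < K.+1%:R by apply: truncn_itv; rewrite mulr_ge0 ?ltW.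
have ext k : exists t : R, (0 < k <= K)%N ->
    1 <= t /\ normal_cdf 1 (- t) = k%:R / n%:R.
  have [/andP[k0 kK]|_] := boolP (0 < k <= K)%N; last by exists 0.
  have [||t t1 tE] := @normal_quantile R (k%:R / n%:R).
  - by rewrite divr_gt0 // ltr0n.
  - by rewrite ler_pdivrMr //; apply: le_trans K1; rewrite ler_nat.
  by exists t.
pose t k := sval (cid (ext k)).
have tP k : (0 < k <= K)%N -> 1 <= t k /\ normal_cdf 1 (- t k) = k%:R / n%:R.
  by rewrite /t; case: (cid (ext k)) => x /= h; exact: h.
pose a k := - t k.
pose x k : R := if k is 0 then 1 else (1 - normal_cdf 1 (a k)) ^+ n.
have xle k : (k <= K)%N -> x k <= expR (- k%:R).
  case: k => [|k] kK; first by rewrite /= oppr0 expR0.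
  have [_ e] := tP k.+1 kK; rewrite /x /a e.
  have -> : - k.+1%:R = n%:R * (- (k.+1%:R / n%:R)) :> R by rewrite mulrN mulrCA mulfV ?mulr1.
  rewrite expRM_natl; apply: lerXn2r; rewrite ?nnegrE ?expR_ge0 //.
    by rewrite -e subr_ge0 normal_cdf_le1.
  exact: expR_ge1Dx.
have x0 k : 0 <= x k.
  by case: k => [|k] //; rewrite exprn_ge0 // subr_ge0 normal_cdf_le1.
set L := ln n%:R.
have L2 : ln 2 <= L by rewrite ler_ln ?posrE // ler_nat.
have l20 : 0 < ln (2 : R) by rewrite ln_gt0 // ltr1n.
have L0 : 0 < L by exact: lt_le_trans L2.
have yle k : (k < K)%N -> normal_cdf (off_sd R) (a k.+1) ^+ 4 <=
    4 * C ^+ 4 * (L ^+ 2 / n%:R ^+ 8) * k.+1%:R ^+ 8.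
  move=> kK; have [t1 e] := tP k.+1 kK.
  have t0 : 0 <= t k.+1 by lra.
  have h := hC _ t1; rewrite e in h.
  have h2 : t k.+1 ^+ 2 <= 2 * L.
    apply: quantile_le => //; first exact: ltnW.
    by rewrite e ler_pdivlMr // mulVf // ler1n.
  apply: le_trans (lerXn2r 4 _ _ h) _; rewrite ?nnegrE ?normal_cdf_ge0 //.
    by rewrite !mulr_ge0 ?sqr_ge0 // ltW.
  have -> : (C * t k.+1 * (k.+1%:R / n%:R) ^+ 2) ^+ 4 =
    (t k.+1 ^+ 2) ^+ 2 * (C ^+ 4 / n%:R ^+ 8 * k.+1%:R ^+ 8) by field.
  have -> : 4 * C ^+ 4 * (L ^+ 2 / n%:R ^+ 8) * k.+1%:R ^+ 8 =
    (2 * L) ^+ 2 * (C ^+ 4 / n%:R ^+ 8 * k.+1%:R ^+ 8) by field.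
  apply: ler_wpM2r.
    by rewrite mulr_ge0 ?exprn_ge0 ?ler0n // divr_ge0 ?exprn_ge0 ?ler0n // ltW.
  by apply: lerXn2r; rewrite ?nnegrE ?sqr_ge0 // mulr_ge0 // ltW.
(* The exponent 10 is 8 + 2: eight powers absorb the edge probabilities, and two make the sum over k
   converge. *)
have zle (k : nat) : expR (- k%:R : R) * k.+1%:R ^+ 8 <= (expR 1 * 10 ^+ 10) * k.+1%:R ^- 2.
  have kp : 0 < k.+1%:R :> R by rewrite ltr0n.
  have := @expR_pow R k.+1%:R 10 (ltW kp) isT.
  rewrite -{2}natr1 expRD expr_div_n ler_pdivrMr ?exprn_gt0 // => h.
  rewrite expRN ler_pdivrMl ?expR_gt0 // mulrA ler_pdivlMr ?exprn_gt0 //.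
  by rewrite -exprD mulrA.
(* Since K + 1 > [ka] n, exp(-K) <= e exp(-[ka] n); [expR_pow] with exponent 8 gives n^-8, and the
   factor (ln n / ln 2)^2 >= 1 supplies the logarithm. *)
have wle : x K <= expR 1 * (8 / ka) ^+ 8 / ln 2 ^+ 2 * (L ^+ 2 / n%:R ^+ 8).
  apply: le_trans (xle K (leqnn K)) _.
  have kn : 0 < ka * n%:R by exact: mulr_gt0.
  apply: (@le_trans _ _ (expR 1 * expR (- (ka * n%:R)))).
    by rewrite -expRD ler_expR; move: K2; rewrite -natr1; lra.
  rewrite -[leRHS]mulrA -[leRHS]mulrA; apply: ler_wpM2l; first exact: expR_ge0.
  have h := @expR_pow R (ka * n%:R) 8 (ltW kn) isT.
  have h2 : expR (- (ka * n%:R)) <= ((8 / ka) ^+ 8 / n%:R ^+ 8).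
    rewrite expRN -[leRHS]invrK lef_pV2 ?posrE ?expR_gt0 //; last first.
      by rewrite invr_gt0 divr_gt0 ?exprn_gt0 // divr_gt0.
    apply: le_trans h; rewrite le_eqVlt; apply/orP; left; apply/eqP.
    by field; rewrite nn gt_eqF //.
  apply: le_trans h2 _.
  have -> : (8 / ka) ^+ 8 * ((ln 2 ^+ 2)^-1 * (L ^+ 2 / n%:R ^+ 8)) =
     (8 / ka) ^+ 8 / n%:R ^+ 8 * (L ^+ 2 / ln 2 ^+ 2).
    by field; rewrite nn (gt_eqF l20) (gt_eqF ka0).
  rewrite ler_peMr //.
    by rewrite divr_ge0 ?exprn_ge0 ?ler0n // divr_ge0 // ltW.
  rewrite ler_pdivlMr ?exprn_gt0 // mul1r.
  by apply: lerXn2r; rewrite ?nnegrE // ltW.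
apply: le_trans (edges_lt_diag_slices K a) _.
rewrite lower_prob -/(x K).
under eq_bigr => k _ do rewrite slice_prob -/(x k).
rewrite sumEFin -EFinD lee_fin [leRHS]mulrDl; apply: lerD wle.
set D := 4 * C ^+ 4 * (L ^+ 2 / n%:R ^+ 8) in yle.
have D0 : 0 <= D.
  by rewrite /D mulr_ge0 // ?mulr_ge0 ?exprn_ge0 ?invr_ge0 ?ler0n // ltW.
apply: (@le_trans _ _ (\sum_(k < K) D * (expR 1 * 10 ^+ 10) * k.+1%:R ^- 2)).
  apply: ler_sum => k _; apply: (@le_trans _ _ (expR (- k%:R) * (D * k.+1%:R ^+ 8))).
    apply: ler_pM => //; first by rewrite exprn_ge0 // normal_cdf_ge0.
      by apply: xle; exact: ltnW.
    exact: yle.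
  by rewrite mulrCA -mulrA; apply: ler_wpM2l.
rewrite -mulr_sumr.
apply: (@le_trans _ _ (D * (expR 1 * 10 ^+ 10) * 2)).
  apply: ler_wpM2l; last exact: sum_inv_sqr.
  by rewrite mulr_ge0 // mulr_ge0 ?expR_ge0 ?exprn_ge0.
by rewrite /D le_eqVlt; apply/orP; left; apply/eqP; field.
Qed.

End FourEdges.

(** * Large components *)

Lemma connect_closed_seq (T : finType) (e : rel T) (s : seq T) (i j : T) :
  (forall x y, x \in s -> e x y -> y \in s) -> i \in s -> connect e i j -> j \in s.
Proof.
move=> cl is_ /connectP[p + ->]; elim: p i is_ => //= y p IH x xs /andP[exy].
exact: IH (cl _ _ xs exy).
Qed.

(** Vertices in order of discovery, each with an earlier neighbour as parent. A list shorter than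
    the component is not closed under e, so some edge leaves it and its endpoint is appended. *)
Lemma component_tree (T : finType) (e : rel T) (i : T) (m : nat) :
  (m < #|[set j | connect e i j]%SET|)%N ->
  exists s : seq T, [/\ size s = m.+1, uniq s, i \in s &
    forall k, (0 < k <= m)%N -> exists2 l, (l < k)%N & e (nth i s l) (nth i s k)].
Proof.
elim: m => [_|m IH lt].
  by exists [:: i]; split; rewrite ?inE //; case.
have [s [sz us is_ tr]] := IH (ltnW lt).
have [x [y [xs ys exy]]] : exists x y, [/\ x \in s, y \notin s & e x y].
  apply: contrapT => no; move: lt; rewrite ltnNge; apply/negP; rewrite negbK.
  rewrite -sz -(card_uniqP us); apply: subset_leq_card.
  apply/fintype.subsetP => j; rewrite inE; apply: connect_closed_seq => // x y xs exy.
  by apply/negPn/negP => ys; apply: no; exists x, y.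
exists (rcons s y); split.
- by rewrite size_rcons sz.
- by rewrite rcons_uniq ys.
- by rewrite mem_rcons inE is_ orbT.
move=> k /andP[k0]; rewrite leq_eqVlt => /predU1P[->|km].
  exists (index x s); first by rewrite -sz index_mem.
  by rewrite !nth_rcons index_mem xs sz ltnn eqxx nth_index.
have [|l lk el] := tr k; first by rewrite k0 -ltnS.
exists l => //; rewrite !nth_rcons sz km (ltn_trans lk km) //.
Qed.

Section LargeComponents.
Context d (T : measurableType d) (R : realType) (P : probability T R) (n : nat).
Context (Q : 'I_n.+1 -> 'I_n.+1 -> {RV P >-> R}) (goeQ : GOE Q).
Notation U := (upper_index n.+1).
Notation M := (random_matrix Q).

Lemma lt_min_diag (A : 'M[R]_n.+1) x : x < min_diag A <-> forall i, x < A i i.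
Proof.
split=> [h i|h]; first by apply: lt_le_trans h _; apply: bigmin_le_cond.
by rewrite /min_diag; apply/bigmin_gtP.
Qed.

(** The pair is ordered before insertion, so the default of [insubd] is never returned. *)
Definition edge_index (i j : 'I_n.+1) : U :=
  insubd (diag_index i) (if (i <= j)%N then (i, j) else (j, i)).

Lemma val_edge_index i j : val (edge_index i j) = if (i <= j)%N then (i, j) else (j, i).
Proof.
rewrite val_insubd; case: (leqP i j) => [-> //|ji /=].
by rewrite ltnW.
Qed.

Lemma defect_edge w i j : defect (M w) i j ->
  forall k, Q (val (edge_index i j)).1 (val (edge_index i j)).2 w < Q k k w.
Proof.
rewrite /defect val_edge_index => /orP[] /andP[lt /lt_min_diag h] k.
  by have := h k; rewrite !mxE ltnW.
by have := h k; rewrite !mxE leqNgt lt.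
Qed.

Lemma measurable_defect i j : measurable [set w | defect (M w) i j].
Proof.
have mlt a b : measurable [set w | M w a b < min_diag (M w)].
  rewrite (_ : mkset _ = [set w | forall k, M w a b < M w k k]).
    apply: (@measurable_forall _ _ _ (fun k => [set w | M w a b < M w k k])) => k.
    by apply: measurable_set_lt; exact: GOE_measurable.
  by apply/seteqP; split=> w /= /lt_min_diag.
rewrite /defect; case: (ltngtP i j) => _ /=.
- by under eq_set => w do rewrite orbF; exact: mlt.
- exact: mlt.
- rewrite (_ : mkset _ = set0) //; by apply/seteqP; split.
Qed.

(** The defect graph takes finitely many values, and the event is the finite union over the graphs
    with small components. *)
Lemma measurable_defect_components_le k :
  measurable [set w | defect_components_le (M w) k].
Proof.
pose good (r : {ffun 'I_n.+1 * 'I_n.+1 -> bool}) :=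
  [forall i, #|[set j | connect (fun a b => r (a, b)) i j]%SET| <= k]%N.
rewrite (_ : mkset _ = \big[setU/set0]_(r | good r)
  [set w | forall p : 'I_n.+1 * 'I_n.+1, defect (M w) p.1 p.2 = r p]).
  apply: bigsetU_measurable => r _.
  apply: (@measurable_forall _ _ _ (fun p : 'I_n.+1 * 'I_n.+1 =>
    [set w | defect (M w) p.1 p.2 = r p])) => p.
  case: (r p); first exact: measurable_defect.
  rewrite (_ : mkset _ = ~` [set w | defect (M w) p.1 p.2]).
    by apply: measurableC; exact: measurable_defect.
  by apply/seteqP; split=> w /= => [->|/negP/negPf].
have cE w (r : {ffun 'I_n.+1 * 'I_n.+1 -> bool}) :
    (forall p : 'I_n.+1 * 'I_n.+1, defect (M w) p.1 p.2 = r p) ->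
    forall i, defect_component (M w) i = [set j | connect (fun a b => r (a, b)) i j]%SET.
  move=> h i; apply/setP => j; rewrite !inE; apply: eq_connect => a b.
  exact: (h (a, b)).
rewrite -bigcup_seq_cond.
apply/seteqP; split=> w /=.
  move=> h; pose r : {ffun 'I_n.+1 * 'I_n.+1 -> bool} := [ffun p => defect (M w) p.1 p.2].
  have rE p : defect (M w) p.1 p.2 = r p by rewrite ffunE.
  exists r => //=; rewrite mem_index_enum /=.
  by apply/forallP => i; rewrite -(cE w r rE); exact: h.
by move=> [r /= /andP[_ /forallP g] h] i; rewrite (cE w r h).
Qed.

Definition edges_below_diag (f : 'I_4 -> U) : set T :=
  [set w | forall k i, Q (val (f k)).1 (val (f k)).2 w < Q i i w].

(** A tree is coded by its five vertices in order of discovery and by the parent of each later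
    vertex: [p.2 k] is the place of the parent of vertex k + 1, at most k. The union bound over all
    codes yields 5^4 times the fifth power of the dimension. *)
Lemma prob_large_component (B : R) :
  (forall f : 'I_4 -> U, injective f -> (forall k, (val (f k)).1 != (val (f k)).2) ->
     (P (edges_below_diag f) <= B%:E)%E) ->
  0 <= B ->
  (P (~` [set w | defect_components_le (M w) 4]) <= (5 ^+ 4 * n.+1%:R ^+ 5 * B)%:E)%E.
Proof.
move=> hB B0.
pose I := ({ffun 'I_5 -> 'I_n.+1} * {ffun 'I_4 -> 'I_5})%type.
pose f (p : I) k := edge_index (p.1 (p.2 k)) (p.1 (lift ord0 k)).
pose valid (p : I) := injectiveb p.1 && [forall k : 'I_4, (p.2 k <= k)%N].
pose F (p : I) := if valid p then
  edges_below_diag (f p) else set0.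
have mF p : measurable (F p).
  by rewrite /F; case: ifP => // _; apply: measurable_edges_lt_diag.
have PF p : (P (F p) <= B%:E)%E.
  rewrite /F; case: ifP => [/andP[/injectiveP inj /forallP par]|_]; last first.
    by rewrite measure0 lee_fin.
  apply: hB.
    move=> k l e; apply/eqP; apply: contraT => kl.
    (* Distinct tree edges are distinct entries: for k < l, vertex l + 1 comes after both endpoints
       of edge k and cannot be one of them. *)
    wlog lt : k l e kl / (k < l)%N.
      move=> H; case: (ltngtP k l) => [lt|lt|/val_inj e']; first exact: (H k l).
        by apply: (H l k) => //; rewrite eq_sym.
      by rewrite e' eqxx in kl.
    have mem : p.1 (lift ord0 l) \in [:: p.1 (p.2 k); p.1 (lift ord0 k)].
      have := congr1 val e; rewrite !val_edge_index.
      by case: ifP => _; case: ifP => _ [e1 e2]; rewrite !inE ?e1 ?e2 eqxx ?orbT.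
    move: mem; rewrite !inE => /orP[] /eqP /inj /(congr1 val) /= E.
      by have := par k; rewrite -E /bump /= add1n leqNgt ltnS ltnW // ltnW.
    by move: E lt; rewrite /bump /= !add1n => -[->]; rewrite ltnn.
  move=> k; rewrite val_edge_index.
  have ne : p.1 (p.2 k) != p.1 (lift ord0 k).
    apply/eqP => /inj /(congr1 val) /= E; have := par k.
    by rewrite E /bump /= add1n ltnn.
  by case: ifP => _ //=; rewrite eq_sym.
have cover : ~` [set w | defect_components_le (M w) 4] `<=` \big[setU/set0]_p F p.
  move=> w /= /existsNP[i /negP]; rewrite -ltnNge => big.
  have [s [sz us is_ tr]] := component_tree big.
  have ex (k : 'I_4) : exists l : 'I_5, (l <= k)%N /\
      defect (M w) (nth i s l) (nth i s k.+1).
    have [|l lk el] := tr k.+1; first exact: ltn_ord.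
    have l5 : (l < 5)%N by apply: leq_trans lk _; rewrite ltnS ltnW.
    by exists (Ordinal l5).
  pose p : I := ([ffun k : 'I_5 => nth i s k], [ffun k => sval (cid (ex k))]).
  rewrite -bigcup_seq; exists p; first by rewrite /= mem_index_enum.
  have vp : valid p.
    apply/andP; split.
      apply/injectiveP => a b; rewrite !ffunE => /eqP.
      by rewrite nth_uniq ?sz // => /eqP/val_inj.
    by apply/forallP => k; rewrite ffunE; case: cid => l [].
  rewrite /F vp => k a; rewrite /f; apply: defect_edge; rewrite !ffunE.
  by case: cid => l [].
apply: le_trans (@le_probability _ _ _ P _ _ _ _ cover) _.
- by apply: measurableC; exact: measurable_defect_components_le.
- exact: bigsetU_measurable.
apply: le_trans (@probability_bigU_le _ _ _ P _ _ _ mF) _.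
apply: (@le_trans _ _ (\sum_(p : I) B%:E)%E); first exact: lee_sum.
rewrite sumEFin lee_fin sumr_const card_prod !card_ffun !card_ord.
by rewrite -[B *+ _]mulr_natl natrM !natrX [_ ^+ 5 * _]mulrC.
Qed.

End LargeComponents.

(** * Assembly of the probability bound and of the recovery guarantee *)

Lemma dnn_unique_rank_one_of_components (R : realType) n (Q : 'M[R]_n.+1) :
  symf Q -> defect_components_le Q 4 ->
  (forall X Y, dnn_optimal Q X -> dnn_optimal Q Y -> X = Y) ->
  dnn_unique_rank_one Q.
Proof.
move=> sQ cQ uQ; have [X oX] := dnn_optimal_exists Q.
have [x sx xX] := simplex_below_feasible sQ cQ oX.1.
have ox : dnn_optimal Q (outer x).
  split; first exact: dnn_feasible_outer.
  by move=> Y fY; rewrite mxinner_outer; apply: le_trans xX _; exact: oX.2.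
exists (outer x); split=> //; last exact: rank_outer.
by move=> Y oY; exact: uQ.
Qed.

Section GOEProbability.
Context d (T : measurableType d) (R : realType) (P : probability T R) (n : nat).
Context (Q : 'I_n.+1 -> 'I_n.+1 -> {RV P >-> R}) (goeQ : GOE Q).
Notation M := (random_matrix Q).
Let E := [set w | dnn_unique_rank_one (M w)].
Let D := [set w | defect_components_le (M w) 4].

Lemma measurable_unique_rank_one : measurable E.
Proof.
by apply: measurable_dnn_unique_rank_one => i j; exact: GOE_measurable.
Qed.

Lemma prob_small_component_not_unique : P (D `\` E) = 0.
Proof.
apply/(negligibleP P).
  apply: measurableD; last exact: measurable_unique_rank_one.
  exact: measurable_defect_components_le.
apply: negligibleS (negligible_not_unique goeQ) => w [Dw Ew].
apply: contrapT => nu; apply: Ew.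
apply: dnn_unique_rank_one_of_components => //; first exact: GOE_sym.
move=> X Y oX oY; apply: contrapT => XY; apply: nu.
by exists X, Y.
Qed.

Lemma prob_recovery_event (b : R) : (P (~` D) <= b%:E)%E ->
  ((1 - b)%:E <= P (E `&` D))%E.
Proof.
move=> Db; have mE := measurable_unique_rank_one.
have mD : measurable D by exact: measurable_defect_components_le.
have mA : measurable (E `&` D) by exact: measurableI.
rewrite -[E `&` D]setCK probability_setC; last exact: measurableC.
rewrite EFinB; apply: leeB => //.
apply: (le_trans _ Db).
have -> : ~` (E `&` D) = ~` D `|` (D `\` E).
  apply/seteqP; split=> w /=.
    by case: (pselect (D w)) => Dw h; [right; split=> // Ew; apply: h | left].
  by move=> [Dw [_ /Dw]|[_ Ew] [/Ew]].
apply: (@le_trans _ _ (P (~` D) + P (D `\` E))%E).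
  by apply: measureU2; [exact: measurableC|exact: measurableD].
by rewrite prob_small_component_not_unique adde0.
Qed.

End GOEProbability.

Theorem mainTheorem3 (R : realType) :
  exists (K : R) (prog : cmd) (c : nat),
  forall (n : nat) (d : measure_display) (T : measurableType d)
         (P : probability T R) (Q : 'I_n.+1 -> 'I_n.+1 -> {RV P >-> R}),
  GOE Q ->
  let bound := 1 - K * (ln n.+1%:R ^+ 2 / n.+1%:R ^+ 3) in
  let E := [set w | dnn_unique_rank_one (random_matrix Q w)] in
  let A := E `&` [set w | defect_components_le (random_matrix Q w) 4] in
  [/\ measurable E, (bound%:E <= P E)%E,
      measurable A, (bound%:E <= P A)%E
    & forall w, A w ->
        recovers_within prog (random_matrix Q w) (c * n.+1 ^ 2) /\
        recovers_within prog (random_matrix Q w) (c * input_size n.+1)].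
Proof.
have [C C0 hC] := off_diag_tail R.
pose K0 : R := 8 * C ^+ 4 * (expR 1 * 10 ^+ 10) +
  expR 1 * (8 / normal_cdf 1 (- 1)) ^+ 8 / ln 2 ^+ 2.
have [c hc] := recovery_cmd_correct R.
exists (5 ^+ 4 * K0), recovery_cmd, c => n d T P Q goeQ bound E A.
have mE : measurable E := measurable_unique_rank_one Q.
have mA : measurable A by apply: measurableI => //; exact: measurable_defect_components_le.
have K00 : 0 <= K0.
  by rewrite addr_ge0 ?mulr_ge0 ?invr_ge0 ?exprn_ge0 ?mulr_ge0 ?invr_ge0 ?expR_ge0 ?ln_ge0
    ?normal_cdf_ge0 ?ler1n ?exprn_ge0 ?(ltW C0).
have bD : (P (~` [set w | defect_components_le (random_matrix Q w) 4]) <=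
    (5 ^+ 4 * K0 * (ln n.+1%:R ^+ 2 / n.+1%:R ^+ 3))%:E)%E.
  (* In dimension one the logarithm is zero, so the bad event must have probability zero; it is
     empty, as the only component is a single vertex. From dimension two on, [four_edges_bound]
     applies. *)
  case: n => [|n] in Q goeQ bound E A mE mA *.
    rewrite ln1 expr0n mul0r mulr0 (_ : ~` _ = set0) ?measure0 //.
    apply/seteqP; split=> // w /= h; apply: h => i.
    by apply: leq_trans (max_card _) _; rewrite card_ord.
  have -> : 5 ^+ 4 * K0 * (ln n.+2%:R ^+ 2 / n.+2%:R ^+ 3) =
      5 ^+ 4 * n.+2%:R ^+ 5 * (K0 * (ln n.+2%:R ^+ 2 / n.+2%:R ^+ 8)).
    have N0 : n.+2%:R != 0 :> R by rewrite pnatr_eq0.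
    by move: (_%:R) N0 => N N0; field.
  apply: prob_large_component => //; last first.
    by rewrite mulr_ge0 // divr_ge0 ?exprn_ge0 // ln_ge0 // ler1n.
  by move=> f fi fo; exact: four_edges_bound.
have bA : (bound%:E <= P A)%E by exact: prob_recovery_event.
split=> //.
  by apply: le_trans bA _; apply: le_measure; rewrite ?inE // => w [].
move=> w [Ew Dw]; have r := hc _ _ (GOE_sym goeQ w) Ew Dw.
by split=> //; rewrite /input_size card_prod card_ord mulnn.
Qed.
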